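(* Let $\{X_{n,t}:1\le t\le n,\ n\in\mathbb{N}\}$ be a triangular array of random variables with values in some measure space $\mathcal{X}$. Let $\mathcal{F}$ be a class of measurable functions $\mathcal{X}\to\mathbb{R}$ with $E|\varphi(X_{n,t})|<\infty$ for all $\varphi\in\mathcal{F}$, $1\le t\le n$, $n\in\mathbb{N}$. Assume that there are a real number $\gamma>0$ and an even integer $Q\ge 2$ such that the following hold. (A1) The array $\{X_{n,t}\}$ is strongly mixing with mixing coefficient $\alpha(\cdot)$ satisfying $$\sum_{t=1}^{\infty}t^{Q-2}\alpha(t)^{\frac{\gamma}{2+\gamma}}<\infty .$$ (A2) With $\rho(\varphi):=\sup_{n\in\mathbb{N}}\sup_{1\le t\le n}E[|\varphi(X_{n,t})|^2]^{1/2}$ for measurable $\varphi:\mathcal{X}\to\mathbb{R}$, $$\int_{0}^{1}x^{-\frac{\gamma}{2+\gamma}}\left(N_{[\,]}(x,\mathcal{F},\rho)\right)^{\frac{1}{Q}}dx<\infty ,$$ and, furthermore, for each $\varepsilon>0$ the bounding class $\mathcal{B}$ (in the definition of the bracketing number $N_{[\,]}(\varepsilon,\mathcal{F},\rho)$) can be chosen such that for all $i=2,\dots,Q$ $$\sup_{n\in\mathbb{N}}\sup_{1\le t\le n}E\left[|b(X_{n,t})|^{i\frac{2+\gamma}{2}}\right]^{\frac12}\le\varepsilon\quad\text{for all } b\in\mathcal{B}.$$ Let additionally, for all $K\in\mathbb{N}$ and all $\varphi_k\in\mathcal{F}$, $k=1,\dots,K$, $$\left(G_n(1,\varphi_k)\right)_{k=1,\dots,K}\overset{\mathcal{D}}{\longrightarrow}\left(G(1,\varphi_k)\right)_{k=1,\dots,K},$$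 where $G:=\{G(1,\varphi):\varphi\in\mathcal{F}\}$ is a centered Gaussian process. Then $$\left\{G_n(1,\varphi):\varphi\in\mathcal{F}\right\}\leadsto G\quad\text{in } l^\infty(\mathcal{F}).$$
   Context: Empirical process: for measurable $\varphi:\mathcal{X}\to\mathbb{R}$ and $s\in[0,1]$, $G_n(s,\varphi):=\frac{1}{\sqrt n}\sum_{i=1}^{\lfloor ns\rfloor}\left(\varphi(X_{n,i})-E[\varphi(X_{n,i})]\right)$, $n\in\mathbb{N}$. $\overset{\mathcal{D}}{\to}$ denotes convergence in distribution. Strong mixing: for a triangular array $\{X_{n,t}:1\le t\le n,n\in\mathbb{N}\}$ let, for $t\le n-1$, $$\alpha_n(t):=\sup_{1\le k\le n-t}\ \sup_{A\in\sigma(X_{n,j}:1\le j\le k),\ B\in\sigma(X_{n,j}:k+t\le j\le n)}|P(A\cap B)-P(A)P(B)|,$$ and $\alpha_n(t):=0$ for $t\ge n$. Let $\alpha(t):=\sup_{n\in\mathbb{N}}\alpha_n(t)$ for $t\in\mathbb{N}$ and $\alpha(0):=1$. The array is called strongly mixing if $\alpha(t)\to0$ as $t\to\infty$, and $\alpha(\cdot)$ is called its mixing coefficient. Bracketing number: for $\varepsilon>0$, $N_{[\,]}(\varepsilon,\mathcal{F},\rho)$ is the smallest integer $N$ for which there exist a class $\mathcal{B}$ of (measurable) functions $\mathcal{X}\to\mathbb{R}$, called bounding class, and a class $\mathcal{A}\subset\mathcal{F}$, called approximating class, such that $|\mathcal{B}|=|\mathcal{A}|=N$, $\rho(b)<\varepsilon$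 for all $b\in\mathcal{B}$, and for every $\varphi\in\mathcal{F}$ there exist $a^*\in\mathcal{A}$ and $b^*\in\mathcal{B}$ with $|\varphi-a^*|\le b^*$ (pointwise). It is $\infty$ if no such integer exists. The choice of the bounding class in (A2) is among the classes $\mathcal{B}$ that, together with some approximating class $\mathcal{A}$, satisfy these requirements with $N=N_{[\,]}(\varepsilon,\mathcal{F},\rho)$. Weak convergence: for a set $T$, $l^\infty(T)$ is the set of bounded real-valued functions on $T$ with the supremum norm and its Borel $\sigma$-algebra. For stochastic processes $Z_n=\{Z_n(t):t\in T\}$ and $Z=\{Z(t):t\in T\}$ in $l^\infty(T)$ with $Z$ Borel measurable, $Z_n\leadsto Z$ means $E^*[H(Z_n)]\to E[H(Z)]$ for all bounded continuous $H:l^\infty(T)\to\mathbb{R}$, where $E^*$ denotes outer expectation. As usual, when the limit is specified through its finite-dimensional distributions, $Z_n\leadsto Z$ is understood to mean that $Z$ has a version which is a Borel measurable random element of $l^\infty(T)$ and that $Z_n$ converges weakly to this version. *)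

(* Defs.v *)
From HB Require Import structures.
From mathcomp Require Import all_boot all_order all_algebra.
From mathcomp Require Import all_classical all_reals all_analysis.
From mathcomp Require Import measurable_realfun.

Set Implicit Arguments.
Unset Strict Implicit.
Unset Printing Implicit Defensive.

Import Order.TTheory GRing.Theory Num.Theory.
Import numFieldNormedType.Exports.

Local Open Scope classical_set_scope.
Local Open Scope ring_scope.

Section linf.
Context (T : Type) (R : realType).

Definition bounded_pred : {pred T -> R} := fun f => `[< bounded_fun f >].

Record linf := Linf { linf_fun :> T -> R ; linfP : linf_fun \in bounded_pred }.

HB.instance Definition _ := [isSub for linf_fun].
HB.instance Definition _ := [Choice of linf by <:].

Lemma bounded_predE (f : T -> R) :
  (f \in bounded_pred) <-> exists M : R, forall t, `|f t| <= M.
Proof.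
rewrite unfold_in /bounded_pred; split=> [/asboolP[M [_ fM]]|[M fM]].
  exists (M + 1) => t; apply: fM => //; by rewrite ltrDl.
apply/asboolP; exists M; split; first exact: num_real.
by move=> y My t _ /=; exact: le_trans (fM t) (ltW My).
Qed.

Lemma bounded_pred_submod : submod_closed bounded_pred.
Proof.
split=> [|a f g /bounded_predE[M fM] /bounded_predE[N gN]].
  by apply/bounded_predE; exists 0 => t; rewrite normr0.
apply/bounded_predE; exists (`|a| * M + N) => t.
apply: le_trans (ler_normD _ _) _; rewrite lerD// normrM.
by rewrite ler_wpM2l.
Qed.

HB.instance Definition _ :=
  GRing.isSubmodClosed.Build R (T -> R) bounded_pred bounded_pred_submod.
HB.instance Definition _ := [SubChoice_isSubLmodule of linf by <:].

Definition linf_norm (f : linf) : R := sup (range (fun t => `|f t|)).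

Lemma linf_norm_ub (f : linf) t : `|f t| <= linf_norm f.
Proof.
have /bounded_predE[M fM] := linfP f.
apply: ub_le_sup; last by exists t.
by exists M => _ [s _ <-].
Qed.

Lemma linf_norm_le (f : linf) M : 0 <= M -> (forall t, `|f t| <= M) ->
  linf_norm f <= M.
Proof.
move=> M0 fM; rewrite /linf_norm; set E := (X in sup X); have [->|/set0P E0] := eqVneq E set0.
  by rewrite sup0.
by apply: ge_sup => // _ [t _ <-].
Qed.

Lemma linf_norm_ge0 (f : linf) : 0 <= linf_norm f.
Proof.
rewrite /linf_norm; set E := (X in sup X).
have [->|/set0P[_ [t _ _]]] := eqVneq E set0; first by rewrite sup0.
exact: le_trans (normr_ge0 (f t)) (linf_norm_ub f t).
Qed.

Lemma linf_normD (f g : linf) : linf_norm (f + g) <= linf_norm f + linf_norm g.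
Proof.
apply: linf_norm_le => [|t]; first by rewrite addr_ge0// linf_norm_ge0.
by apply: le_trans (ler_normD _ _) _; rewrite lerD// linf_norm_ub.
Qed.

Lemma linf_normZ_le a (f : linf) : linf_norm (a *: f) <= `|a| * linf_norm f.
Proof.
apply: linf_norm_le => [|t]; first by rewrite mulr_ge0// linf_norm_ge0.
rewrite (_ : (a *: f) t = a * f t)// normrM.
by rewrite ler_wpM2l// linf_norm_ub.
Qed.

Lemma linf_normZ a (f : linf) : linf_norm (a *: f) = `|a| * linf_norm f.
Proof.
apply/eqP; rewrite eq_le linf_normZ_le /=.
have [->|a0] := eqVneq a 0; first by rewrite normr0 mul0r linf_norm_ge0.
rewrite -{1}[f](scalerK a0) -ler_pdivlMl ?normr_gt0// -normfV.
exact: linf_normZ_le.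
Qed.

Lemma linf_norm0_eq0 (f : linf) : linf_norm f = 0 -> f = 0.
Proof.
move=> f0; apply: val_inj; apply/funext => t /=.
by apply/eqP; rewrite -normr_le0 -f0 linf_norm_ub.
Qed.

HB.instance Definition _ :=
  Lmodule_isNormed.Build R linf linf_normD linf_normZ linf_norm0_eq0.

End linf.

Local Open Scope ereal_scope.

Section triangular_array.
Context d (Omega : measurableType d) (R : realType) (P : probability Omega R).
Context d' (X : measurableType d') (Y : nat -> nat -> Omega -> X).

(* sigma(Y n j : a <= j <= b) *)
Definition sigma_block (n a b : nat) : set (set Omega) :=
  <<s \bigcup_(j in [set j | a <= j <= b]%N)
        preimage_set_system setT (Y n j) measurable >>.

Definition alpha_row (n t : nat) : \bar R :=
  if (t < n)%N then
    ereal_sup [set x | exists (k : nat) (A B : set Omega),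
      [/\ (1 <= k <= n - t)%N, sigma_block n 1 k A, sigma_block n (k + t) n B
        & x = `|P (A `&` B) - P A * P B| ]]
  else 0.

Definition alpha (t : nat) : \bar R :=
  if t == 0%N then 1
  else ereal_sup [set alpha_row n t | n in [set n | 1 <= n]%N].

Definition strongly_mixing : Prop := alpha t @[t --> \oo] --> 0.

Definition sup_array (f : nat -> nat -> \bar R) : \bar R :=
  ereal_sup [set x | exists n t : nat, (1 <= t <= n)%N /\ x = f n t].

Definition rho (phi : X -> R) : \bar R :=
  sup_array (fun n t =>
    'E_P[fun w => (`|phi (Y n t w)| ^+ 2)%R] `^ (2^-1)%R).

Definition empirical_process (n : nat) (s : R) (phi : X -> R) (w : Omega) : R :=
  ((Num.sqrt n%:R)^-1 *
   \sum_(1 <= i < (Num.truncn (n%:R * s)).+1)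
      (phi (Y n i w) - fine 'E_P[phi \o Y n i]))%R.

End triangular_array.

Section bracketing.
Context d (X : measurableType d) (R : realType).
Implicit Types (F A B : set (X -> R)) (rho : (X -> R) -> \bar R).

Definition bracketing F rho (eps : R) (N : nat) A B : Prop :=
  [/\ A `<=` F, (A #= `I_N)%card, (B #= `I_N)%card,
      forall b, B b -> measurable_fun setT b /\ rho b < eps%:E
    & forall phi, F phi -> exists a b,
        [/\ A a, B b & forall x, (`|phi x - a x| <= b x)%R] ].

Definition bracketing_number F rho (eps : R) : \bar R :=
  ereal_inf [set (N%:R)%:E | N in
    [set N | exists A B, bracketing F rho eps N A B]].

End bracketing.

Section processes.
Context d (Omega : measurableType d) (R : realType) (P : probability Omega R).

(* Every finite linear combination is N(0, s^2); the Dirac case covers s = 0,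
   where [normal_prob] is not the degenerate law. *)
Definition centered_gaussian_process (I : Type) (G : I -> {RV P >-> R}) : Prop :=
  forall (K : nat) (u : 'I_K -> I) (c : 'I_K -> R),
  exists2 s : R, (0 <= s)%R & forall A : set R, measurable A ->
    P ((fun w => \sum_(k < K) c k * G (u k) w)%R @^-1` A) =
    if s == 0%R then \d_(0%R : R) A else normal_prob 0%R s A.

Definition outer_expectation (f : Omega -> R) : \bar R :=
  ereal_inf [set \int[P]_w U w | U in [set U : Omega -> \bar R |
    [/\ measurable_fun setT U, forall w, (f w)%:E <= U w
      & \int[P]_w U^\+ w < +oo \/ \int[P]_w U^\- w < +oo] ]].

Context d' (Omega' : measurableType d') (P' : probability Omega' R).

Definition cvg_in_distribution (K : nat)
    (Z_ : nat -> Omega -> 'rV[R]_K) (Z : Omega' -> 'rV[R]_K) : Prop :=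
  forall h : 'rV[R]_K -> R, continuous h -> bounded_fun h ->
    'E_P[h \o Z_ n] @[n --> \oo] --> 'E_P'[h \o Z].

Definition same_fidi (I : Type) (G : I -> Omega -> R) (G' : I -> Omega' -> R) :
    Prop :=
  forall (K : nat) (u : 'I_K -> I) (A : set 'rV[R]_K), <<s open >> A ->
    P [set w | A (\row_k G (u k) w)] = P' [set w | A (\row_k G' (u k) w)].

Definition borel_measurable (I : Type) (Z : Omega -> linf I R) : Prop :=
  forall U : set (linf I R), open U -> measurable (Z @^-1` U).

Definition weak_cvg (I : Type) (Z_ : nat -> Omega -> linf I R)
    (Z : Omega' -> linf I R) : Prop :=
  forall H : linf I R -> R, continuous H -> bounded_fun H ->
    outer_expectation (H \o Z_ n) @[n --> \oo] --> 'E_P'[H \o Z].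

End processes.

(* The limit G is given through its finite-dimensional distributions; its
   version Z may live on another probability space. *)
Definition weak_cvg_to_version d (Omega : measurableType d) (R : realType)
    (P : probability Omega R) dG (OmegaG : measurableType dG)
    (PG : probability OmegaG R) (I : Type)
    (G_ : nat -> I -> Omega -> R) (G : I -> OmegaG -> R) : Prop :=
  exists2 Z_ : nat -> Omega -> linf I R,
    forall n w i, (0 < n)%N -> Z_ n w i = G_ n i w &
  exists (d' : measure_display) (Omega' : measurableType d')
         (P' : probability Omega' R) (Z : Omega' -> linf I R),
    [/\ borel_measurable Z, same_fidi PG P' G (fun i w => Z w i)
      & weak_cvg P P' Z_ Z].

(* Main.v *)
(* Write r = (2 + gamma) / 2 and eps_j = 2^-j.  Truncating all factors at a
   common level turns the mixing coefficient into a covariance bound for products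
   of at most Q centered variables, and splitting an ordered tuple of indices at
   its largest gap then gives E (G_n f)^Q <= C eps^(Q/r) whenever f has the
   moments required of a bounding class of size eps and n eps^(2/r) >= 1.
   Since the approximating classes lie in F, every phi is joined to level k by a
   chain with only N_j possible links at level j, and chaining costs
   sum_j N_j^(1/Q) eps_j^(1/r), i.e. the entropy integral; the chain starts at the
   level where n eps^(2/r) is about 1, and there the bias sqrt n eps is negligible
   because r > 1.  Hence G_n is uniformly L^1-close to finitely many of its
   coordinates.  Convergence of the finite-dimensional laws carries this over to
   G: its discretizations converge almost surely in l^oo(F), and their limit is
   the required version.  Weak convergence is proved for Lipschitz functionals
   and extended to continuous ones by inf-convolution. *)

Require Import Defs.
From HB Require Import structures.
From mathcomp Require Import all_boot all_order all_algebra.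
From mathcomp Require Import all_classical all_reals all_analysis.
From mathcomp Require Import measurable_realfun ring lra zify.

Set Implicit Arguments.
Unset Strict Implicit.
Unset Printing Implicit Defensive.

Import Order.TTheory GRing.Theory Num.Theory.
Import numFieldNormedType.Exports.

Local Open Scope classical_set_scope.
Local Open Scope ring_scope.

(** * Sums over ordered tuples *)

(** With r as above, gamma / (2 + gamma) is 1 - 1/r, so all the hypotheses share one scale: the
    covariance bound has the form al^(1 - 1/r) c^(1/r) with c = eps^2, and the weight
    x^(-gamma/(2+gamma)), integrated over a dyadic interval, leaves exactly eps_j^(1/r). The
    condition n eps^(2/r) >= 1 has a combinatorial origin: splitting tuples repeatedly produces
    powers of n eps^(2/r) with exponents up to Q/2, one for each block, and the condition makes the
    top power dominate. Members of F are only known to have a first moment; higher moments are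
    available for the differences phi - a, through their bounding functions. Hence every estimate
    concerns links and never a single phi. Suprema over F and functionals of the process in l^oo(F)
    need not be measurable. Closeness is therefore always recorded by an integrable U that dominates
    pointwise and has small expectation, and outer expectations are squeezed between ordinary ones.
    Convergence in law transports only bounded continuous functionals of finitely many coordinates,
    so distances are cut off by [Num.min 1] before they are passed on to G. *)

Section list_sums.
Context (R : realFieldType) (n : nat).
Implicit Types (F G : seq nat -> R) (s : seq nat) (q : nat).

(* The sum of F over all lists of length q with entries in {1, .., n}; lists make
   the splitting of a tuple of indices a mere concatenation. *)
Fixpoint lsum q F : R :=
  if q is q'.+1 then \sum_(1 <= g < n.+1) lsum q' (fun s => F (g :: s))
  else F [::].

Definition in_range s := all (fun i => 1 <= i <= n)%N s.

Lemma eq_lsum q F G :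
  (forall s, size s = q -> in_range s -> F s = G s) -> lsum q F = lsum q G.
Proof.
elim: q F G => [|q IH] F G FG /=; first exact: FG.
apply: eq_big_nat => g gn; apply: IH => s sq sr; apply: FG; rewrite /= ?sq//.
by rewrite sr andbT.
Qed.

Lemma ler_lsum q F G :
  (forall s, size s = q -> in_range s -> F s <= G s) -> lsum q F <= lsum q G.
Proof.
elim: q F G => [|q IH] F G FG /=; first exact: FG.
apply: ler_sum_nat => g gn; apply: IH => s sq sr; apply: FG; rewrite /= ?sq//.
by rewrite sr andbT.
Qed.

Lemma lsum0 q : lsum q (fun=> 0) = 0.
Proof. by elim: q => //= q IH; rewrite big1. Qed.

Lemma lsum_ge0 q F : (forall s, 0 <= F s) -> 0 <= lsum q F.
Proof. by move=> F0; rewrite -(lsum0 q); apply: ler_lsum. Qed.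

Lemma lsumD q F G : lsum q (fun s => F s + G s) = lsum q F + lsum q G.
Proof. by elim: q F G => //= q IH F G; rewrite -big_split; apply: eq_bigr. Qed.

Lemma lsumZ q F c : lsum q (fun s => c * F s) = c * lsum q F.
Proof. by elim: q F => //= q IH F; rewrite mulr_sumr; apply: eq_bigr. Qed.

Lemma exchange_lsum (I : Type) (r : seq I) (p : pred I) q (F : I -> seq nat -> R) :
  lsum q (fun s => \sum_(i <- r | p i) F i s) = \sum_(i <- r | p i) lsum q (F i).
Proof.
elim: q F => //= q IH F; rewrite exchange_big /=.
by apply: eq_bigr => g _; rewrite IH.
Qed.

Lemma lsum_cat a b F :
  lsum (a + b) F = lsum a (fun s => lsum b (fun s' => F (s ++ s'))).
Proof. by elim: a F => //= a IH F; apply: eq_bigr => g _; rewrite IH. Qed.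

Lemma expr_sum_lsum (x : nat -> R) q :
  (\sum_(1 <= i < n.+1) x i) ^+ q = lsum q (fun s => \prod_(i <- s) x i).
Proof.
elim: q => [|q IH]; first by rewrite expr0 /= big_nil.
rewrite exprS IH mulr_suml /=; apply: eq_bigr => g _.
by rewrite -lsumZ; apply: eq_lsum => s _ _; rewrite big_cons.
Qed.

Lemma sorted_insert g s : sorted leq s ->
  exists2 p, (p <= size s)%N & sorted leq (take p s ++ g :: drop p s).
Proof.
elim: s => [|a s IH] ss; first by exists 0%N.
have [ga|ag] := leqP g a; first by exists 0%N => //=; rewrite ga.
have [p ps so] := IH (path_sorted ss).
exists p.+1 => //=.
have la : all (leq a) s by apply: order_path_min => //; exact: leq_trans.
move: so; rewrite path_sortedE; last exact: leq_trans.
move=> ->; rewrite andbT all_cat /= (ltnW ag) /=.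
by rewrite -all_cat cat_take_drop.
Qed.

(** For a fixed position [p] the pair [(g, s)] and the longer list determine each other, so no list
    is missed or counted twice. *)
Lemma lsum_insert p q H : (p <= q)%N ->
  \sum_(1 <= g < n.+1) lsum q (fun s => H (take p s ++ g :: drop p s)) =
  lsum q.+1 H.
Proof.
move=> /subnKC <-; move: (q - p)%N => b; rewrite -addnS.
rewrite lsum_cat /= exchange_lsum; apply: eq_bigr => g _.
rewrite lsum_cat; apply: eq_lsum => s sp _; apply: eq_lsum => s' _ _.
by rewrite take_size_cat// drop_size_cat.
Qed.

(** The induction sorts the tail and then inserts the head. At least one of the [q.+1] positions
    preserves the order, and summing over all of them costs the factor [q.+1]. Ties are the reason
    why equality fails. *)
Lemma lsum_sym_le q F : (forall s, 0 <= F s) ->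
  (forall s s', perm_eq s s' -> F s = F s') ->
  lsum q F <= q`!%:R * lsum q (fun s => (sorted leq s)%:R * F s).
Proof.
elim: q F => [|q IH] F F0 Fsym; first by rewrite /= !mul1r.
pose H s := (sorted leq s)%:R * F s.
apply: (@le_trans _ _ (\sum_(1 <= g < n.+1) q`!%:R *
   lsum q (fun s => (sorted leq s)%:R * F (g :: s)))).
  rewrite /=; apply: ler_sum_nat => g _; apply: IH => // s s' ss'.
  by apply: Fsym; rewrite perm_cons.
apply: (@le_trans _ _ (q`!%:R * \sum_(0 <= p < q.+1)
   \sum_(1 <= g < n.+1) lsum q (fun s => H (take p s ++ g :: drop p s)))).
  rewrite -mulr_sumr ler_wpM2l//.
  rewrite exchange_big /=; apply: ler_sum_nat => g _.
  rewrite -exchange_lsum; apply: ler_lsum => s sq _.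
  have H0 p : 0 <= H (take p s ++ g :: drop p s) by rewrite mulr_ge0.
  case: (boolP (sorted leq s)) => [/(sorted_insert g)[p]|_]; last first.
    by rewrite mul0r sumr_ge0.
  move=> pq so; rewrite sq in pq.
  rewrite (bigD1_seq p) ?iota_uniq ?mem_index_iota //=.
  rewrite -[leLHS]addr0 lerD ?sumr_ge0//.
  rewrite /H so !mul1r.
  rewrite (Fsym _ (take p s ++ g :: drop p s))//.
  by rewrite perm_sym (perm_catCA _ [:: g]) /= cat_take_drop perm_refl.
rewrite (_ : \sum_(0 <= p < _) _ = \sum_(0 <= p < q.+1) lsum q.+1 H); last first.
  by apply: eq_big_nat => p pq; rewrite lsum_insert.
by rewrite sumr_const_nat subn0 factS mulrnAr -mulrnAl -mulrnA mulnC.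
Qed.

Definition gap_le (t x y : nat) := (x <= y <= x + t)%N.

Lemma sum_gap_count (lo t : nat) :
  \sum_(1 <= g < n.+1) ((lo <= g <= lo + t)%N)%:R <= t.+1%:R :> R.
Proof.
(* The range is enlarged until it contains the whole window, which may stick out of {1, .., n}. *)
apply: (@le_trans _ _ (\sum_(0 <= g < maxn n.+1 (lo + t.+1)) ((lo <= g <= lo + t)%N)%:R)).
  rewrite [leRHS](@big_cat_nat _ _ _ 1%N)//=; last by rewrite leq_max.
  rewrite [X in _ + X](@big_cat_nat _ _ _ n.+1)//=; last by rewrite leq_maxl.
  by rewrite addrCA lerDl addr_ge0// sumr_ge0.
rewrite (@big_cat_nat _ _ _ lo)//=; last by rewrite leq_max leq_addr orbT.
rewrite big_nat_cond big1 ?add0r; last first.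
  by move=> g; rewrite andbT => /= glo; rewrite leqNgt glo.
rewrite (@big_cat_nat _ _ _ (lo + t.+1))//=; last 2 first.
- by rewrite leq_addr.
- by rewrite leq_maxr.
rewrite [X in _ + X]big_nat_cond [X in _ + X]big1 ?addr0; last first.
  move=> g; rewrite andbT => /andP[glo _].
  by rewrite addnS in glo; rewrite [(g <= _)%N]leqNgt glo andbF.
apply: (@le_trans _ _ (\sum_(lo <= g < lo + t.+1) 1)).
  by apply: ler_sum => g _; case: (_ <= _ <= _)%N.
by rewrite big_const_nat iter_addr addr0 addKn.
Qed.

Lemma lsum_gap_path t b y :
  lsum b (fun s => (path (gap_le t) y s)%:R) <= t.+1%:R ^+ b.
Proof.
elim: b y => [|b IH] y; first by rewrite /= expr0.
rewrite /= exprS; apply: (@le_trans _ _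
  (\sum_(1 <= g < n.+1) ((y <= g <= y + t)%N)%:R * t.+1%:R ^+ b)).
  apply: ler_sum => g _.
  under eq_lsum do rewrite -mulnb natrM.
  by rewrite lsumZ ler_wpM2l.
by rewrite -mulr_suml ler_wpM2r ?exprn_ge0 ?sum_gap_count.
Qed.

Lemma lsum_gap_rcons t a x :
  lsum a (fun s => (sorted (gap_le t) (rcons s x))%:R) <= t.+1%:R ^+ a.
Proof.
elim: a x => [|a IH] x; first by rewrite /= expr0.
rewrite -addn1 lsum_cat /= exchange_lsum addn1 exprS.
(* Subtraction is truncated: if [x < t] the window starts at 0, and it still contains every
   admissible [g] because [g <= x]. *)
apply: (@le_trans _ _
  (\sum_(1 <= g < n.+1) ((x - t <= g <= x - t + t)%N)%:R * t.+1%:R ^+ a)).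
  apply: ler_sum_nat => g _.
  rewrite (@eq_lsum _ _ (fun s => (gap_le t g x)%:R * (sorted (gap_le t) (rcons s g))%:R)).
    rewrite lsumZ; apply: ler_pM => //; first by rewrite lsum_ge0.
    by rewrite ler_nat /gap_le; case: (leqP g x) => //= gx; lia.
  move=> s _ _; rewrite cats1 -natrM mulnb; congr (_%:R); congr (nat_of_bool _).
  case: s => [|b s] /=; first by rewrite andbT.
  by rewrite !rcons_path last_rcons andbC.
by rewrite -mulr_suml ler_wpM2r ?exprn_ge0 ?sum_gap_count.
Qed.

(** The end points [x] and [y] of the gap stay in their blocks. So both blocks are nonempty and
    strictly shorter than the tuple, as the induction on the length requires. *)
Lemma max_gap_split a b s : sorted leq [:: a, b & s] ->
  exists s1 x y s2, [/\ [:: a, b & s] = s1 ++ [:: x, y & s2], (x <= y)%N,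
    sorted (gap_le (y - x)) (rcons s1 x) & path (gap_le (y - x)) y s2].
Proof.
elim: s a b => [|c s IH] a b /=.
  by rewrite andbT => ab; exists [::], a, b, [::].
move=> /andP[ab bcs]; have [s1 [x [y [s2 [e xy so1 pa2]]]]] := IH _ _ bcs.
have [le|lt] := leqP (b - a) (y - x).
  exists (a :: s1), x, y, s2; split => //; first by rewrite e.
  rewrite /=; case: s1 e so1 => [|b1 s1] /= [bE _] so1; rewrite ?bE in ab le.
    by rewrite andbT /gap_le ab /= -leq_subLR.
  by rewrite so1 andbT /gap_le ab /= -leq_subLR.
exists [::], a, b, (c :: s); split => //.
have : sorted (gap_le (y - x)) (b :: c :: s).
  rewrite e -cat_rcons; case: s1 so1 {e} => [|b1 s1] /=.
    by move=> _; rewrite pa2 /gap_le xy /= subnKC ?leqnn.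
  move=> so1; rewrite cat_path so1 last_rcons /= pa2 /gap_le xy; lia.
apply: sub_path.
by move=> u v; rewrite /gap_le; lia.
Qed.

End list_sums.

Lemma sorted_gap_le t s : sorted (gap_le t) s -> sorted leq s.
Proof. by apply: sub_sorted => u v /andP[]. Qed.

Definition sorted_lsum (R : realFieldType) n (psi : seq nat -> R) q :=
  lsum n q (fun s => (sorted leq s)%:R * psi s).

(* Each tuple is split at its largest gap t: the other q - 2 gaps are at most t,
   which leaves t.+1 ^ (q - 2) tuples for given positions around that gap. *)
Lemma sorted_lsum_rec (R : realFieldType) (n Q q : nat) (psi : seq nat -> R)
    (a : nat -> R) (B sa : R) :
  (forall s, 0 <= psi s) -> (forall t, 0 <= a t) -> 0 <= B ->
  \sum_(0 <= t < n) t.+1%:R ^+ (Q - 2) * a t <= sa ->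
  (forall s1 x y s2, in_range n s1 -> in_range n s2 -> in_range n [:: x; y] ->
    sorted leq (rcons s1 x) -> sorted leq (y :: s2) -> (x <= y)%N ->
    (size s1 + size s2 + 2 <= Q)%N ->
    psi (s1 ++ [:: x, y & s2]) <=
      psi (rcons s1 x) * psi (y :: s2) + B * a (y - x)%N) ->
  (2 <= q <= Q)%N ->
  sorted_lsum n psi q <= \sum_(0 <= m < q.-1)
    (sorted_lsum n psi m.+1 * sorted_lsum n psi (q - m.+1)%N) + q%:R * (n%:R * B * sa).
Proof.
move=> psi0 a0 B0 aS psiB /andP[q2 qQ]; set M := sorted_lsum n psi.
(* [T m s] is the bound for a split after position [m] (counted from 0), and it vanishes unless that
   gap is a largest one. All terms are nonnegative and one is active, so the sum over [m]
   dominates. *)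
pose T m s := let s1 := take m s in let x := nth 0%N s m in
  let y := nth 0%N s m.+1 in let s2 := drop m.+2 s in
  ((x <= y)%N && sorted (gap_le (y - x)) (rcons s1 x) &&
    path (gap_le (y - x)) y s2)%:R *
  (psi (rcons s1 x) * psi (y :: s2) + B * a (y - x)%N).
have T0 m s : 0 <= T m s.
  by rewrite /T mulr_ge0// addr_ge0// mulr_ge0.
have TE m s1 x y s2 : size s1 = m -> T m (s1 ++ [:: x, y & s2]) =
    ((x <= y)%N && sorted (gap_le (y - x)) (rcons s1 x) &&
    path (gap_le (y - x)) y s2)%:R *
  (psi (rcons s1 x) * psi (y :: s2) + B * a (y - x)%N).
  move=> <-; rewrite /T take_size_cat// !nth_cat ltnn subnn ltnNge leqnSn /=.
  by rewrite subSnn /= drop_cat ltnNge leqW// ?leqW// subSn// subSnn /= drop0.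
apply: (@le_trans _ _ (lsum n q (fun s => \sum_(0 <= m < q.-1) T m s))).
  apply: ler_lsum => s sq sr.
  have [so|_] := boolP (sorted leq s); last by rewrite mul0r sumr_ge0.
  case: s sq sr so => [|b [|c s]] sq sr so; [by move: q2; rewrite -sq..|].
  have [s1 [x [y [s2 [e xy so1 pa2]]]]] := max_gap_split so.
  have szE : (size s1 + size s2 + 2 = q)%N.
    by rewrite -sq e size_cat /= !addnS addn0.
  rewrite (bigD1_seq (size s1)) ?iota_uniq ?mem_index_iota //=; last by lia.
  rewrite -[leLHS]addr0 lerD ?sumr_ge0// mul1r e TE// xy so1 pa2 !mul1r.
  have : in_range n (s1 ++ [:: x, y & s2]) by rewrite -e.
  rewrite /in_range all_cat /= => /and4P[r1 xr yr r2].
  apply: psiB => //.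
  - by rewrite /in_range /= xr yr.
  - exact: sorted_gap_le so1.
  - exact: (@sorted_gap_le (y - x) (y :: s2)).
  - by rewrite szE.
rewrite exchange_lsum.
apply: (@le_trans _ _ (\sum_(0 <= m < q.-1) (M m.+1 * M (q - m.+1)%N + n%:R * B * sa))).
  apply: ler_sum_nat => m /andP[_ mq].
  pose b := (q - m.+2)%N.
  have qE : q = (m + b.+2)%N by rewrite /b; lia.
  have -> : (q - m.+1)%N = b.+1 by rewrite /b; lia.
  rewrite {1}qE lsum_cat /=.
  (* In the product term the gap conditions are weakened to sortedness, which decouples the two
     blocks. In the mixing term they are kept, since they are what makes the tuples few. *)
  apply: (@le_trans _ _ (lsum n m (fun s1 => \sum_(1 <= x < n.+1)
     \sum_(1 <= y < n.+1) lsum n b (fun s2 =>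
     ((sorted leq (rcons s1 x))%:R * psi (rcons s1 x)) *
     ((sorted leq (y :: s2))%:R * psi (y :: s2)) +
     ((x <= y)%:R * (B * a (y - x)%N) * (sorted (gap_le (y - x)) (rcons s1 x))%:R) *
     (path (gap_le (y - x)) y s2)%:R)))).
    apply: ler_lsum => s1 s1m s1r; apply: ler_sum => x _.
    apply: ler_sum => y _; apply: ler_lsum => s2 s2b s2r.
    rewrite TE//; set g := (y - x)%N.
    case: (boolP (x <= y)%N) => xy /=; last first.
      by rewrite !mul0r addr0 !mulr_ge0.
    case: (boolP (sorted (gap_le g) _)) => /= so1; last first.
      by rewrite mul0r mulr0 mul0r addr0 !mulr_ge0.
    case: (boolP (path (gap_le g) y s2)) => /= so2; last first.
      by rewrite mul0r mulr0 addr0 !mulr_ge0.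
    rewrite (sorted_gap_le so1) (_ : path leq y s2); first by rewrite !mul1r !mulr1.
    exact: (@sorted_gap_le g (y :: s2)).
  rewrite (@eq_lsum _ _ _ _ (fun s1 => \sum_(1 <= x < n.+1)
     ((sorted leq (rcons s1 x))%:R * psi (rcons s1 x)) * M b.+1 +
     \sum_(1 <= x < n.+1) \sum_(1 <= y < n.+1) 
     ((x <= y)%:R * (B * a (y - x)%N) * (sorted (gap_le (y - x)) (rcons s1 x))%:R) *
     lsum n b (fun s2 => (path (gap_le (y - x)) y s2)%:R))); last first.
    move=> s1 _ _; rewrite -big_split /=; apply: eq_bigr => x _.
    under eq_bigr do rewrite lsumD !lsumZ.
    by rewrite big_split /= -mulr_sumr.
  rewrite lsumD; apply: lerD.
    have -> : M m.+1 = lsum n m (fun s => \sum_(1 <= x < n.+1)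
        (sorted leq (rcons s x))%:R * psi (rcons s x)).
      rewrite /M /sorted_lsum -[in LHS]addn1 lsum_cat /=; apply: eq_lsum => s _ _.
      by apply: eq_bigr => x _; rewrite cats1.
    under eq_lsum do rewrite -mulr_suml mulrC.
    by rewrite lsumZ mulrC.
  rewrite exchange_lsum.
  apply: (@le_trans _ _ (\sum_(1 <= x < n.+1) B * sa)); last first.
    by rewrite big_const_nat subSS subn0 iter_addr addr0 -mulrA mulr_natl.
  apply: ler_sum_nat => x /andP[x1 xn].
  rewrite exchange_lsum.
  apply: (@le_trans _ _ (\sum_(1 <= y < n.+1)
    (x <= y)%:R * (B * ((y - x).+1%:R ^+ (Q - 2) * a (y - x)%N)))).
    apply: ler_sum_nat => y _.
    under eq_lsum do rewrite -mulrA.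
    rewrite lsumZ -[leLHS]mulrA; apply: ler_wpM2l => //.
    rewrite -mulrA ler_wpM2l//.
    under eq_lsum do rewrite mulrC.
    rewrite lsumZ mulrC ler_wpM2r//.
    apply: (@le_trans _ _ ((y - x).+1%:R ^+ b * (y - x).+1%:R ^+ m)).
      by apply: ler_pM; rewrite ?lsum_gap_path ?lsum_gap_rcons ?lsum_ge0.
    rewrite -exprD ler_weXn2l ?ler1n//; lia.
  rewrite (@big_cat_nat _ _ _ x)//=; last by rewrite ltnW.
  rewrite big_nat_cond big1 ?add0r; last first.
    by move=> y; rewrite andbT => /andP[_]; rewrite ltnNge => /negbTE->; rewrite mul0r.
  under eq_big_nat => y /andP[-> _] do rewrite mul1r.
  rewrite -mulr_sumr ler_wpM2l//.
  rewrite -{1}[x]add0n big_addn; under eq_bigr do rewrite addnK.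
  apply: le_trans aS; rewrite [leRHS](@big_cat_nat _ _ _ (n.+1 - x))//=; last by lia.
  by rewrite lerDl sumr_ge0// => t _; rewrite mulr_ge0// exprn_ge0.
rewrite big_split /= lerD2l big_const_nat subn0 iter_addr addr0 -[leLHS]mulr_natl.
rewrite ler_wpM2r ?ler_nat ?leq_pred// !mulr_ge0//.
by apply: le_trans aS; apply: sumr_ge0 => t _; rewrite mulr_ge0// exprn_ge0.
Qed.

(* As psi vanishes on singletons, only blocks of length at least 2 contribute,
   whence the exponent q./2. *)
Lemma sorted_lsum_bound (R : realFieldType) (Q : nat) (sa : R) : 0 <= sa ->
  forall q, (1 <= q <= Q)%N -> exists2 K : R, 0 <= K &
  forall (n : nat) (psi : seq nat -> R) (a : nat -> R) (B D : R),
  (forall s, 0 <= psi s) -> (forall t, 0 <= a t) -> 0 <= B ->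
  \sum_(0 <= t < n) t.+1%:R ^+ (Q - 2) * a t <= sa ->
  (forall s1 x y s2, in_range n s1 -> in_range n s2 -> in_range n [:: x; y] ->
    sorted leq (rcons s1 x) -> sorted leq (y :: s2) -> (x <= y)%N ->
    (size s1 + size s2 + 2 <= Q)%N ->
    psi (s1 ++ [:: x, y & s2]) <=
      psi (rcons s1 x) * psi (y :: s2) + B * a (y - x)%N) ->
  (forall i, (1 <= i <= n)%N -> psi [:: i] = 0) ->
  1 <= D -> n%:R * B <= D ->
  sorted_lsum n psi q <= K * D ^+ (q./2).
Proof.
move=> S0; elim/ltn_ind => q IH /andP[q1 qQ].
have [q2|] := leqP q 1.
  exists 0 => // n psi a B D psi0 a0 B0 aS psiB psi1 D1 nB.
  have {q1 q2}-> : q = 1%N by lia.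
  by rewrite /sorted_lsum /= big_nat big1 ?mul0r// => i ir; rewrite psi1// mulr0.
move=> q2.
(* [K] precedes [n], [psi], [a], [B] and [D]: the constant must not depend on the row of the array
   or on the function. Lengths outside the induction get the default 0. *)
have /choice[K HK] : forall m, exists K : R, 0 <= K /\ ((1 <= m < q)%N ->
  forall (n : nat) (psi : seq nat -> R) (a : nat -> R) (B D : R),
  (forall s, 0 <= psi s) -> (forall t, 0 <= a t) -> 0 <= B ->
  \sum_(0 <= t < n) t.+1%:R ^+ (Q - 2) * a t <= sa ->
  (forall s1 x y s2, in_range n s1 -> in_range n s2 -> in_range n [:: x; y] ->
    sorted leq (rcons s1 x) -> sorted leq (y :: s2) -> (x <= y)%N ->
    (size s1 + size s2 + 2 <= Q)%N ->
    psi (s1 ++ [:: x, y & s2]) <=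
      psi (rcons s1 x) * psi (y :: s2) + B * a (y - x)%N) ->
  (forall i, (1 <= i <= n)%N -> psi [:: i] = 0) ->
  1 <= D -> n%:R * B <= D ->
  sorted_lsum n psi m <= K * D ^+ (m./2)).
  move=> m; have [/andP[m1 mq]|mq] := boolP (1 <= m < q)%N; last by exists 0.
  have [|K K0 HK] := IH m mq; first by rewrite m1 (leq_trans (ltnW mq)).
  by exists K; split=> // _.
exists (\sum_(0 <= m < q.-1) K m.+1 * K (q - m.+1)%N + q%:R * sa).
  by rewrite addr_ge0 ?mulr_ge0// sumr_ge0// => m _; rewrite mulr_ge0//; apply: (HK _).1.
move=> n psi a B D psi0 a0 B0 aS psiB psi1 D1 nB.
apply: le_trans (sorted_lsum_rec psi0 a0 B0 aS psiB _) _; first by rewrite q2.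
have D0 : 0 <= D by exact: le_trans D1.
rewrite mulrDl; apply: lerD.
  rewrite mulr_suml; apply: ler_sum_nat => m /andP[_ mq].
  apply: (@le_trans _ _ (K m.+1 * D ^+ (m.+1)./2 * (K (q - m.+1)%N * D ^+ (q - m.+1)./2))).
    apply: ler_pM.
    - by rewrite lsum_ge0// => s; rewrite mulr_ge0.
    - by rewrite lsum_ge0// => s; rewrite mulr_ge0.
    - by apply: (HK m.+1).2 psi0 a0 B0 aS psiB psi1 D1 nB; lia.
    - by apply: (HK (q - m.+1)%N).2 psi0 a0 B0 aS psiB psi1 D1 nB; lia.
  rewrite mulrACA -exprD ler_wpM2l ?mulr_ge0//; [exact: (HK _).1..|].
  by rewrite ler_weXn2l//; lia.
rewrite -!mulrA ler_wpM2l// mulrA mulrC ler_wpM2l//.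
(* One factor [D] is at most [D ^+ q./2] because [1 <= D] and [2 <= q]. *)
apply: (le_trans nB); rewrite -[leLHS]expr1 ler_weXn2l//; lia.
Qed.

(** * Covariance inequality *)

Section expectation.
Context d (Omega : measurableType d) (R : realType) (P : probability Omega R).
Implicit Types f g h : Omega -> R.

Local Notation L1 f := (P.-integrable setT (EFin \o f)).
Local Notation E f := (Rintegral P setT f).

Lemma L1_measurable f : L1 f -> measurable_fun setT f.
Proof. by move=> /integrableP[/measurable_EFinP]. Qed.

Lemma L1_le f g : measurable_fun setT f -> L1 g -> (forall w, `|f w| <= g w) ->
  L1 f.
Proof.
move=> mf ig fg; apply: le_integrable ig => //; first exact/measurable_EFinP.
by move=> w _ /=; rewrite lee_fin (le_trans (fg w)) ?ler_norm.
Qed.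

Lemma L1D f g : L1 f -> L1 g -> L1 (fun w => f w + g w).
Proof. by move=> f1 g1; exact: (integrableD measurableT f1 g1). Qed.

Lemma L1B f g : L1 f -> L1 g -> L1 (fun w => f w - g w).
Proof. by move=> f1 g1; exact: (integrableB measurableT f1 g1). Qed.

Lemma L1Z c f : L1 f -> L1 (fun w => c * f w).
Proof.
by move=> f1; exact: (integrableZl measurableT c f1).
Qed.

Lemma L1_cst c : L1 (fun=> c).
Proof. exact: finite_measure_integrable_cst. Qed.

Lemma L1_sum (I : Type) (s : seq I) (p : pred I) (f : I -> Omega -> R) :
  (forall i, p i -> L1 (f i)) -> L1 (fun w => \sum_(i <- s | p i) f i w).
Proof.
move=> f1; elim: s => [|i s IH].
  by under [X in EFin \o X]eq_fun do rewrite big_nil; exact: L1_cst.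
under [X in EFin \o X]eq_fun do rewrite big_cons.
by have [/f1 fi|//] := boolP (p i); exact: L1D.
Qed.

Lemma L1_norm f : L1 f -> L1 (fun w => `|f w|).
Proof. exact: integrable_norm. Qed.

Lemma L1_bounded f M : measurable_fun setT f -> (forall w, `|f w| <= M) -> L1 f.
Proof. by move=> mf fM; apply: (L1_le mf (L1_cst M)). Qed.

Lemma ED f g : L1 f -> L1 g -> E (fun w => f w + g w) = E f + E g.
Proof. by move=> f1 g1; exact: RintegralD. Qed.

Lemma EB f g : L1 f -> L1 g -> E (fun w => f w - g w) = E f - E g.
Proof. by move=> f1 g1; exact: RintegralB. Qed.

Lemma EZ c f : L1 f -> E (fun w => c * f w) = c * E f.
Proof. by move=> f1; exact: RintegralZl. Qed.

Lemma E_cst c : E (fun=> c) = c.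
Proof. by rewrite Rintegral_cst// [X in fine X]probability_setT mulr1. Qed.

Lemma E_sum (I : Type) (s : seq I) (p : pred I) (f : I -> Omega -> R) :
  (forall i, p i -> L1 (f i)) ->
  E (fun w => \sum_(i <- s | p i) f i w) = \sum_(i <- s | p i) E (f i).
Proof.
move=> f1; elim: s => [|i s IH].
  by rewrite big_nil -[RHS](E_cst 0); congr Rintegral; apply/funext => w; rewrite big_nil.
rewrite big_cons; have [pi|npi] := boolP (p i).
  rewrite -IH -ED//; [|exact: f1|exact: L1_sum].
  by congr Rintegral; apply/funext => w; rewrite big_cons pi.
rewrite -IH; congr Rintegral; apply/funext => w.
by rewrite big_cons (negbTE npi).
Qed.

Lemma ler_E f g : L1 f -> L1 g -> (forall w, f w <= g w) -> E f <= E g.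
Proof. by move=> f1 g1 fg; exact: le_Rintegral. Qed.

Lemma ler_norm_E f g : L1 f -> L1 g -> (forall w, `|f w| <= g w) -> `|E f| <= E g.
Proof.
move=> f1 g1 fg; apply: (le_trans (le_normr_Rintegral _ _)) => //.
by apply: ler_E => //; exact: L1_norm.
Qed.

Lemma EFin_E f : L1 f -> (E f)%:E = (\int[P]_w (f w)%:E)%E.
Proof. by move=> f1; rewrite /Rintegral fineK//; exact: integrable_fin_num. Qed.

Lemma L1_ge0_lty f : measurable_fun setT f -> (forall w, 0 <= f w) ->
  (\int[P]_w (f w)%:E < +oo)%E -> L1 f.
Proof.
move=> mf f0 foo; apply/integrableP; split; first exact/measurable_EFinP.
by under eq_integral do rewrite /= ger0_norm//.
Qed.

Lemma L1_ge0_le f c : measurable_fun setT f -> (forall w, 0 <= f w) ->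
  (\int[P]_w (f w)%:E <= c%:E)%E -> L1 f /\ E f <= c.
Proof.
move=> mf f0 fc; have f1 : L1 f by apply: L1_ge0_lty => //; exact: le_lt_trans (ltry c).
by split=> //; rewrite -lee_fin EFin_E.
Qed.

Lemma measurable_ge_set f c : measurable_fun setT f -> measurable [set w | c <= f w].
Proof.
move=> mf; have := mf measurableT `[c, +oo[%classic (measurable_itv _).
by rewrite setTI set_itvcy.
Qed.

Lemma E_indic (A : set Omega) : measurable A -> E (\1_A) = fine (P A).
Proof. by move=> mA; rewrite /Rintegral integral_indic// setIT. Qed.

Lemma L1_indic (A : set Omega) : measurable A -> L1 (\1_A).
Proof. exact: integrable_indic. Qed.

(** For values in [0, 1] this is floor (N f) / N. *)
Definition staircase N f : Omega -> R := fun w =>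
  N%:R^-1 * \sum_(1 <= k < N.+1) \1_[set w | k%:R / N%:R <= f w] w.

Lemma staircase_ge0 N f w : 0 <= staircase N f w.
Proof. by rewrite mulr_ge0// sumr_ge0. Qed.

Lemma staircase_approx N f w : (0 < N)%N -> 0 <= f w <= 1 ->
  f w - N%:R^-1 <= staircase N f w <= f w.
Proof.
move=> N0 /andP[f0 f1]; have N0' : 0 < N%:R :> R by rewrite ltr0n.
have x0 : 0 <= N%:R * f w by rewrite mulr_ge0.
have /andP[m1 m2] := truncn_itv x0; set m := Num.truncn _ in m1 m2.
have mN : (m <= N)%N.
  by rewrite -(ler_nat R) (le_trans m1)// -[leRHS]mulr1 ler_wpM2l.
have -> : staircase N f w = N%:R^-1 * m%:R.
  congr (_ * _); rewrite (@big_cat_nat _ _ _ m.+1)//=.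
  rewrite big_nat (eq_bigr (fun=> 1)); last first.
    move=> k /andP[_ km]; rewrite indicE mem_set//=.
    rewrite ler_pdivrMr// mulrC (le_trans _ m1)// ler_nat; lia.
  rewrite [X in _ + X]big_nat [X in _ + X]big1 ?addr0; last first.
    move=> k /andP[mk _]; rewrite indicE memNset//=; apply/negP.
    rewrite -ltNge ltr_pdivlMr// mulrC (lt_le_trans m2)// ler_nat//.
  by rewrite -big_nat big_const_nat iter_addr addr0 subn1.
rewrite mulrC ler_pdivrMr// [f w * _]mulrC m1 andbT.
rewrite ler_pdivlMr// mulrBl mulVf ?gt_eqF// mulrC lerBlDr.
by rewrite -natr1 in m2; exact: ltW.
Qed.

(** Only upper level sets are tested. They are all that [staircase] sees, and the property survives
    increasing affine changes of [f] and [g]. *)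
Definition alpha_pair (a : R) f g := forall c e,
  `|fine (P ([set w | c <= f w] `&` [set w | e <= g w])) -
    fine (P [set w | c <= f w]) * fine (P [set w | e <= g w])| <= a.

(* The staircase approximations are averages of indicators of level sets. *)
Lemma cov_unit_interval a f g : measurable_fun setT f -> measurable_fun setT g ->
  (forall w, 0 <= f w <= 1) -> (forall w, 0 <= g w <= 1) ->
  alpha_pair a f g -> `|E (fun w => f w * g w) - E f * E g| <= a.
Proof.
move=> mf mg f01 g01 afg.
have nb u (z : R) : 0 <= u <= z -> `|u| <= z by move=> /andP[u0 uz]; rewrite ger0_norm.
have L1f : L1 f by apply: (@L1_bounded _ 1) => // w; exact: nb.
have L1g : L1 g by apply: (@L1_bounded _ 1) => // w; exact: nb.
have L1fg : L1 (fun w => f w * g w).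
  apply: (@L1_bounded _ 1); first exact: measurable_funM.
  move=> w; rewrite normrM; have := nb _ _ (f01 w); have := nb _ _ (g01 w).
  by move=> ? ?; rewrite mulr_ile1.
(* Replacing [f] and [g] by their staircases changes the mean of the product by at most 2 / N and
   the product of the means by as much. *)
have key N : (0 < N)%N -> `|E (fun w => f w * g w) - E f * E g| <= a + 4 * N%:R^-1.
  move=> N0; have N0' : 0 < N%:R :> R by rewrite ltr0n.
  have Nn0 : N%:R != 0 :> R by rewrite gt_eqF.
  pose F := staircase N f; pose G := staircase N g.
  have mA h : measurable_fun setT h -> forall k, measurable [set w | k%:R / N%:R <= h w].
    by move=> mh k; exact: measurable_ge_set.
  have L1s h : measurable_fun setT h ->
      L1 (fun w => \sum_(1 <= k < N.+1) \1_[set w | k%:R / N%:R <= h w] w).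
    by move=> mh; apply: L1_sum => k _; apply: L1_indic; exact: mA.
  have L1F : L1 F by apply: L1Z; exact: L1s.
  have L1G : L1 G by apply: L1Z; exact: L1s.
  have EF : E F = N%:R^-1 * \sum_(1 <= k < N.+1) fine (P [set w | k%:R / N%:R <= f w]).
    rewrite EZ; last exact: L1s.
    rewrite E_sum; last by move=> k _; apply: L1_indic; exact: mA.
    by congr (_ * _); apply: eq_bigr => k _; rewrite E_indic//; exact: mA.
  have EG : E G = N%:R^-1 * \sum_(1 <= k < N.+1) fine (P [set w | k%:R / N%:R <= g w]).
    rewrite EZ; last exact: L1s.
    rewrite E_sum; last by move=> k _; apply: L1_indic; exact: mA.
    by congr (_ * _); apply: eq_bigr => k _; rewrite E_indic//; exact: mA.
  have FGE : (fun w => F w * G w) = (fun w => (N%:R^-1 * N%:R^-1) *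
     \sum_(1 <= k < N.+1) \sum_(1 <= l < N.+1)
       \1_([set w | k%:R / N%:R <= f w] `&` [set w | l%:R / N%:R <= g w]) w).
    apply/funext => w; rewrite /F /G /staircase mulrACA; congr (_ * _).
    rewrite mulr_suml; apply: eq_bigr => k _; rewrite mulr_sumr.
    by apply: eq_bigr => l _; rewrite indicI.
  have mI k l : measurable ([set w | k%:R / N%:R <= f w] `&` [set w | l%:R / N%:R <= g w]).
    by apply: measurableI; exact: mA.
  have L1S : L1 (fun w => \sum_(1 <= k < N.+1) \sum_(1 <= l < N.+1)
       \1_([set w | k%:R / N%:R <= f w] `&` [set w | l%:R / N%:R <= g w]) w).
    by apply: L1_sum => k _; apply: L1_sum => l _; apply: L1_indic.
  have L1FG : L1 (fun w => F w * G w) by rewrite FGE; apply: L1Z.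
  have EFG : E (fun w => F w * G w) = (N%:R^-1 * N%:R^-1) *
      \sum_(1 <= k < N.+1) \sum_(1 <= l < N.+1)
      fine (P ([set w | k%:R / N%:R <= f w] `&` [set w | l%:R / N%:R <= g w])).
    rewrite FGE EZ// E_sum; last by move=> k _; apply: L1_sum => l _; apply: L1_indic.
    congr (_ * _); apply: eq_bigr => k _.
    rewrite E_sum; last by move=> l _; apply: L1_indic.
    by apply: eq_bigr => l _; rewrite E_indic.
  have cFG : `|E (fun w => F w * G w) - E F * E G| <= a.
    rewrite EFG EF EG mulrACA -mulrBr mulr_suml -sumrB normrM ger0_norm ?mulr_ge0//.
    rewrite -invfM ler_pdivrMl ?mulr_gt0//.
    apply: le_trans (ler_norm_sum _ _ _) _.
    apply: (@le_trans _ _ (\sum_(1 <= k < N.+1) \sum_(1 <= l < N.+1) a)); last first.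
      rewrite !big_const_nat !subn1 /= !iter_addr !addr0.
      by rewrite -mulrA !mulr_natl.
    apply: ler_sum => k _; rewrite mulr_sumr -sumrB.
    apply: le_trans (ler_norm_sum _ _ _) _; apply: ler_sum => l _; exact: afg.
  have apx h w : (forall w, 0 <= h w <= 1) -> `|h w - staircase N h w| <= N%:R^-1.
    move=> h01; have /andP[] := staircase_approx N0 (h01 w).
    by move=> ? ?; rewrite ger0_norm; lra.
  have s01 h w : (forall w, 0 <= h w <= 1) -> 0 <= staircase N h w <= 1.
    move=> h01; have /andP[_] := staircase_approx N0 (h01 w).
    by move=> h1; rewrite staircase_ge0 (le_trans h1)//; case/andP: (h01 w).
  have E01 h : L1 h -> (forall w, 0 <= h w <= 1) -> `|E h| <= 1.
    move=> h1 h01; rewrite -[leRHS]E_cst; apply: ler_norm_E => //; first exact: L1_cst.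
    by move=> w; exact: nb.
  have d1 : `|E (fun w => f w * g w) - E (fun w => F w * G w)| <= 2 * N%:R^-1.
    rewrite -EB// -[leRHS]E_cst; apply: ler_norm_E => //; [exact: L1B|exact: L1_cst|].
    move=> w; rewrite (_ : _ - _ = f w * (g w - G w) + (f w - F w) * G w); last by ring.
    apply: le_trans (ler_normD _ _) _.
    rewrite (normrM (f w)) (normrM (f w - F w)) mulr2n mulrDl mul1r lerD//.
      by rewrite -[leRHS]mul1r ler_pM//; [exact: nb|exact: apx].
    rewrite -[leRHS]mulr1 ler_pM//; first exact: apx.
    exact: (nb _ _ (s01 _ w g01)).
  have d2 : `|E f * E g - E F * E G| <= 2 * N%:R^-1.
    rewrite (_ : _ - _ = E f * (E g - E G) + (E f - E F) * E G); last by ring.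
    apply: le_trans (ler_normD _ _) _; rewrite !normrM mulr2n mulrDl mul1r lerD//.
      rewrite -[leRHS]mul1r ler_pM//; first exact: E01.
      rewrite -EB// -[leRHS]E_cst; apply: ler_norm_E => //; [exact: L1B|exact: L1_cst|].
      by move=> w; exact: apx.
    rewrite -[leRHS]mulr1 ler_pM//; last by apply: E01 => // w; exact: s01.
    rewrite -EB// -[leRHS]E_cst; apply: ler_norm_E => //; [exact: L1B|exact: L1_cst|].
    by move=> w; exact: apx.
  rewrite (_ : _ - _ = (E (fun w => f w * g w) - E (fun w => F w * G w)) +
    (E (fun w => F w * G w) - E F * E G) - (E f * E g - E F * E G)); last by ring.
  apply: le_trans (ler_normB _ _) _.
  by have := ler_normD (E (fun w => f w * g w) - E (fun w => F w * G w))
    (E (fun w => F w * G w) - E F * E G); lra.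
apply/ler_addgt0Pr => e e0; pose N := (Num.truncn (4 / e)).+1.
have N0 : 0 < N%:R :> R by rewrite ltr0n.
apply: (le_trans (key N isT)); rewrite lerD2l ler_pdivrMr// -ler_pdivrMl// mulrC.
by apply: ltW; have /andP[] := @truncn_itv _ (4 / e) (divr_ge0 (ler0n _ 4) (ltW e0)).
Qed.

(** The map y -> y / (2 c) + 1/2 sends [-c, c] to [0, 1] and level sets to level sets. Undoing it
    multiplies the covariance by 2 a * 2 b. *)
Lemma cov_bounded al a b f g : measurable_fun setT f -> measurable_fun setT g ->
  0 < a -> 0 < b -> (forall w, `|f w| <= a) -> (forall w, `|g w| <= b) ->
  alpha_pair al f g -> `|E (fun w => f w * g w) - E f * E g| <= 4 * a * b * al.
Proof.
move=> mf mg a0 b0 fa gb afg.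
have L1f : L1 f by exact: L1_bounded fa.
have L1g : L1 g by exact: L1_bounded gb.
have L1fg : L1 (fun w => f w * g w).
  apply: (@L1_bounded _ (a * b)); first exact: measurable_funM.
  by move=> w; rewrite normrM ler_pM.
pose N h c := fun w : Omega => (2 * c)^-1 * h w + 2^-1 : R.
have mN h c : measurable_fun setT h -> measurable_fun setT (N h c).
  move=> mh; apply: measurable_funD; last exact: measurable_cst.
  by apply: measurable_funM => //; exact: measurable_cst.
have N01 h c w : 0 < c -> `|h w| <= c -> 0 <= N h c w <= 1.
  move=> c0; rewrite ler_norml => /andP[h1 h2]; rewrite /N.
  have -> : (2 * c)^-1 * h w + 2^-1 = (2 * c)^-1 * (h w + c) by field; rewrite gt_eqF.
  rewrite mulr_ge0 ?invr_ge0 ?mulr_ge0 ?(ltW c0)//=; last by lra.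
  by rewrite ler_pdivrMl ?mulr_gt0//; lra.
have setE h c x : 0 < c -> [set w | x <= N h c w] = [set w | (x - 2^-1) * (2 * c) <= h w].
  move=> c0; apply/seteqP; split=> w /=; rewrite /N.
    by rewrite -lerBlDr ler_pdivlMl ?mulr_gt0// mulrC.
  by rewrite -lerBlDr ler_pdivlMl ?mulr_gt0// mulrC.
have : `|E (fun w => N f a w * N g b w) - E (N f a) * E (N g b)| <= al.
  apply: cov_unit_interval; [exact: mN|exact: mN|by move=> w; exact: N01|by move=> w; exact: N01|].
  by move=> x y; rewrite !setE//; exact: afg.
have EN h c : L1 h -> E (N h c) = (2 * c)^-1 * E h + 2^-1.
  by move=> h1; rewrite ED ?EZ ?E_cst//; [exact: L1Z|exact: L1_cst].
rewrite !EN//.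
have -> : (fun w => N f a w * N g b w) =
   (fun w => ((2 * a)^-1 * (2 * b)^-1) * (f w * g w) +
     ((2 * a)^-1 / 2 * f w + ((2 * b)^-1 / 2 * g w + 2^-1 / 2))).
  by apply/funext => w; rewrite /N; ring.
have L1c : L1 (fun w : Omega => 2^-1 / 2 : R) by exact: L1_cst.
have L1b : L1 (fun w => (2 * b)^-1 / 2 * g w) by exact: L1Z.
have L1a : L1 (fun w => (2 * a)^-1 / 2 * f w) by exact: L1Z.
have L1ab := L1Z ((2 * a)^-1 * (2 * b)^-1) L1fg.
have L1bc := L1D L1b L1c.
rewrite (ED L1ab (L1D L1a L1bc)) (ED L1a L1bc) (ED L1b L1c) (EZ _ L1fg) (EZ _ L1f) (EZ _ L1g) E_cst.
set I := E (fun w => f w * g w).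
have -> : (2 * a)^-1 * (2 * b)^-1 * I +
  ((2 * a)^-1 / 2 * E f + ((2 * b)^-1 / 2 * E g + 2^-1 / 2)) -
  ((2 * a)^-1 * E f + 2^-1) * ((2 * b)^-1 * E g + 2^-1) =
  (4 * a * b)^-1 * (I - E f * E g) by field; rewrite ?gt_eqF.
by rewrite normrM gtr0_norm ?invr_gt0 ?mulr_gt0// ler_pdivrMl ?mulr_gt0.
Qed.

End expectation.

(** * Truncation of products and the covariance bound *)

Section truncation.
Context (R : realType).
Implicit Types (x : nat -> R) (s : seq nat) (l p : R).

(** Large values are sent to 0 rather than cut back to [l], so that a product with one large factor
    vanishes after truncation. *)
Definition trunc l (y : R) : R := if `|y| <= l then y else 0.

Lemma norm_trunc_le l y : 0 <= l -> `|trunc l y| <= l.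
Proof. by move=> l0; rewrite /trunc; case: ifP; rewrite ?normr0. Qed.

Lemma measurable_trunc l : measurable_fun setT (trunc l).
Proof.
by apply: measurable_fun_ifT => //; apply: measurable_fun_ler.
Qed.

Lemma norm_prod_le x s M : (forall i, i \in s -> `|x i| <= M) ->
  `|\prod_(i <- s) x i| <= M ^+ size s.
Proof.
elim: s => [|i s IH] xM; first by rewrite big_nil normr1.
rewrite big_cons normrM exprS ler_pM//; first by rewrite xM ?mem_head.
by apply: IH => j js; rewrite xM// in_cons js orbT.
Qed.

Lemma seq_max x s : s != [::] ->
  exists2 i, i \in s & forall j, j \in s -> `|x j| <= `|x i|.
Proof.
elim: s => // a [|b s] IH _.
  by exists a; rewrite ?mem_head// => j; rewrite inE => /eqP->.
have [//|i is_ imax] := IH; have [ai|ia] := leP `|x a| `|x i|.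
  exists i; first by rewrite in_cons is_ orbT.
  by move=> j; rewrite in_cons => /predU1P[->//|/imax].
exists a; first exact: mem_head.
move=> j; rewrite in_cons => /predU1P[->//|/imax ji].
exact: le_trans ji (ltW ia).
Qed.

(** If no factor exceeds [l], both products agree. Otherwise the truncated one is 0, and the largest
    factor M > l bounds the other by M^q <= l^q (M / l)^p, where q is the length of [s]. *)
Lemma prod_trunc_diff x s l p : 0 < l -> (size s)%:R <= p ->
  `|\prod_(i <- s) x i - \prod_(i <- s) trunc l (x i)| <=
  l ^+ size s * (l `^ p)^-1 * \sum_(i <- s) `|x i| `^ p.
Proof.
move=> l0 sp; have W0 : 0 <= \sum_(i <- s) `|x i| `^ p.
  by apply: sumr_ge0 => i _; exact: powR_ge0.
have lp0 : 0 <= l ^+ size s * (l `^ p)^-1.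
  by rewrite mulr_ge0 ?exprn_ge0 ?invr_ge0 ?powR_ge0// ltW.
have [/allP al|/allPn[j js]] := boolP (all (fun i => `|x i| <= l) s).
  rewrite [X in _ - X](eq_big_seq x) ?subrr ?normr0 ?(mulr_ge0 lp0 W0)//.
  by move=> i /al; rewrite /trunc => ->.
rewrite -ltNge => xj.
have -> : \prod_(i <- s) trunc l (x i) = 0.
  by rewrite (big_rem j)//= {1}/trunc leNgt xj mul0r.
rewrite subr0.
have [|i is_ imax] := @seq_max x s; first by case: (s) js.
have M0 : l < `|x i| := lt_le_trans xj (imax _ js).
apply: (le_trans (norm_prod_le imax)); set M := `|x i| in M0 *.
apply: (@le_trans _ _ (l ^+ size s * (l `^ p)^-1 * M `^ p)); last first.
  rewrite ler_wpM2l// (big_rem i)//= lerDl.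
  by apply: sumr_ge0 => k _; exact: powR_ge0.
have M0' : 0 < M by exact: lt_trans M0.
have Mn := ltW M0'; have ln := ltW l0; have lin : 0 <= l^-1 by rewrite invr_ge0.
have : (M / l) `^ (size s)%:R <= (M / l) `^ p.
  by apply: ler_powR => //; rewrite ler_pdivlMr// mul1r ltW.
have -> : (M / l) `^ (size s)%:R = M ^+ size s / l ^+ size s.
  by rewrite powR_mulrn ?divr_ge0// exprMn exprVn.
have -> : (M / l) `^ p = M `^ p / l `^ p.
  by rewrite powRM// -[l^-1]powR_inv1// -powRrM mulN1r powRN.
rewrite ler_pdivrMr ?exprn_gt0// => h; apply: (le_trans h).
by rewrite le_eqVlt; apply/orP; left; apply/eqP; ring.
Qed.

Lemma prod_trunc_le x s l : 0 <= l -> `|\prod_(i <- s) trunc l (x i)| <= l ^+ size s.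
Proof.
by move=> l0; apply: norm_prod_le => i _; exact: norm_trunc_le.
Qed.

End truncation.

Section covariance.
Context d (Omega : measurableType d) (R : realType) (P : probability Omega R).
Variable xi : nat -> Omega -> R.

Local Notation L1 f := (P.-integrable setT (EFin \o f)).
Local Notation E f := (Rintegral P setT f).

Lemma measurable_prod_seq d' (T : measurableType d') (f : nat -> T -> R) s :
  (forall i, i \in s -> measurable_fun setT (f i)) ->
  measurable_fun setT (fun w => \prod_(i <- s) f i w).
Proof.
elim: s => [|i s IH] mf.
  by under eq_fun do rewrite big_nil; exact: measurable_cst.
under eq_fun do rewrite big_cons.
apply: measurable_funM; first by apply: mf; exact: mem_head.
by apply: IH => j js; apply: mf; rewrite in_cons js orbT.
Qed.

Lemma E_le_cover (s : seq nat) (p c : R) :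
  (forall i, i \in s -> L1 (fun w => `|xi i w| `^ p)) ->
  (forall i, i \in s -> E (fun w => `|xi i w| `^ p) <= c) ->
  L1 (fun w => \sum_(i <- s) `|xi i w| `^ p) /\
  E (fun w => \sum_(i <- s) `|xi i w| `^ p) <= (size s)%:R * c.
Proof.
move=> xi1 xic.
have h : L1 (fun w => \sum_(i <- s) `|xi i w| `^ p) /\
    E (fun w => \sum_(i <- s) `|xi i w| `^ p) = \sum_(i <- s) E (fun w => `|xi i w| `^ p).
  have sE w : \sum_(i <- s) `|xi i w| `^ p = \sum_(i <- s | i \in s) `|xi i w| `^ p.
    by rewrite big_seq.
  split; first by under [X in EFin \o X]eq_fun do rewrite sE; exact: L1_sum.
  rewrite (_ : (fun w => _) = fun w => \sum_(i <- s | i \in s) `|xi i w| `^ p).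
    by rewrite E_sum// -big_seq.
  by apply/funext => w; rewrite sE.
split; first exact: h.1.
rewrite h.2 big_seq; apply: le_trans (ler_sum _ xic) _.
by rewrite -big_seq big_const_seq count_predT iter_addr addr0 mulr_natl.
Qed.

Lemma prod_trunc_E (s : seq nat) (p c l : R) : 0 < l -> (size s)%:R <= p ->
  (forall i, i \in s -> measurable_fun setT (xi i)) ->
  (forall i, i \in s -> L1 (fun w => `|xi i w| `^ p)) ->
  (forall i, i \in s -> E (fun w => `|xi i w| `^ p) <= c) ->
  [/\ L1 (fun w => \prod_(i <- s) xi i w),
    L1 (fun w => \prod_(i <- s) trunc l (xi i w)),
    `|E (fun w => \prod_(i <- s) xi i w) -
      E (fun w => \prod_(i <- s) trunc l (xi i w))| <=
      l ^+ size s * (l `^ p)^-1 * ((size s)%:R * c) &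
    `|E (fun w => \prod_(i <- s) trunc l (xi i w))| <= l ^+ size s].
Proof.
move=> l0 sp mxi xi1 xic.
have [W1 Wc] := E_le_cover xi1 xic.
have mtr : measurable_fun setT (fun w => \prod_(i <- s) trunc l (xi i w)).
  apply: measurable_prod_seq => i /mxi mi.
  by apply: (measurableT_comp (measurable_trunc l)).
have mpr := measurable_prod_seq mxi.
have T1 : L1 (fun w => \prod_(i <- s) trunc l (xi i w)).
  by apply: (@L1_bounded _ _ _ P _ (l ^+ size s) mtr) => w; apply: prod_trunc_le; exact: ltW.
have K0 : 0 <= l ^+ size s * (l `^ p)^-1.
  by rewrite mulr_ge0 ?exprn_ge0 ?invr_ge0 ?powR_ge0// ltW.
have WK1 := L1Z (l ^+ size s * (l `^ p)^-1) W1.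
have D1 : L1 (fun w => \prod_(i <- s) xi i w - \prod_(i <- s) trunc l (xi i w)).
  apply: (L1_le _ WK1); first exact: measurable_funB.
  by move=> w; exact: prod_trunc_diff.
(* The truncated product is bounded and the difference is dominated by a sum of p-th powers, so the
   product is integrable without appeal to Hoelder's inequality. *)
have X1 : L1 (fun w => \prod_(i <- s) xi i w).
  have := L1D D1 T1; congr (P.-integrable setT _).
  by apply/funext => w /=; rewrite subrK.
split => //.
  rewrite -EB//; apply: (@le_trans _ _ (E (fun w => l ^+ size s * (l `^ p)^-1 *
     \sum_(i <- s) `|xi i w| `^ p))).
    by apply: ler_norm_E => // w; exact: prod_trunc_diff.
  by rewrite EZ// ler_wpM2l.
rewrite -[leRHS](E_cst P); apply: ler_norm_E => //; first exact: L1_cst.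
by move=> w; apply: prod_trunc_le; exact: ltW.
Qed.

(* The truncation level l with l ^ (q r) = c / al balances the bounded part, of
   order al l ^ q, and the tails, of order c l ^ (q - q r). *)
Lemma cov_prod_pos (s1 s2 : seq nat) (r c al : R) :
  let q := (size s1 + size s2)%N in
  1 <= r -> 0 < c -> 0 < al <= 1 -> (0 < q)%N ->
  (forall i, i \in s1 ++ s2 -> measurable_fun setT (xi i)) ->
  (forall i, i \in s1 ++ s2 -> L1 (fun w => `|xi i w| `^ (q%:R * r))) ->
  (forall i, i \in s1 ++ s2 -> E (fun w => `|xi i w| `^ (q%:R * r)) <= c) ->
  (forall l, 0 < l -> alpha_pair P al (fun w => \prod_(i <- s1) trunc l (xi i w))
    (fun w => \prod_(i <- s2) trunc l (xi i w))) ->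
  `|E (fun w => \prod_(i <- s1 ++ s2) xi i w) -
    E (fun w => \prod_(i <- s1) xi i w) * E (fun w => \prod_(i <- s2) xi i w)| <=
  (4 + 2 * q%:R + q%:R ^+ 2) * (al `^ (1 - r^-1) * c `^ r^-1).
Proof.
move=> q r1 c0 /andP[al0 al1] q0 mxi xi1 xic alp.
have r0 : 0 < r by exact: lt_le_trans r1.
have q0' : 0 < q%:R :> R by rewrite ltr0n.
pose p := q%:R * r; pose l := (c / al) `^ (p^-1).
have p0 : 0 < p by rewrite mulr_gt0.
have ca0 : 0 < c / al by rewrite divr_gt0.
have l0 : 0 < l by exact: powR_gt0.
have lp : (l `^ p)^-1 = al / c.
  by rewrite /l -powRrM mulVf ?gt_eqF// powRr1 ?invf_div// ltW.
have lq : l ^+ q = (c / al) `^ r^-1.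
  rewrite -powR_mulrn ?ltW// /l -powRrM; congr (_ `^ _).
  by rewrite /p; field; rewrite !gt_eqF.
have Lal : l ^+ q * al = al `^ (1 - r^-1) * c `^ r^-1.
  rewrite lq powRM ?invr_ge0 ?ltW// -[al^-1]powR_inv1 ?ltW// -powRrM mulN1r.
  rewrite powRD; last by apply/implyP => _; rewrite gt_eqF.
  by rewrite powRr1 ?ltW//; ring.
have qp : q%:R <= p by rewrite /p ler_peMr// ltW.
have sub1 i : i \in s1 -> i \in s1 ++ s2 by rewrite mem_cat => ->.
have sub2 i : i \in s2 -> i \in s1 ++ s2 by rewrite mem_cat orbC => ->.
have s1p : (size s1)%:R <= p by apply: le_trans qp; rewrite ler_nat leq_addr.
have s2p : (size s2)%:R <= p by apply: le_trans qp; rewrite ler_nat leq_addl.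
have [|X X' dX bX] := @prod_trunc_E (s1 ++ s2) p c l l0 _ mxi xi1 xic.
  by rewrite size_cat.
have [Y Y' dY bY] := @prod_trunc_E s1 p c l l0 s1p (fun i h => mxi _ (sub1 i h))
  (fun i h => xi1 _ (sub1 i h)) (fun i h => xic _ (sub1 i h)).
have [Z Z' dZ bZ] := @prod_trunc_E s2 p c l l0 s2p (fun i h => mxi _ (sub2 i h))
  (fun i h => xi1 _ (sub2 i h)) (fun i h => xic _ (sub2 i h)).
have cov := @cov_bounded _ _ _ P al (l ^+ size s1) (l ^+ size s2) _ _
  (L1_measurable Y') (L1_measurable Z') (exprn_gt0 _ l0) (exprn_gt0 _ l0)
  (fun w => prod_trunc_le (xi^~ w) s1 (ltW l0))
  (fun w => prod_trunc_le (xi^~ w) s2 (ltW l0)) (alp _ l0).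
move: X dX cov; rewrite size_cat.
have -> : (fun w => \prod_(i <- s1) trunc l (xi i w) * \prod_(i <- s2) trunc l (xi i w)) =
  (fun w => \prod_(i <- s1 ++ s2) trunc l (xi i w)).
  by apply/funext => w; rewrite big_cat.
move: dY bY dZ bZ; rewrite lp.
set x := E _; set x' := E _; set y := E _; set y' := E _; set z := E _; set z' := E _.
move=> dx bx dy by_ _ dz cov.
(* Primes mark truncated products: [z' - x' * y'] is a covariance of bounded variables, and the
   other terms contain a tail. Each is at most [a * b * al] times a count; the second factor [al] in
   [(x - x') * (y - y')] is absorbed by [al <= 1]. *)
have -> : z - x * y = (z - z') + (z' - x' * y') - ((x - x') * (y - y') +
  (x - x') * y' + x' * (y - y')) by ring.
rewrite -Lal.
have cE m : al * (c^-1 * (m * c)) = al * m by field; rewrite gt_eqF.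
move: dx dy dz; rewrite -!mulrA !cE => dx dy dz.
set a := l ^+ size s1 in bx dx cov; set b := l ^+ size s2 in by_ dy cov.
have a0 : 0 <= a by rewrite exprn_ge0 ?ltW.
have b0 : 0 <= b by rewrite exprn_ge0 ?ltW.
have abE : l ^+ q = a * b by rewrite exprD.
rewrite -/q abE in dz *.
set m1 := (size s1)%:R in dx; set m2 := (size s2)%:R in dy.
have m10 : 0 <= m1 :> R by exact: ler0n.
have m20 : 0 <= m2 :> R by exact: ler0n.
have -> : q%:R = m1 + m2 :> R by rewrite natrD.
have qE : q%:R = m1 + m2 :> R by rewrite natrD.
rewrite qE in dz.
clearbody a b m1 m2 x x' y y' z z'.
have h1 : `|(x - x') * (y - y')| <= a * b * al * (m1 * m2).
  rewrite normrM; apply: (le_trans (ler_pM _ _ dx dy)) => //.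
  have -> : a * (al * m1) * (b * (al * m2)) = a * b * al * (m1 * m2) * al by ring.
  by rewrite ler_piMr// !mulr_ge0// ltW.
have h2 : `|(x - x') * y'| <= a * b * al * m1.
  rewrite normrM; apply: (le_trans (ler_pM _ _ dx by_)) => //.
  by rewrite le_eqVlt; apply/orP; left; apply/eqP; ring.
have h3 : `|x' * (y - y')| <= a * b * al * m2.
  rewrite normrM; apply: (le_trans (ler_pM _ _ bx dy)) => //.
  by rewrite le_eqVlt; apply/orP; left; apply/eqP; ring.
apply: le_trans (ler_normB _ _) _.
apply: (@le_trans _ _ (a * b * al * (m1 + m2) + 4 * (a * b * al) +
  (a * b * al * (m1 * m2) + a * b * al * m1 + a * b * al * m2))).
  apply: lerD.
    apply: le_trans (ler_normD _ _) _; apply: lerD; first by rewrite -mulrA.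
    by rewrite -!mulrA in cov *.
  apply: le_trans (ler_normD _ _) _; apply: lerD => //.
  by apply: le_trans (ler_normD _ _) _; exact: lerD.
have -> : a * b * al * (m1 + m2) + 4 * (a * b * al) +
  (a * b * al * (m1 * m2) + a * b * al * m1 + a * b * al * m2) =
  a * b * al * (4 + 2 * (m1 + m2) + m1 * m2) by ring.
rewrite [leRHS]mulrC ler_wpM2l// ?mulr_ge0//; first exact: ltW.
rewrite lerD2l sqrrD; have := mulr_ge0 m10 m20; have := sqr_ge0 m1; have := sqr_ge0 m2.
by rewrite mulr2n; lra.
Qed.

Lemma cov_prod (s1 s2 : seq nat) (r c al : R) :
  let q := (size s1 + size s2)%N in
  1 < r -> 0 < c -> 0 <= al <= 1 -> (0 < q)%N ->
  (forall i, i \in s1 ++ s2 -> measurable_fun setT (xi i)) ->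
  (forall i, i \in s1 ++ s2 -> L1 (fun w => `|xi i w| `^ (q%:R * r))) ->
  (forall i, i \in s1 ++ s2 -> E (fun w => `|xi i w| `^ (q%:R * r)) <= c) ->
  (forall l, 0 < l -> alpha_pair P al (fun w => \prod_(i <- s1) trunc l (xi i w))
    (fun w => \prod_(i <- s2) trunc l (xi i w))) ->
  `|E (fun w => \prod_(i <- s1 ++ s2) xi i w) -
    E (fun w => \prod_(i <- s1) xi i w) * E (fun w => \prod_(i <- s2) xi i w)| <=
  (4 + 2 * q%:R + q%:R ^+ 2) * (al `^ (1 - r^-1) * c `^ r^-1).
Proof.
move=> q r1 c0 /andP[+ al1] q0 mxi xi1 xic alp.
rewrite le_eqVlt => /predU1P[al0|al0]; last first.
  by apply: cov_prod_pos => //; [exact: ltW|rewrite al0].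
have th0 : 0 < 1 - r^-1 by rewrite subr_gt0 invf_lt1// (lt_trans _ r1).
rewrite -al0 powR0 ?gt_eqF// mul0r mulr0.
set K : R := 4 + 2 * q%:R + q%:R ^+ 2.
have K0 : 0 < K by rewrite ltr_pwDl ?exprn_ge0// ltr_pwDl ?mulr_ge0.
have KC0 : 0 < K * c `^ r^-1 by rewrite mulr_gt0 ?powR_gt0.
apply/ler_addgt0Pr => e e0; rewrite add0r.
pose b := Num.min 1 (e / (K * c `^ r^-1)).
have b0 : 0 < b by rewrite lt_min ltr01 divr_gt0.
have b1 : b <= 1 by rewrite ge_min lexx.
pose al' := b `^ (1 - r^-1)^-1.
have al'0 : 0 < al' by exact: powR_gt0.
have al'1 : al' <= 1.
  rewrite -[leRHS](@powRr0 _ b); apply: ger_powR; first by rewrite b0.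
  by rewrite invr_ge0 ltW.
have := @cov_prod_pos s1 s2 r c al' (ltW r1) c0 _ q0 mxi xi1 xic.
rewrite al'0 al'1 => /(_ isT) h; apply: (le_trans (h _)) => {h}.
  by move=> l l0 x y; apply: le_trans (alp l l0 x y) _; rewrite -al0 ltW.
rewrite /al' -powRrM mulVf ?gt_eqF// powRr1 ?(ltW b0)//.
by rewrite -/K mulrCA -ler_pdivlMr// ge_min lexx orbT.
Qed.

End covariance.

(** * Moment inequality for strongly mixing arrays *)

Section array.
Context d (Omega : measurableType d) (R : realType) (P : probability Omega R).
Context d' (X : measurableType d') (Y : nat -> nat -> Omega -> X).
Hypothesis mY : forall n t, (1 <= t <= n)%N -> measurable_fun setT (Y n t).

Local Notation L1 f := (P.-integrable setT (EFin \o f)).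
Local Notation E f := (Rintegral P setT f).
Local Notation emp n f w := (empirical_process P Y n 1%R f w).

Lemma fine_expectation (f : Omega -> R) : fine 'E_P[f] = E f.
Proof. by rewrite unlock. Qed.

Definition centered n (f : X -> R) i w : R := f (Y n i w) - E (f \o Y n i).

Lemma empirical_processE n f w :
  emp n f w = (Num.sqrt n%:R)^-1 * \sum_(1 <= i < n.+1) centered n f i w.
Proof.
rewrite /empirical_process mulr1 natrK; congr (_ * _); apply: eq_bigr => i _.
by rewrite fine_expectation.
Qed.

Definition alphar t : R := fine (alpha P Y t).

Lemma sigma_block_measurable n a b A : (1 <= a)%N -> (b <= n)%N ->
  sigma_block Y n a b A -> measurable A.
Proof.
move=> a1 bn; apply: smallest_sub; first exact: sigma_algebra_measurable.
move=> _ [j /= /andP[aj jb]] [B mB <-]; apply: mY => //; lia.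
Qed.

Lemma measurable_sigma_block n a b j (f : X -> R) : (a <= j <= b)%N ->
  measurable_fun setT f -> measurable_fun
   (setT : set (g_sigma_algebraType (\bigcup_(j in [set j | a <= j <= b]%N)
        preimage_set_system setT (Y n j) measurable))) (f \o Y n j).
Proof.
move=> ajb mf _ B mB; rewrite setTI comp_preimage.
apply: sub_sigma_algebra; exists j => //; exists (f @^-1` B).
  by rewrite -[X in measurable X]setTI; exact: mf.
by rewrite setTI.
Qed.

Lemma prob_diff_le1 A B : measurable A -> measurable B ->
  (`|P (A `&` B) - P A * P B| <= 1)%E.
Proof.
move=> mA mB; have mAB := measurableI _ _ mA mB.
have pE C : measurable C -> exists2 x : R, P C = x%:E & 0 <= x <= 1.
  move=> mC; exists (fine (P C)); first by rewrite fineK ?fin_num_measure.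
  by rewrite fine_ge0// -lee_fin fineK ?fin_num_measure// probability_le1.
have [x -> /andP[x0 x1]] := pE _ mAB; have [y -> /andP[y0 y1]] := pE _ mA.
have [z -> /andP[z0 z1]] := pE _ mB.
rewrite -EFinM -EFinB /= lee_fin ler_norml; apply/andP; split; last by nra.
by have := mulr_ile1 y0 z0 y1 z1; lra.
Qed.

Lemma alpha_row_bounds n t : (0 <= alpha_row P Y n t <= 1)%E.
Proof.
rewrite /alpha_row; case: ifP => [tn|_]; last by rewrite lexx lee01.
apply/andP; split.
  apply: ereal_sup_ubound; exists 1%N, set0, set0.
  split; [by lia|exact: sigma_algebra0|exact: sigma_algebra0|].
  by rewrite set0I measure0 mule0 sube0 abse0.
apply: ge_ereal_sup => _ [k [A [B [/andP[k1 kn] sA sB ->]]]].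
apply: prob_diff_le1.
  by apply: (sigma_block_measurable _ _ sA) => //; lia.
by apply: (sigma_block_measurable _ _ sB) => //; lia.
Qed.

Lemma alpha_bounds t : (0 <= alpha P Y t <= 1)%E.
Proof.
rewrite /alpha; case: ifP => _; first by rewrite lee01 lexx.
apply/andP; split.
  apply: (@le_trans _ _ (alpha_row P Y 1 t)).
    by have /andP[] := alpha_row_bounds 1 t.
  by apply: ereal_sup_ubound; exists 1%N.
by apply: ge_ereal_sup => _ [n _ <-]; have /andP[] := alpha_row_bounds n t.
Qed.

Lemma alpharE t : alpha P Y t = (alphar t)%:E.
Proof.
have /andP[a0 a1] := alpha_bounds t; rewrite /alphar fineK//.
by rewrite ge0_fin_numE// (le_lt_trans a1)// ltry.
Qed.

Lemma alphar_bounds t : 0 <= alphar t <= 1.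
Proof. by have := alpha_bounds t; rewrite alpharE !lee_fin. Qed.

Lemma alpha_sets n x y A B : (1 <= x)%N -> (x <= y)%N -> (y <= n)%N ->
  sigma_block Y n 1 x A -> sigma_block Y n y n B ->
  `|fine (P (A `&` B)) - fine (P A) * fine (P B)| <= alphar (y - x).
Proof.
move=> x1 xy yn sA sB.
have mA : measurable A by apply: sigma_block_measurable sA => //; lia.
have mB : measurable B by apply: sigma_block_measurable sB => //; lia.
have mAB := measurableI _ _ mA mB.
rewrite -lee_fin -alpharE -abse_EFin EFinB EFinM !fineK ?fin_num_measure//.
(* If [y = x] the two blocks share an index; the convention that the coefficient at 0 is 1 makes the
   bound trivial. *)
rewrite /alpha; case: ifPn => [_|t0]; first exact: prob_diff_le1.
apply: (@le_trans _ _ (alpha_row P Y n (y - x))); last first.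
  by apply: ereal_sup_ubound; exists n => //=; lia.
rewrite /alpha_row; case: ifPn => [_|]; last by lia.
apply: ereal_sup_ubound; exists x, A, B; split => //; first by lia.
by rewrite subnKC.
Qed.

(** The functions [g i] vary with the index because centring subtracts the mean of [f (Y n i)],
    which may change along a row. *)
Lemma alpha_pair_prod n x y s1 s2 (g : nat -> X -> R) :
  (1 <= x)%N -> (x <= y)%N -> (y <= n)%N ->
  (forall i, measurable_fun setT (g i)) ->
  all (fun i => 1 <= i <= x)%N s1 -> all (fun i => y <= i <= n)%N s2 ->
  alpha_pair P (alphar (y - x)) (fun w => \prod_(i <- s1) g i (Y n i w))
    (fun w => \prod_(i <- s2) g i (Y n i w)).
Proof.
move=> x1 xy yn mg /allP s1x /allP s2y c e.
apply: (@alpha_sets n x y) => //.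
  pose T := g_sigma_algebraType (\bigcup_(j in [set j | 1 <= j <= x]%N)
        preimage_set_system setT (Y n j) measurable).
  have : measurable_fun (setT : set T) (fun w => \prod_(i <- s1) g i (Y n i w)).
    apply: (@measurable_prod_seq R _ T (fun i w => g i (Y n i w))) => i /s1x ix.
    exact: (measurable_sigma_block ix (mg i)).
  exact: (@measurable_ge_set _ T).
pose T := g_sigma_algebraType (\bigcup_(j in [set j | y <= j <= n]%N)
      preimage_set_system setT (Y n j) measurable).
have : measurable_fun (setT : set T) (fun w => \prod_(i <- s2) g i (Y n i w)).
  apply: (@measurable_prod_seq R _ T (fun i w => g i (Y n i w))) => i /s2y ix.
  exact: (measurable_sigma_block ix (mg i)).
exact: (@measurable_ge_set _ T).
Qed.

End array.

(** * Moments of centred variables *)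

Section centering.
Context d (Omega : measurableType d) (R : realType) (P : probability Omega R).

Local Notation L1 f := (P.-integrable setT (EFin \o f)).
Local Notation E f := (Rintegral P setT f).

(** The one-factor case of [prod_trunc_E] at the level with l^p = c: the bounded part and the tail
    contribute at most l each. This takes the place of Jensen's inequality, at the price of 2^p. *)
Lemma mean_le (f : Omega -> R) (p c : R) : 0 < c -> 1 <= p ->
  measurable_fun setT f ->
  L1 (fun w => `|f w| `^ p) -> E (fun w => `|f w| `^ p) <= c ->
  L1 f /\ `|E f| `^ p <= 2 `^ p * c.
Proof.
move=> c0 p1 mf f1 fc; have p0 : 0 < p by exact: lt_le_trans p1.
pose l := c `^ p^-1; have l0 : 0 < l by exact: powR_gt0.
have lp : l `^ p = c by rewrite /l -powRrM mulVf ?gt_eqF// powRr1// ltW.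
have /= := @prod_trunc_E _ _ _ P (fun=> f) [:: 0%N] p c l l0 p1.
case; [by []|by []|by []|].
have e1 g : (fun w : Omega => \prod_(i <- [:: 0%N]) (g w : R)) = g.
  by apply/funext => w; rewrite big_seq1.
rewrite !e1 => F1 T1 d1 b1; split => //.
rewrite lp mul1r expr1 -mulrA mulVf ?gt_eqF// mulr1 in d1.
have : `|E f| <= 2 * l.
  rewrite -[E f](subrK (E (fun w => trunc l (f w)))).
  by apply: le_trans (ler_normD _ _) _; rewrite expr1 in b1; lra.
move=> /(ge0_ler_powR (ltW p0)) => /(_ _ _)/le_trans; apply.
- by rewrite nnegrE.
- by rewrite nnegrE mulr_ge0// ltW.
- by rewrite powRM ?(ltW l0)// lp.
Qed.

Lemma powR_add_le (a b p : R) : 0 <= a -> 0 <= b -> 0 <= p ->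
  (a + b) `^ p <= 2 `^ p * (a `^ p + b `^ p).
Proof.
move=> a0 b0 p0; wlog ab : a b a0 b0 / a <= b.
  move=> h; have [/h|/ltW/h] := leP a b; first exact.
  by rewrite addrC [a `^ p + _]addrC; exact.
apply: (@le_trans _ _ ((2 * b) `^ p)).
  by apply: ge0_ler_powR; rewrite ?nnegrE ?addr_ge0 ?mulr_ge0//; lra.
by rewrite powRM// ler_wpM2l ?powR_ge0// lerDr powR_ge0.
Qed.

(** One factor 2^p comes from splitting the power of the difference, the other from [mean_le];
    together they give 4^p. *)
Lemma centered_moment (f : Omega -> R) (p c : R) : 0 < c -> 1 <= p ->
  measurable_fun setT f ->
  L1 (fun w => `|f w| `^ p) -> E (fun w => `|f w| `^ p) <= c ->
  L1 (fun w => `|f w - E f| `^ p) /\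
  E (fun w => `|f w - E f| `^ p) <= 2 * 4 `^ p * c.
Proof.
move=> c0 p1 mf f1 fc; have p0 : 0 <= p by exact: le_trans p1.
have [F1 Ef] := mean_le c0 p1 mf f1 fc.
have bound w : `|f w - E f| `^ p <= 2 `^ p * (`|f w| `^ p + `|E f| `^ p).
  apply: le_trans (powR_add_le _ _ _) => //.
  by apply: ge0_ler_powR; rewrite ?nnegrE ?addr_ge0//; exact: ler_normB.
have G1 : L1 (fun w => 2 `^ p * (`|f w| `^ p + `|E f| `^ p)).
  by apply: L1Z; apply: L1D => //; exact: L1_cst.
have m1 : L1 (fun w => `|f w - E f| `^ p).
  apply: L1_le G1 _ => [|w].
    apply: (measurableT_comp (measurable_powR p)).
    by apply: measurableT_comp => //; apply: measurable_funB => //; exact: measurable_cst.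
  by rewrite (ger0_norm (powR_ge0 _ _)); exact: bound.
split=> //; apply: le_trans (ler_E m1 G1 bound) _.
rewrite EZ; last by apply: L1D => //; exact: L1_cst.
rewrite ED//; last exact: L1_cst.
rewrite E_cst; have -> : (4 : R) = 2 * 2 by lra.
rewrite powRM//; set z := 2 `^ p in Ef *.
have z1 : 1 <= z by rewrite -[1](@powRr0 _ 2); apply: ler_powR => //; lra.
rewrite -mulrA [2 * _]mulrC -!mulrA ler_wpM2l//; first by lra.
by have := ler_peMl (ltW c0) z1; nra.
Qed.

End centering.

Lemma sorted_rcons_le s x i : sorted leq (rcons s x) -> i \in s -> (i <= x)%N.
Proof.
rewrite -[rcons s x]revK rev_sorted rev_rcons /= => /order_path_min h is_.
have /allP/(_ i) : all (fun y => y <= x)%N (rev s).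
  by apply: h => a b c /= ba cb; exact: leq_trans cb ba.
by rewrite mem_rev; exact.
Qed.

Section moment_inequality.
Context d (Omega : measurableType d) (R : realType) (P : probability Omega R).
Context d' (X : measurableType d') (Y : nat -> nat -> Omega -> X).
Hypothesis mY : forall n t, (1 <= t <= n)%N -> measurable_fun setT (Y n t).

Local Notation L1 f := (P.-integrable setT (EFin \o f)).
Local Notation E f := (Rintegral P setT f).
Local Notation emp n f w := (empirical_process P Y n 1%R f w).

Lemma E_lsum n q (F : seq nat -> Omega -> R) :
  (forall s, size s = q -> in_range n s -> L1 (F s)) ->
  L1 (fun w => lsum n q (F^~ w)) /\
  E (fun w => lsum n q (F^~ w)) = lsum n q (fun s => E (F s)).
Proof.
elim: q F => [|q IH] F F1 /=; first by split => //; exact: F1.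
have h g : (1 <= g < n.+1)%N -> L1 (fun w => lsum n q (fun s => F (g :: s) w)) /\
    E (fun w => lsum n q (fun s => F (g :: s) w)) = lsum n q (fun s => E (F (g :: s))).
  move=> gn; apply: (IH (fun s => F (g :: s))) => s sq sr; apply: F1 => /=.
    by rewrite sq.
  by rewrite sr andbT.
under [X in EFin \o X]eq_fun do rewrite big_nat.
split; first by apply: L1_sum => g /h[].
under [X in Rintegral _ _ X]eq_fun do rewrite big_nat.
rewrite E_sum; last by move=> g /h[].
by rewrite -big_nat; apply: eq_big_nat => g /h[].
Qed.

(** All orders [q%:R * r] are listed because the covariance bound for a tuple of [q] variables uses
    moments of exactly that order. *)
Definition moments_le (r : R) Q n (f : X -> R) (c : R) :=
  forall t q, (1 <= t <= n)%N -> (2 <= q <= Q)%N ->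
    L1 (fun w => `|f (Y n t w)| `^ (q%:R * r)) /\
    E (fun w => `|f (Y n t w)| `^ (q%:R * r)) <= c.

Lemma measurable_comp_Y n t (f : X -> R) : (1 <= t <= n)%N ->
  measurable_fun setT f -> measurable_fun setT (f \o Y n t).
Proof. by move=> tn mf; apply: measurableT_comp => //; exact: mY. Qed.

Lemma measurable_empirical n (f : X -> R) : measurable_fun setT f ->
  measurable_fun setT (fun w => emp n f w).
Proof.
move=> mf; under eq_fun do rewrite empirical_processE big_nat big_mkcond.
apply: measurable_funM; first exact: measurable_cst.
apply: measurable_sum => i; case: (boolP (1 <= i < n.+1)%N) => [ni|_]; last exact: measurable_cst.
by apply: measurable_funB; [exact: (measurable_comp_Y ni)|exact: measurable_cst].
Qed.

Lemma moment_bound (r sa : R) (Q : nat) : 1 < r -> (2 <= Q)%N -> ~~ odd Q ->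
  (forall n, \sum_(0 <= t < n) t.+1%:R ^+ (Q - 2) * alphar P Y t `^ (1 - r^-1) <= sa) ->
  exists2 C : R, 0 <= C & forall n f c, (0 < n)%N -> 0 < c -> 1 <= n%:R * c `^ r^-1 ->
    measurable_fun setT f -> moments_le r Q n f c ->
    L1 (fun w => emp n f w ^+ Q) /\
    E (fun w => emp n f w ^+ Q) <= C * (c `^ r^-1) ^+ Q./2.
Proof.
move=> r1 Q2 Qe SE.
have r0 : 0 < r by exact: lt_trans r1.
have S0 : 0 <= sa by have := SE 0%N; rewrite big_nil.
have [K K0 HK] := @sorted_lsum_bound R Q sa S0 Q (introT andP (conj (ltnW Q2) (leqnn Q))).
pose K1 : R := 2 * 4 `^ (Q%:R * r).
pose K2 : R := 4 + 2 * Q%:R + Q%:R ^+ 2.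
have K11 : 1 <= K1.
  have : 1 <= 4 `^ (Q%:R * r).
    by rewrite -[X in X <= _](@powRr0 _ 4); apply: ler_powR; rewrite ?mulr_ge0 ?(ltW r0)//; lra.
  by rewrite /K1; lra.
have K10 : 0 < K1 by exact: lt_le_trans K11.
have K21 : 1 <= K2.
  by rewrite /K2; have := ler0n R Q; have := sqr_ge0 (Q%:R : R); lra.
have K1r : 1 <= K1 `^ r^-1.
  by rewrite -[X in X <= _](@powRr0 _ K1); apply: ler_powR; rewrite ?invr_ge0 ?(ltW r0).
exists (Q`!%:R * K * (K2 * K1 `^ r^-1) ^+ Q./2).
  by rewrite !mulr_ge0// exprn_ge0// mulr_ge0 ?powR_ge0//; lra.
move=> n f c n0 c0 nc mf fc.
pose xi i := centered P Y n f i.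
have mfY t : (1 <= t <= n)%N -> measurable_fun setT (f \o Y n t).
  by move=> tn; exact: measurable_comp_Y.
have qr1 q : (2 <= q)%N -> 1 <= q%:R * r.
  move=> q2; have : (2 : R) <= q%:R by rewrite ler_nat.
  by move=> q2'; nra.
have xim t q : (1 <= t <= n)%N -> (2 <= q <= Q)%N ->
    L1 (fun w => `|xi t w| `^ (q%:R * r)) /\
    E (fun w => `|xi t w| `^ (q%:R * r)) <= K1 * c.
  move=> tn qQ; have [f1 f2] := fc t q tn qQ; have /andP[q2 qQ'] := qQ.
  have [x1 x2] := centered_moment c0 (qr1 _ q2) (mfY _ tn) f1 f2.
  split => //; apply: (le_trans x2); rewrite ler_wpM2r ?(ltW c0)//.
  rewrite /K1 ler_wpM2l//; apply: ler_powR; first by lra.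
  by rewrite ler_wpM2r ?(ltW r0)// ler_nat.
have f1 t : (1 <= t <= n)%N -> L1 (f \o Y n t).
  move=> tn; have [|g1 g2] := fc t 2%N tn; first by rewrite Q2.
  by have [] := mean_le c0 (qr1 2%N isT) (mfY _ tn) g1 g2.
have mxi t : (1 <= t <= n)%N -> measurable_fun setT (xi t).
  by move=> tn; apply: measurable_funB; [exact: mfY|exact: measurable_cst].
have Exi t : (1 <= t <= n)%N -> E (xi t) = 0.
  by move=> tn; rewrite EB ?E_cst ?subrr//; [exact: f1|exact: L1_cst].
(* The absolute value makes [psi] nonnegative and keeps it symmetric, as sorting requires; centring
   makes it vanish on singletons. *)
pose psi s := `|E (fun w => \prod_(i <- s) xi i w)|.
have c'0 : 0 < K1 * c by rewrite mulr_gt0.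
pose B := K2 * (K1 * c) `^ r^-1.
have cr0 : 0 <= (K1 * c) `^ r^-1 by exact: powR_ge0.
have crE : (K1 * c) `^ r^-1 = K1 `^ r^-1 * c `^ r^-1 by rewrite powRM ?ltW.
have K20 : 0 <= K2 by exact: le_trans K21.
have B0 : 0 <= B by rewrite mulr_ge0.
have D1 : 1 <= n%:R * B.
  rewrite /B crE (_ : _ * _ = (K2 * K1 `^ r^-1) * (n%:R * c `^ r^-1)); last by ring.
  by rewrite mulr_ege1// mulr_ege1.
pose a t := alphar P Y t `^ (1 - r^-1).
have a0 t : 0 <= a t by exact: powR_ge0.
have cov s1 x y s2 : in_range n s1 -> in_range n s2 -> in_range n [:: x; y] ->
    sorted leq (rcons s1 x) -> sorted leq (y :: s2) -> (x <= y)%N ->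
    (size s1 + size s2 + 2 <= Q)%N ->
    psi (s1 ++ [:: x, y & s2]) <=
      psi (rcons s1 x) * psi (y :: s2) + B * a (y - x)%N.
  move=> s1r s2r /and3P[/andP[x1 xn] /andP[y1 yn] _] so1 so2 xy sQ.
  rewrite -cat_rcons /psi -normrM -lerBlDl.
  apply: le_trans (lerB_dist _ _) _.
  have inr i : i \in rcons s1 x ++ (y :: s2) -> (1 <= i <= n)%N.
    rewrite mem_cat mem_rcons !in_cons => /orP[/predU1P[->|]|/predU1P[->|]].
    - by rewrite x1.
    - by move/(allP s1r).
    - by rewrite y1.
    - by move/(allP s2r).
  have szE : (size (rcons s1 x) + size (y :: s2) = size s1 + size s2 + 2)%N.
    by rewrite size_rcons /= addSn addnS addn2.
  have q2Q : (2 <= size (rcons s1 x) + size (y :: s2) <= Q)%N.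
    rewrite szE; exact: (introT andP (conj (leq_addl _ 2) sQ)).
  apply: le_trans (@cov_prod _ _ _ P xi (rcons s1 x) (y :: s2) r (K1 * c)
    (alphar P Y (y - x)) r1 c'0 (alphar_bounds P mY _) _ _ _ _ _) _.
  - exact: leq_trans (proj1 (andP q2Q)).
  - by move=> i /inr; exact: mxi.
  - by move=> i /inr ir; have [] := xim _ _ ir q2Q.
  - by move=> i /inr ir; have [] := xim _ _ ir q2Q.
  - move=> l l0.
    apply: (@alpha_pair_prod _ _ _ P _ _ _ mY n x y _ _
      (fun i z => trunc l (f z - E (f \o Y n i)))) => //.
    + move=> i; apply: (measurableT_comp (measurable_trunc l)).
      by apply: measurable_funB => //; exact: measurable_cst.
    + apply/allP => i; rewrite mem_rcons in_cons => /predU1P[->|is1].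
        by rewrite x1 leqnn.
      by rewrite (sorted_rcons_le so1 is1) andbT; have /andP[] := allP s1r _ is1.
    + apply/allP => i; rewrite in_cons => /predU1P[->|is2]; first by rewrite leqnn yn.
      have /andP[_ ->] := allP s2r _ is2; rewrite andbT.
      by have /allP/(_ _ is2) := order_path_min leq_trans so2.
  have -> : B * a (y - x)%N = K2 * (a (y - x)%N * (K1 * c) `^ r^-1).
    by rewrite /B -mulrA [X in _ * X]mulrC.
  apply: ler_wpM2r; first by rewrite mulr_ge0 ?powR_ge0.
  set q := (size (rcons s1 x) + size (y :: s2))%N; have qQ : (q <= Q)%N by case/andP: q2Q.
  rewrite /K2; apply: lerD; first by rewrite lerD2l ler_wpM2l// ler_nat.
  by rewrite lerXn2r ?nnegrE ?ler_nat.
have psi1 i : (1 <= i <= n)%N -> psi [:: i] = 0.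
  move=> ir; rewrite /psi.
  by rewrite (_ : (fun w => _) = xi i) ?Exi ?normr0//; apply/funext => w; rewrite big_seq1.
have := HK n psi a B (n%:R * B) (fun s => normr_ge0 _) a0 B0 (SE n) cov psi1 D1 (lexx _).
move=> sb.
have prod1 s : size s = Q -> in_range n s -> L1 (fun w => \prod_(i <- s) xi i w).
  move=> sQ sr; have := @prod_trunc_E _ _ _ P xi s (Q%:R * r) (K1 * c) 1 ltr01.
  rewrite sQ ler_peMr ?(ltW r1)// => /(_ isT)[] //.
  - by move=> i /(allP sr); exact: mxi.
  - by move=> i /(allP sr) ir; have [|] := xim i Q ir; rewrite ?Q2 ?leqnn.
  - by move=> i /(allP sr) ir; have [|] := xim i Q ir; rewrite ?Q2 ?leqnn.
have [l1 lE] := E_lsum prod1.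
have QE : Q = (Q./2 * 2)%N by rewrite muln2 halfK (negbTE Qe) subn0.
have n0' : 0 < n%:R :> R by rewrite ltr0n.
have sqE : (Num.sqrt n%:R)^-1 ^+ Q = (n%:R^-1 : R) ^+ Q./2.
  by rewrite [in LHS]QE mulnC exprM exprVn sqr_sqrtr// ltW.
have empE w : emp n f w ^+ Q =
    n%:R^-1 ^+ Q./2 * lsum n Q (fun s => \prod_(i <- s) xi i w).
  by rewrite empirical_processE exprMn sqE expr_sum_lsum.
have -> : (fun w => emp n f w ^+ Q) =
    (fun w => n%:R^-1 ^+ Q./2 * lsum n Q (fun s => \prod_(i <- s) xi i w)).
  by apply/funext => w; rewrite empE.
split; first exact: L1Z.
rewrite EZ// lE; apply: (@le_trans _ _ (n%:R^-1 ^+ Q./2 * lsum n Q psi)).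
  by rewrite ler_wpM2l ?exprn_ge0 ?invr_ge0//; apply: ler_lsum => s _ _; exact: ler_norm.
apply: (@le_trans _ _ (n%:R^-1 ^+ Q./2 * (Q`!%:R * (K * (n%:R * B) ^+ Q./2)))).
  rewrite ler_wpM2l ?exprn_ge0 ?invr_ge0//.
  apply: le_trans (@lsum_sym_le R n Q psi _ _) _.
  - by move=> s; exact: normr_ge0.
  - move=> s s' ss'; rewrite /psi; congr (`|Rintegral _ _ _|).
    by apply/funext => w; exact: perm_big.
  - by rewrite ler_wpM2l.
rewrite /B crE !exprMn exprVn le_eqVlt; apply/orP; left; apply/eqP.
have nQ : (n%:R : R) ^+ Q./2 != 0 by rewrite expf_neq0// gt_eqF.
by field.
Qed.

End moment_inequality.

(** * Maximal inequality and chaining *)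

Section maximal.
Context d (Omega : measurableType d) (R : realType) (P : probability Omega R).
Context d' (X : measurableType d') (Y : nat -> nat -> Omega -> X).
Hypothesis mY : forall n t, (1 <= t <= n)%N -> measurable_fun setT (Y n t).

Local Notation L1 f := (P.-integrable setT (EFin \o f)).
Local Notation E f := (Rintegral P setT f).
Local Notation emp n f w := (empirical_process P Y n 1%R f w).

(* With l = (E |z|^Q)^(1/Q) this gives E |z| <= 2 l. *)
Lemma norm_le_power_envelope (l z : R) Q : 0 < l -> (1 <= Q)%N ->
  `|z| <= l + l * (`|z| ^+ Q / l ^+ Q).
Proof.
move=> l0 Q1; have [zl|lz] := leP `|z| l.
  by rewrite (le_trans zl)// lerDl mulr_ge0 ?divr_ge0 ?exprn_ge0// ltW.
apply: (@le_trans _ _ (l * (`|z| / l) ^+ Q)); last first.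
  by rewrite exprMn exprVn lerDr ltW.
rewrite -ler_pdivrMl// mulrC -[leLHS]expr1 ler_weXn2l//.
by rewrite ler_pdivlMr// mul1r ltW.
Qed.

(** The maximum over [I] is replaced by an explicit measurable dominator. Adding up Q-th moments is
    what produces the power 1/Q of the cardinality. *)
Lemma maximal_family (r sa : R) (Q : nat) : 1 < r -> (2 <= Q)%N -> ~~ odd Q ->
  (forall n, \sum_(0 <= t < n) t.+1%:R ^+ (Q - 2) * alphar P Y t `^ (1 - r^-1) <= sa) ->
  exists2 C : R, 0 <= C & forall n (I : finType) (g : I -> X -> R) eps,
    (0 < n)%N -> 0 < eps -> 1 <= n%:R * (eps `^ r^-1) ^+ 2 ->
    (forall i, measurable_fun setT (g i)) ->
    (forall i, moments_le P Y r Q n (g i) (eps ^+ 2)) ->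
    exists U, [/\ L1 U, forall w, 0 <= U w,
      E U <= C * (#|I|%:R `^ (Q%:R^-1) * eps `^ r^-1) &
      forall i w, `|emp n (g i) w| <= U w].
Proof.
move=> r1 Q2 Qe SE; have [C C0 HC] := moment_bound mY r1 Q2 Qe SE.
have Q0 : Q%:R != 0 :> R by rewrite pnatr_eq0; lia.
(* The summand 1 keeps [C'], and with it the level [l], positive when [C = 0]. *)
pose C' := (C + 1) `^ Q%:R^-1.
have C'0 : 0 < C' by rewrite powR_gt0// ltr_wpDl.
have C'Q : C' ^+ Q = C + 1.
  by rewrite -powR_mulrn ?(ltW C'0)// -powRrM mulVf// powRr1// addr_ge0.
exists (2 * C'); first by rewrite mulr_ge0// ltW.
move=> n I g eps n0 eps0 neps mg mom.
have eps20 : 0 < eps ^+ 2 by rewrite exprn_gt0.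
have eps2E : (eps ^+ 2) `^ r^-1 = (eps `^ r^-1) ^+ 2.
  by rewrite -(powR_mulrn 2 (ltW eps0)) -(powR_mulrn 2 (powR_ge0 _ _)) powRAC.
have [I0|I0] := posnP #|I|.
  exists (fun=> 0); split => //; first exact: L1_cst.
    by rewrite E_cst I0 powR0 ?invr_eq0// mul0r mulr0.
  by move=> i; have := fintype0 i; rewrite I0.
set N := #|I| in I0 *; have N0 : 0 < N%:R :> R by rewrite ltr0n.
pose l := C' * (N%:R `^ Q%:R^-1 * eps `^ r^-1).
have l0 : 0 < l by rewrite !mulr_gt0// powR_gt0.
have lQ : l ^+ Q = (C + 1) * (N%:R * (eps `^ r^-1) ^+ Q).
  rewrite !exprMn C'Q; congr (_ * (_ * _)).
  by rewrite -powR_mulrn ?powR_ge0// -powRrM mulVf// powRr1.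
have QE : Q = (2 * Q./2)%N by rewrite mul2n halfK (negbTE Qe) subn0.
have mom' i : L1 (fun w => emp n (g i) w ^+ Q) /\
    E (fun w => emp n (g i) w ^+ Q) <= C * (eps `^ r^-1) ^+ Q.
  have [|h1 h2] := HC n (g i) (eps ^+ 2) n0 eps20 _ (mg i) (mom i).
    by rewrite eps2E.
  by split => //; rewrite eps2E -exprM -QE in h2.
have evenE z : z ^+ Q = `|z| ^+ Q :> R.
  by rewrite QE !exprM real_normK// num_real.
(* The bound of [norm_le_power_envelope] with the single power replaced by the sum over [I]. As the
   expectations sum to at most [l ^+ Q], the second term has mean at most [l]. *)
pose U w := l + l / l ^+ Q * \sum_i emp n (g i) w ^+ Q.
have lQ0 : 0 <= l / l ^+ Q by rewrite divr_ge0 ?exprn_ge0// ltW.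
have S1 : L1 (fun w => \sum_i emp n (g i) w ^+ Q).
  by apply: L1_sum => i _; case: (mom' i).
have pow0 w i : 0 <= emp n (g i) w ^+ Q by rewrite evenE exprn_ge0.
exists U; split.
- by apply: L1D; [exact: L1_cst|exact: L1Z].
- by move=> w; rewrite addr_ge0 ?(ltW l0)// mulr_ge0// sumr_ge0.
- rewrite ED ?E_cst; [|exact: L1_cst|exact: L1Z].
  rewrite EZ// E_sum; last by move=> i _; case: (mom' i).
  have -> : 2 * C' * (N%:R `^ Q%:R^-1 * eps `^ r^-1) = l + l by rewrite /l; ring.
  rewrite lerD2l.
  rewrite -mulrA ger_pMr// ler_pdivrMl ?exprn_gt0// mulr1 lQ.
  apply: (@le_trans _ _ (\sum_(i : I) C * (eps `^ r^-1) ^+ Q)).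
    by apply: ler_sum => i _; case: (mom' i).
  rewrite sumr_const -[leLHS]mulr_natl mulrCA ler_wpM2r ?lerDl//.
  by rewrite mulr_ge0// exprn_ge0// powR_ge0.
move=> i w; apply: le_trans (norm_le_power_envelope _ l0 (ltnW Q2)) _.
rewrite lerD2l mulrA mulrAC -evenE ler_wpM2l// (bigD1 i)//= lerDl.
by apply: sumr_ge0 => j _; exact: pow0.
Qed.

Lemma empiricalB n (f g : X -> R) w :
  (forall t, (1 <= t <= n)%N -> L1 (f \o Y n t)) ->
  (forall t, (1 <= t <= n)%N -> L1 (g \o Y n t)) ->
  emp n (fun x => f x - g x) w = emp n f w - emp n g w.
Proof.
move=> f1 g1; rewrite !empirical_processE -mulrBr; congr (_ * _).
rewrite -sumrB; apply: eq_big_nat => t tn; rewrite /centered.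
rewrite [X in _ - X = _](EB (f1 t tn) (g1 t tn)).
by move: (E _) (E _) => u v; ring.
Qed.

(** Pointwise |f - E f| <= b + E b = (b - E b) + 2 E b. The centred part sums to the empirical
    process of [b], and the means accumulate to the bias of order sqrt n eps. *)
Lemma empirical_envelope n (f b : X -> R) eps w : (0 < n)%N ->
  (forall t, (1 <= t <= n)%N -> L1 (f \o Y n t)) ->
  (forall t, (1 <= t <= n)%N -> L1 (b \o Y n t)) ->
  (forall x, `|f x| <= b x) ->
  (forall t, (1 <= t <= n)%N -> E (b \o Y n t) <= eps) ->
  `|emp n f w| <= `|emp n b w| + 2 * (Num.sqrt n%:R * eps).
Proof.
move=> n0 f1 b1 fb beps; have n0' : 0 < n%:R :> R by rewrite ltr0n.
have s0 : 0 < Num.sqrt n%:R :> R by rewrite sqrtr_gt0.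
apply: (@le_trans _ _ (emp n b w + 2 * (Num.sqrt n%:R * eps))); last first.
  by rewrite lerD2r ler_norm.
rewrite !empirical_processE normrM gtr0_norm ?invr_gt0// ler_pdivrMl//.
have ss : Num.sqrt n%:R * Num.sqrt n%:R = n%:R :> R.
  by rewrite -expr2 sqr_sqrtr ?(ltW n0').
rewrite mulrDr mulVKf ?gt_eqF// mulrCA [X in 2 * X]mulrA ss [2 * _]mulrCA.
apply: (@le_trans _ _ (\sum_(1 <= i < n.+1) (centered P Y n b i w + 2 * eps))).
  apply: le_trans (ler_norm_sum _ _ _) _; apply: ler_sum_nat => t tn.
  have Efb : `|E (f \o Y n t)| <= E (b \o Y n t).
    by apply: ler_norm_E; [exact: f1|exact: b1|move=> z /=; exact: fb].
  apply: le_trans (ler_normB _ _) _; rewrite /centered.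
  by have := fb (Y n t w); have := beps t tn; lra.
by rewrite big_split /= lerD2l big_const_nat subSS subn0 iter_addr addr0 [leRHS]mulr_natl.
Qed.

End maximal.

Lemma small_tail (R : realType) (e : nat -> R) (M dlt : R) :
  (forall j, 0 <= e j) -> (forall J, \sum_(0 <= j < J) e j <= M) -> 0 < dlt ->
  exists k, forall l, \sum_(k <= j < k + l) e j <= dlt.
Proof.
move=> e0 eM d0; pose A : set R := range (fun J => \sum_(0 <= j < J) e j).
have As : has_sup A.
  split; first by exists (\sum_(0 <= j < 0) e j), 0%N.
  by exists M => _ [J _ <-].
have [_ [k _ <-] ks] := sup_adherent d0 As.
exists k => l; have : \sum_(0 <= j < k + l) e j <= sup A.
  by apply: (ub_le_sup As.2); exists (k + l)%N.
by rewrite (@big_cat_nat _ _ _ k)//= ?leq_addr//; lra.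
Qed.

Lemma exists_half_power (R : realType) (y : R) : 0 < y -> exists l, (2^-1) ^+ l <= y.
Proof.
move=> y0; exists (Num.truncn y^-1).+1.
rewrite exprVn -[leRHS]invrK lef_pV2 ?posrE ?invr_gt0 ?exprn_gt0//.
have y'0 : 0 <= y^-1 by rewrite invr_ge0 ltW.
have /andP[_ /ltW h] := truncn_itv y'0.
by apply: (le_trans h); rewrite -natrX ler_nat ltnW// ltn_expl.
Qed.

(* For 2 ^ m <= n ^ (r / 2) < 2 ^ m.+1 the bias sqrt n * 2 ^- m is at most
   2 n ^ ((1 - r) / 2). *)
Lemma chain_level (R : realType) (r eta : R) k : 1 < r -> 0 < eta ->
  exists n0, forall n, (n0 <= n)%N -> (0 < n)%N /\ exists l,
    1 <= n%:R * (((2^-1) ^+ (k + l)) `^ r^-1) ^+ 2 /\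
    Num.sqrt n%:R * (2^-1) ^+ (k + l) <= eta.
Proof.
move=> r1 eta0; have r0 : 0 < r by exact: lt_trans r1.
(* Above [z1] one has 2 / eta <= n^((r - 1) / 2), which makes the bias small; above [z2] one has 2^k
   <= n^(r / 2), which puts the level [m] at or beyond [k]. *)
pose z1 : R := (2 / eta) `^ (2 / (r - 1)); pose z2 : R := (2 ^+ k) `^ (2 / r).
exists (maxn 1 (maxn (Num.truncn z1).+1 (Num.truncn z2).+1)) => n.
rewrite !geq_max => /and3P[n0 nz1 nz2]; split => //.
have above z : 0 <= z -> (Num.truncn z < n)%N -> z <= n%:R :> R.
  move=> z0 zn; have /andP[_ /ltW h] := truncn_itv z0.
  by apply: (le_trans h); rewrite ler_nat.
have {}nz1 := above z1 (powR_ge0 _ _) nz1.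
have {}nz2 := above z2 (powR_ge0 _ _) nz2.
have n0' : 0 < n%:R :> R by rewrite ltr0n.
pose y : R := n%:R `^ (r / 2).
have y1 : 1 <= y.
  rewrite /y -[X in X <= _](@powRr0 _ n%:R); apply: ler_powR; first by rewrite ler1n.
  by rewrite divr_ge0// ltW.
have y0 : 0 < y by exact: lt_le_trans y1.
have /andP[ty yt] := truncn_itv (ltW y0); set t := Num.truncn y in ty yt.
have t0 : (0 < t)%N by rewrite truncn_gt_nat.
pose m := trunc_log 2 t.
have m1 : (2 : R) ^+ m <= y by rewrite (le_trans _ ty)// -natrX ler_nat trunc_logP.
have m2 : y < (2 : R) ^+ m.+1.
  by rewrite (lt_le_trans yt)// -natrX ler_nat trunc_log_ltn.
have km : (k <= m)%N.
  rewrite leqNgt; apply/negP => mk.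
  have mk2 : (2 : R) ^+ m.+1 <= 2 ^+ k by apply: ler_weXn2l; rewrite ?ler1n.
  suff : 2 ^+ k <= y by rewrite leNgt (lt_le_trans m2 mk2).
  have -> : 2 ^+ k = z2 `^ (r / 2) :> R.
    by rewrite /z2 -powRrM (_ : 2 / r * (r / 2) = 1) ?powRr1 ?exprn_ge0//; field; rewrite gt_eqF.
  by apply: ge0_ler_powR; rewrite ?nnegrE ?divr_ge0 ?powR_ge0// ltW.
exists (m - k)%N; rewrite subnKC//; split.
  have h : (n%:R `^ (2^-1))^-1 <= ((2^-1) ^+ m) `^ r^-1 :> R.
    have -> : (n%:R `^ 2^-1)^-1 = (y^-1) `^ r^-1 :> R.
      rewrite /y -!powRN -powRrM; congr (_ `^ _); field; rewrite ?gt_eqF//.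
    apply: ge0_ler_powR.
    - by rewrite invr_ge0 ltW.
    - by rewrite nnegrE invr_ge0 ltW.
    - by rewrite nnegrE exprn_ge0 ?invr_ge0.
    by rewrite exprVn lef_pV2 ?posrE ?exprn_gt0.
  rewrite powR12_sqrt// in h.
  have s0 : 0 < Num.sqrt n%:R :> R by rewrite sqrtr_gt0.
  have : (Num.sqrt n%:R)^-1 ^+ 2 <= (((2^-1) ^+ m) `^ r^-1) ^+ 2 :> R.
    by rewrite lerXn2r ?nnegrE ?powR_ge0// invr_ge0 ltW.
  rewrite exprVn sqr_sqrtr ?(ltW n0')// => h2.
  by rewrite -ler_pdivrMl// mulr1.
have hm : (2^-1) ^+ m <= 2 / y :> R.
  rewrite ler_pdivlMr// exprVn ler_pdivrMl ?exprn_gt0// mulrC -exprS.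
  exact: ltW.
apply: (le_trans (ler_wpM2l (sqrtr_ge0 _) hm)).
have yE : y = Num.sqrt n%:R * n%:R `^ ((r - 1) / 2).
  rewrite -powR12_sqrt// -powRD; last by apply/implyP => _; rewrite gt_eqF.
  by rewrite /y; congr (_ `^ _); field.
have s0 : 0 < Num.sqrt n%:R :> R by rewrite sqrtr_gt0.
have z1E : 2 / eta = z1 `^ ((r - 1) / 2).
  rewrite /z1 -powRrM (_ : 2 / (r - 1) * ((r - 1) / 2) = 1); first by rewrite powRr1// divr_ge0// ltW.
  by field; rewrite gt_eqF// subr_gt0.
have : z1 `^ ((r - 1) / 2) <= n%:R `^ ((r - 1) / 2).
  by apply: ge0_ler_powR; rewrite ?nnegrE ?powR_ge0 ?divr_ge0 ?subr_ge0// ltW.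
rewrite -z1E ler_pdivrMr// => h.
rewrite mulrA ler_pdivrMr// yE [leRHS]mulrCA ler_wpM2l ?(ltW s0)//.
by rewrite mulrC.
Qed.

Section chaining.
Context d (Omega : measurableType d) (R : realType) (P : probability Omega R).
Context d' (X : measurableType d') (Y : nat -> nat -> Omega -> X).
Hypothesis mY : forall n t, (1 <= t <= n)%N -> measurable_fun setT (Y n t).

Local Notation L1 f := (P.-integrable setT (EFin \o f)).
Local Notation E f := (Rintegral P setT f).
Local Notation emp n f w := (empirical_process P Y n 1%R f w).

Variables (r : R) (Q : nat).
Hypothesis r1 : 1 < r.

(** [T] stands for F, with [ev] its inclusion. Enumerating the classes by ['I_(N j)] supplies the
    finite index types of the maximal inequality, and [pa], [pb] fix one choice of bracket per
    member and level. *)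
Variables (T : Type) (ev : T -> X -> R) (N : nat -> nat).
Variables (a : forall j, 'I_(N j) -> T) (b : forall j, 'I_(N j) -> X -> R).
Variables (pa pb : forall j, T -> 'I_(N j)).
Let eps j : R := (2^-1) ^+ j.
Hypothesis mev : forall p, measurable_fun setT (ev p).
Hypothesis iev : forall p n t, (1 <= t <= n)%N -> L1 (ev p \o Y n t).
Hypothesis mb : forall j i, measurable_fun setT (@b j i).
Hypothesis Mb : forall j i n, moments_le P Y r Q n (@b j i) (eps j ^+ 2).
Hypothesis Eb : forall j i n t, (1 <= t <= n)%N ->
  L1 (@b j i \o Y n t) /\ E (@b j i \o Y n t) <= eps j.
Hypothesis bracket : forall j p x, `|ev p x - ev (a (pa j p)) x| <= b (pb j p) x.

Let e j := (N j)%:R `^ (Q%:R^-1) * eps j `^ r^-1.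

Lemma eps_gt0 j : 0 < eps j. Proof. by rewrite exprn_gt0. Qed.

Lemma moments_le_dom n (f g : X -> R) c : measurable_fun setT f ->
  (forall x, `|f x| <= g x) -> moments_le P Y r Q n g c -> moments_le P Y r Q n f c.
Proof.
move=> mf fg gc t q tn qQ; have [g1 gE] := gc t q tn qQ.
have qr0 : 0 <= q%:R * r by rewrite mulr_ge0// (le_trans _ (ltW r1)).
have le w : `|f (Y n t w)| `^ (q%:R * r) <= `|g (Y n t w)| `^ (q%:R * r).
  apply: ge0_ler_powR; rewrite ?nnegrE//.
  by rewrite (le_trans (fg _))// ler_norm.
have f1 : L1 (fun w => `|f (Y n t w)| `^ (q%:R * r)).
  apply: L1_le g1 _ => [|w]; last by rewrite (ger0_norm (powR_ge0 _ _)).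
  apply: (measurableT_comp (measurable_powR _)).
  by apply: measurableT_comp => //; exact: (measurable_comp_Y mY tn mf).
by split; [exact: f1|apply: le_trans gE; exact: ler_E].
Qed.

Lemma link_moments j p n :
  moments_le P Y r Q n (fun x => ev p x - ev (a (pa j p)) x) (eps j ^+ 2).
Proof.
apply: (@moments_le_dom n _ (b (pb j p))); last exact: Mb.
  exact: measurable_funB.
by move=> x; exact: bracket.
Qed.

Lemma measurable_link j p :
  measurable_fun setT (fun x => ev p x - ev (a (pa j p)) x).
Proof. exact: measurable_funB. Qed.

Lemma empirical_link n j p w :
  emp n (fun x => ev p x - ev (a (pa j p)) x) w = emp n (ev p) w - emp n (ev (a (pa j p))) w.
Proof. by apply: empiricalB => t tn; exact: iev. Qed.

Variable C : R.
Hypothesis C0 : 0 <= C.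
Hypothesis HC : forall n (I : finType) (g : I -> X -> R) eps,
    (0 < n)%N -> 0 < eps -> 1 <= n%:R * (eps `^ r^-1) ^+ 2 ->
    (forall i, measurable_fun setT (g i)) ->
    (forall i, moments_le P Y r Q n (g i) (eps ^+ 2)) ->
    exists U, [/\ L1 U, forall w, 0 <= U w,
      E U <= C * (#|I|%:R `^ (Q%:R^-1) * eps `^ r^-1) &
      forall i w, `|emp n (g i) w| <= U w].

(** The finest link starts at an arbitrary [p], so infinitely many differences occur. They are
    dominated by the finitely many bounding functions, and only this link pays the bias. *)
Lemma last_link n k : (0 < n)%N -> 1 <= n%:R * (eps k `^ r^-1) ^+ 2 ->
  exists U, [/\ L1 U, forall w, 0 <= U w,
    E U <= C * e k + 2 * (Num.sqrt n%:R * eps k) &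
    forall p w, `|emp n (ev p) w - emp n (ev (a (pa k p))) w| <= U w].
Proof.
move=> n0 nk; have [U [U1 U0 UE Ub]] := HC n0 (eps_gt0 k) nk (mb (j := k)) (fun i => @Mb k i n).
exists (fun w => U w + 2 * (Num.sqrt n%:R * eps k)); split.
- by apply: L1D => //; exact: L1_cst.
- by move=> w; rewrite addr_ge0// !mulr_ge0 ?sqrtr_ge0// ltW ?eps_gt0.
- by rewrite ED ?E_cst// ?lerD2r; [move: UE; rewrite card_ord|exact: L1_cst].
move=> p w; rewrite -empirical_link.
apply: (@le_trans _ _ (`|emp n (b (pb k p)) w| + 2 * (Num.sqrt n%:R * eps k))).
  apply: empirical_envelope => [//| | | |].
  - by move=> t tn; exact: (L1B (@iev _ _ _ tn) (@iev _ _ _ tn)).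
  - by move=> t tn; case: (@Eb k (pb k p) n t tn).
  - by move=> x; exact: bracket.
  - by move=> t tn; case: (@Eb k (pb k p) n t tn).
by rewrite lerD2r.
Qed.

(** Links from level j + 1 to level j are counted by [N j.+1] but have size [eps j]; the factor 2
    aligns both with [e j.+1]. *)
Lemma eps_step j : eps j `^ r^-1 <= 2 * eps j.+1 `^ r^-1.
Proof.
have -> : eps j = 2 * eps j.+1 by rewrite /eps exprS mulVKf.
rewrite powRM ?(ltW (eps_gt0 _))// ler_wpM2r ?powR_ge0//.
by apply: ler1_powR; [lra|rewrite invf_le1 ?(lt_trans _ r1)// ltW].
Qed.

Lemma e_ge0 j : 0 <= e j. Proof. by rewrite mulr_ge0// powR_ge0. Qed.

(** The end point at level [k] approximates the end point at level [k.+1] and not [p] itself; so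
    only [N k.+1] links occur there. The price is that [kap] depends on the starting level and hence
    on [n]. Coarser levels inherit the condition on [n] from the finest one. *)
Lemma chain n l k : (0 < n)%N -> 1 <= n%:R * (eps (k + l) `^ r^-1) ^+ 2 ->
  exists (kap : T -> 'I_(N k)) U, [/\ L1 U, forall w, 0 <= U w,
    E U <= 2 * C * \sum_(k.+1 <= j < (k + l).+1) e j + C * e (k + l) +
      2 * (Num.sqrt n%:R * eps (k + l)) &
    forall p w, `|emp n (ev p) w - emp n (ev (a (kap p))) w| <= U w].
Proof.
move=> n0; elim: l k => [|l IH] k.
  rewrite addn0 => nk; have [U [U1 U0 UE Ub]] := last_link n0 nk.
  exists (pa k), U; split => //; apply: (le_trans UE); rewrite lerD2r.
  by rewrite big_geq// mulr0 add0r.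
rewrite addnS -addSn => nk; have [kap [U [U1 U0 UE Ub]]] := IH k.+1 nk.
have nk' : 1 <= n%:R * (eps k `^ r^-1) ^+ 2.
  apply: (le_trans nk); rewrite ler_wpM2l// lerXn2r ?nnegrE ?powR_ge0//.
  apply: ge0_ler_powR; rewrite ?nnegrE ?invr_ge0 ?(ltW (eps_gt0 _))//.
    by rewrite (le_trans _ (ltW r1)).
  by apply: ler_wiXn2l; [lra|lra|rewrite addSn leqW// leq_addr].
have [V [V1 V0 VE Vb]] := HC n0 (eps_gt0 k) nk'
  (fun i : 'I_(N k.+1) => measurable_link k (a i)) (fun i => @link_moments k (a i) n).
exists (fun p => pa k (a (kap p))), (fun w => U w + V w); split.
- exact: L1D.
- by move=> w; rewrite addr_ge0.
- rewrite ED//; apply: (le_trans (lerD UE VE)).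
  have -> : \sum_(k.+1 <= j < (k.+1 + l).+1) e j =
      e k.+1 + \sum_(k.+2 <= j < (k.+1 + l).+1) e j.
    by rewrite big_ltn// ltnS leq_addr.
  have : C * (#|'I_(N k.+1)|%:R `^ Q%:R^-1 * eps k `^ r^-1) <= 2 * C * e k.+1.
    have h := ler_wpM2l (mulr_ge0 C0 (powR_ge0 (N k.+1)%:R Q%:R^-1)) (eps_step k).
    rewrite card_ord mulrA; apply: (le_trans h).
    by rewrite /e le_eqVlt; apply/orP; left; apply/eqP; ring.
  rewrite mulrDr; move: (C * (_ * _)) (2 * C * \sum_(_ <= _ < _) _) => u v; lra.
move=> p w; rewrite (_ : _ - _ = (emp n (ev p) w - emp n (ev (a (kap p))) w) +
  (emp n (ev (a (kap p))) w - emp n (ev (a (pa k (a (kap p))))) w)); last by ring.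
apply: le_trans (ler_normD _ _) _; rewrite lerD//.
by rewrite -empirical_link.
Qed.

Lemma moments_le_cst0 n c : 0 <= c -> moments_le P Y r Q n (fun=> 0 : R) c.
Proof.
move=> c0 t q tn /andP[q2 _]; rewrite normr0.
have -> : 0 `^ (q%:R * r) = 0 :> R.
  by rewrite powR0// mulf_neq0 ?gt_eqF ?(lt_trans _ r1)// ltr0n (leq_trans _ q2).
by split; [exact: L1_cst|rewrite E_cst].
Qed.

(* The end point kap p of the chain depends on n, contrary to pa l p.  Choosing one
   representative p' for each pair (kap p, kap (a (pa l p))), it suffices to
   control the (N k)^2 differences between p' and a (pa l p'). *)
Lemma asymptotic_equicontinuity M dlt :
  (forall J, \sum_(0 <= j < J) e j <= M) -> 0 < dlt ->
  exists l n0, forall n, (n0 <= n)%N -> exists U, [/\ L1 U, forall w, 0 <= U w,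
    E U <= dlt & forall p w, `|emp n (ev p) w - emp n (ev (a (pa l p))) w| <= U w].
Proof.
move=> eM d0; have C1 : 0 < C + 1 by rewrite ltr_wpDl.
(* The chain costs at most 3 dlt / 48 + 2 dlt / 32 = dlt / 8. It is used four times, which leaves
   dlt / 2 for the differences of representatives. *)
have C24 : 0 < 48 * (C + 1) by rewrite mulr_gt0.
have [k tail] := small_tail e_ge0 eM (divr_gt0 d0 C24).
(* [k] is fixed before [l], so the number of pairs stays put while [l] is refined until the
   differences cost at most dlt / 2. *)
pose x := dlt / 2 / (C * (N k * N k)%:R `^ Q%:R^-1 + 1).
have x0 : 0 < x by rewrite !divr_gt0// ltr_wpDl// mulr_ge0// powR_ge0.
have r0 : 0 < r by exact: lt_trans r1.
have [l lx] := exists_half_power (powR_gt0 r x0).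
have {}lx : eps l `^ r^-1 <= x.
  rewrite -[leRHS](@powRr1 _ x) ?(ltW x0)// -(mulfV (lt0r_neq0 r0)) powRrM.
  by apply: ge0_ler_powR; rewrite ?nnegrE ?invr_ge0 ?powR_ge0 ?(ltW r0) ?(ltW (eps_gt0 l)).
have d32 : 0 < dlt / 32 by rewrite divr_gt0.
have [n0 Hn0] := chain_level k r1 d32.
pose el := (eps l `^ r^-1) ^+ 2; have el0 : 0 < el by rewrite exprn_gt0// powR_gt0 ?eps_gt0.
exists l, (maxn n0 (Num.truncn el^-1).+1) => n; rewrite geq_max => /andP[/Hn0[n_gt0 [m [m1 m2]]] nel].
have n0' : 0 < n%:R :> R by rewrite ltr0n.
have nl : 1 <= n%:R * el.
  have eli : 0 <= el^-1 by rewrite invr_ge0 ltW.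
  have /andP[_ /ltW h] := truncn_itv eli.
  by rewrite -ler_pdivrMr// mul1r (le_trans h)// ler_nat.
have [kap [U [U1 U0 UE Ub]]] := chain n_gt0 m1.
have {}UE : E U <= dlt / 8.
  apply: (le_trans UE).
  have s1 : \sum_(k.+1 <= j < (k + m).+1) e j <= dlt / (48 * (C + 1)).
    apply: le_trans (tail m.+1); rewrite addnS [leRHS]big_ltn ?ltnS ?leq_addr//.
    by rewrite lerDr e_ge0.
  have s2 : e (k + m) <= dlt / (48 * (C + 1)).
    apply: le_trans (tail m.+1); rewrite addnS big_nat_recr ?leq_addr//= lerDr.
    by apply: sumr_ge0 => j _; exact: e_ge0.
  have s3 : C * (dlt / (48 * (C + 1))) <= dlt / 48.
    rewrite mulrA ler_pdivrMr//.
    have -> : dlt / 48 * (48 * (C + 1)) = dlt * (C + 1) by field.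
    by rewrite mulrC ler_wpM2l ?(ltW d0)// lerDl.
  have s1' := ler_wpM2l C0 s1; have s2' := ler_wpM2l C0 s2.
  by rewrite -mulrA; move: m2 s1' s2' s3; rewrite -/(eps _); lra.
(* Pairs that no [p] attains get the function 0, which satisfies every moment bound. *)
pose g (i : 'I_(N k) * 'I_(N k)) : X -> R :=
  if pselect (exists p, kap p = i.1 /\ kap (a (pa l p)) = i.2) is left h
  then (fun y => ev (projT1 (cid h)) y - ev (a (pa l (projT1 (cid h)))) y) else fun=> 0.
have mg i : measurable_fun setT (g i).
  by rewrite /g; case: pselect => [h|_]; [exact: measurable_link|exact: measurable_cst].
have Mg i : moments_le P Y r Q n (g i) (eps l ^+ 2).
  rewrite /g; case: pselect => [h|_]; first exact: link_moments.
  by apply: moments_le_cst0; rewrite exprn_ge0// ltW ?eps_gt0.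
have [V [V1 V0 VE Vb]] := HC n_gt0 (eps_gt0 l) nl mg Mg.
exists (fun w => 4 * U w + V w); split.
- by apply: L1D => //; exact: L1Z.
- by move=> w; rewrite addr_ge0// mulr_ge0.
- rewrite ED ?EZ//; last exact: L1Z.
  have : E V <= dlt / 2.
    apply: (le_trans VE); rewrite card_prod !card_ord mulrA.
    apply: (le_trans (ler_wpM2l (mulr_ge0 C0 (powR_ge0 _ _)) lx)).
    rewrite /x; set c := C * _; have c0 : 0 <= c by rewrite mulr_ge0// powR_ge0.
    rewrite mulrA ler_pdivrMr ?ltr_wpDl// mulrC ler_wpM2l ?lerDl//.
    by rewrite divr_ge0// ltW.
  by lra.
move=> p w; have := Vb (kap p, kap (a (pa l p))) w.
rewrite /g /=; case: pselect => [h|]; last by case; exists p.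
case: (cid h) => /= p' [p1 p2]; rewrite empirical_link => vb.
(* The path runs from [p] to [p'] through their common end point, on to [a (pa l p')] by the
   controlled difference, and to [a (pa l p)] through the second common end point: four chains and
   one [V]. *)
have := Ub p w; have := Ub p' w; have := Ub (a (pa l p)) w; have := Ub (a (pa l p')) w.
rewrite p1 p2.
move: (emp n (ev p) w) (emp n (ev p') w) (emp n (ev (a (pa l p))) w)
  (emp n (ev (a (pa l p'))) w) (emp n (ev (a (kap p))) w)
  (emp n (ev (a (kap (a (pa l p))))) w) vb => u1 u2 u3 u4 u5 u6.
by rewrite !ler_norml => /andP[? ?] /andP[? ?] /andP[? ?] /andP[? ?] /andP[? ?]; apply/andP; split; lra.
Qed.

End chaining.

(** * Measurability, null sets and outer expectation *)

Section measure_helpers.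
Context d (Omega : measurableType d) (R : realType) (P : probability Omega R).

Local Notation L1 f := (P.-integrable setT (EFin \o f)).
Local Notation E f := (Rintegral P setT f).

Lemma exists_inv_nat (e : R) : 0 < e -> exists m : nat, m.+1%:R^-1 < e.
Proof.
move=> e0; have ei : 0 <= e^-1 by rewrite invr_ge0 ltW.
exists (Num.truncn e^-1); have /andP[_ h] := truncn_itv ei.
by rewrite -[ltRHS]invrK ltf_pV2 ?posrE ?invr_gt0.
Qed.

(** An open set is the union of the boxes with rational centre and radius 1 / (m + 1) that it
    contains. There are countably many, and each pulls back to finitely many conditions on
    coordinates. *)
Lemma measurable_row_open K (f : 'I_K -> Omega -> R) (A : set 'rV[R]_K) :
  (forall k, measurable_fun setT (f k)) -> open A ->
  measurable [set w | A (\row_k f k w)].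
Proof.
move=> mf oA.
pose box (x : 'rV[rat]_K * nat) : set Omega :=
  if `[< forall y : 'rV[R]_K, (forall k, `|ratr (x.1 0 k) - y 0 k| < x.2.+1%:R^-1) -> A y >]
  then \bigcap_k [set w | `|ratr (x.1 0 k) - f k w| < x.2.+1%:R^-1] else set0.
have -> : [set w | A (\row_k f k w)] = \bigcup_x box x.
  apply/seteqP; split => [w Aw|w [x _]]; last first.
    rewrite /box; case: asboolP => // xA h.
    by apply: xA => k; rewrite mxE; exact: h.
  have : nbhs (\row_k f k w) A by apply: open_nbhs_nbhs.
  move=> /nbhs_ballP[e /= e0 eA].
  have [|m me] := @exists_inv_nat (e / 2); first by rewrite divr_gt0.
  have m0 : 0 < m.+1%:R^-1 :> R by rewrite invr_gt0 ltr0n.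
  have [u uE] : exists u : R, u = m.+1%:R^-1 by exists m.+1%:R^-1.
  rewrite -uE in me m0.
  have /choice[q qP] : forall k, exists q : rat, `|ratr q - f k w| < u.
    move=> k; have : f k w - u < f k w + u by lra.
    move=> /rat_in_itvoo[q]; rewrite in_itv /= => /andP[q1 q2].
    by exists q; rewrite ltr_norml; apply/andP; split; lra.
  exists (\row_k q k, m) => //; rewrite /box; case: asboolP => [_|].
    by move=> k _ /=; rewrite mxE -uE; exact: qP.
  case=> y yq; apply: eA; split => // i k; rewrite ord1 mxE.
  have h1 := qP k; have := yq k; rewrite /= mxE -uE => h2.
  suff : `|f k w - y 0 k| < e by [].
  rewrite (_ : _ - _ = (ratr (q k) - y 0 k) - (ratr (q k) - f k w)); last by ring.
  by apply: le_lt_trans (ler_normB _ _) _; move: me h1 h2; lra.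
apply: countable_bigcupT_measurable => [|x]; first exact: countableP.
rewrite /box; case: asboolP => // _.
apply: fin_bigcap_measurable => // k _.
have := @measurable_fun_ltr _ _ R setT (fun w => `|ratr (x.1 0 k) - f k w|) (cst x.2.+1%:R^-1).
move=> /(_ _ (measurable_cst _)) h.
have {}h := h (measurableT_comp (@normr_measurable R setT) (measurable_funB (measurable_cst _) (mf k))).
have := h measurableT [set true] I; rewrite setTI.
by congr measurable; apply/seteqP; split => w /=.
Qed.

Lemma measurable_row K (f : 'I_K -> Omega -> R) (A : set 'rV[R]_K) :
  (forall k, measurable_fun setT (f k)) -> <<s open >> A ->
  measurable [set w | A (\row_k f k w)].
Proof.
move=> mf; pose S := [set A : set 'rV[R]_K | measurable [set w | A (\row_k f k w)]].
apply: (@smallest_sub _ _ _ S) => [|B oB]; last exact: measurable_row_open.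
split => [|B mB|F mF].
- exact: measurable0.
- have := measurableC mB; congr measurable.
  by apply/seteqP; split => w /= => [h|[]//]; split.
- rewrite /S /= (_ : [set w | _] = \bigcup_n [set w | F n (\row_k f k w)]).
    exact: bigcupT_measurable.
  by apply/seteqP; split => w [n _ h]; exists n.
Qed.

Lemma measurable_fun_open (f : Omega -> R) :
  (forall U : set R, open U -> measurable (f @^-1` U)) -> measurable_fun setT f.
Proof.
move=> fU; apply: (measurability _ (RGenOpens.measurableE R)).
move=> _ [_ [a [b ->] <-]]; rewrite setTI; apply: fU; exact: interval_open.
Qed.

Lemma E_bounded_cvg (f_ : nat -> Omega -> R) (f : Omega -> R) (M : R) :
  (forall n, measurable_fun setT (f_ n)) -> measurable_fun setT f ->
  (forall n w, `|f_ n w| <= M) -> (forall w, f_ ^~ w @ \oo --> f w) ->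
  E (f_ n) @[n --> \oo] --> E f.
Proof.
move=> mf_ mf f_M f_f.
have fM w : `|f w| <= M.
  apply: (cvgr_to_le (cvg_norm (f_f w))); apply: nearW => n; exact: f_M.
have L1f : L1 f by exact: L1_bounded fM.
have L1f_ n : L1 (f_ n) by exact: L1_bounded (f_M n).
have /fine_cvgP[_] : (\int[P]_w (f_ n w)%:E)%E @[n --> \oo] --> (E f)%:E; last exact.
  rewrite EFin_E//; apply: (@dominated_cvg _ _ _ P setT measurableT _ _ (fun=> M%:E)) => //.
  - by move=> n; exact/measurable_EFinP.
  - by move=> w _; apply/fine_cvgP; split; [exact: nearW|exact: f_f].
  - exact: finite_measure_integrable_cst.
  - by move=> n w _; rewrite lee_fin.
Qed.

Lemma eq_prob_null (A B C : set Omega) : measurable A -> measurable B ->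
  measurable C -> P (~` C) = 0%E -> A `&` C = B `&` C -> P A = P B.
Proof.
move=> mA mB mC C0 AB.
have h D : measurable D -> P D = P (D `&` C).
  move=> mD; rewrite (measureDI P mD mC).
  rewrite [X in (X + _)%E](_ : _ = 0%E) ?add0e//.
  by apply: (subset_measure0 (measurableD mD mC) (measurableC mC) _ C0) => w [].
by rewrite (h _ mA) (h _ mB) AB.
Qed.

(** By monotone convergence the sum of the series has integral at most [c0]. The measurable set [W]
    is returned explicitly since limits are later defined separately on it and off it. *)
Lemma ae_summable (D : nat -> Omega -> R) (c : nat -> R) (c0 : R) :
  (forall k, measurable_fun setT (D k)) -> (forall k w, 0 <= D k w) ->
  (forall k, L1 (D k)) -> (forall k, E (D k) <= c k) ->
  (forall J, \sum_(0 <= k < J) c k <= c0) ->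
  exists W : set Omega, [/\ measurable W, P (~` W) = 0%E &
    forall w, W w -> exists M, forall J, \sum_(0 <= k < J) D k w <= M].
Proof.
move=> mD D0 D1 Dc cc0.
pose f w : \bar R := (\sum_(k <oo) (D k w)%:E)%E.
have f0 w : (0 <= f w)%E by apply: nneseries_ge0 => k _ _; rewrite lee_fin.
have mf : measurable_fun setT f.
  apply: ge0_emeasurable_sum; first by move=> k w _ _; rewrite lee_fin.
  move=> k _; exact/measurable_EFinP.
have fint : P.-integrable setT f.
  apply/integrableP; split => //.
  under eq_integral do rewrite gee0_abs//.
  rewrite integral_nneseries//; last 2 first.
  - by move=> k; exact/measurable_EFinP.
  - by move=> k w _; rewrite lee_fin.
  apply: (@le_lt_trans _ _ c0%:E); last exact: ltry.
  apply: lime_le; first by apply: is_cvg_nneseries => k _ _; apply: integral_ge0 => w _; rewrite lee_fin.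
  apply: nearW => J; apply: (@le_trans _ _ (\sum_(0 <= k < J) (c k)%:E)%E).
    by apply: lee_sum => k _; rewrite -EFin_E// lee_fin.
  by rewrite sumEFin lee_fin.
exists [set w | f w \is a fin_num]; split.
- by have := emeasurable_fin_num measurableT mf; rewrite setTI.
- have /(integrable_ae measurableT)[N [mN N0 fN]] := fint.
  have mF : measurable (~` [set w | f w \is a fin_num]).
    by apply: measurableC; have := emeasurable_fin_num measurableT mf; rewrite setTI.
  apply: (subset_measure0 mF mN _ N0) => w /= nf; apply: fN => /= h.
  by apply: nf; exact: h.
move=> w /= wf; exists (fine (f w)) => J.
rewrite -lee_fin -sumEFin fineK//; apply: nneseries_lim_ge => k _ _.
by rewrite lee_fin.
Qed.

Lemma E_ae_eq (f g : Omega -> R) (W : set Omega) : measurable_fun setT f ->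
  measurable_fun setT g -> measurable W -> P (~` W) = 0%E ->
  (forall w, W w -> f w = g w) -> E f = E g.
Proof.
move=> mf mg mW W0 fg; congr fine; apply: ae_eq_integral => //.
- exact/measurable_EFinP.
- exact/measurable_EFinP.
exists (~` W); split => //; first exact: measurableC.
by move=> w /= h Ww; apply: h => _; rewrite fg.
Qed.

Lemma outer_expectation_le (f g : Omega -> R) : L1 g -> (forall w, f w <= g w) ->
  (outer_expectation P f <= (E g)%:E)%E.
Proof.
move=> g1 fg; rewrite EFin_E//; apply: ereal_inf_lbound.
exists (EFin \o g) => //; split.
- exact: measurable_int g1.
- by move=> w; rewrite lee_fin.
- left; apply: integral_funepos_lt_pinfty => //; exact: g1.
Qed.

(** A majorant [V] need not be integrable; its integral is therefore compared through positive and
    negative parts. *)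
Lemma outer_expectation_ge (f g : Omega -> R) : L1 g -> (forall w, g w <= f w) ->
  ((E g)%:E <= outer_expectation P f)%E.
Proof.
move=> g1 gf; apply: le_ereal_inf_tmp => _ [V [mV fV _] <-].
have gV w : ((EFin \o g) w <= V w)%E by rewrite (le_trans _ (fV w))// lee_fin.
have mg : measurable_fun setT (EFin \o g) by exact: measurable_int g1.
rewrite EFin_E// [X in (X <= _)%E]integralE [X in (_ <= X)%E]integralE.
apply: leeB; apply: ge0_le_integral => //.
- exact: measurable_funepos.
- exact: measurable_funepos.
- by move=> w _; apply: (@funepos_le _ _ setT) => [x _|]; [exact: gV|rewrite inE].
- exact: measurable_funeneg.
- exact: measurable_funeneg.
- by move=> w _; apply: (@funeneg_le _ _ setT) => [x _|]; [exact: gV|rewrite inE].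
Qed.

End measure_helpers.

Lemma real_cauchy_limit (R : realType) (x : nat -> R) :
  (forall e, 0 < e -> exists N, forall k l, (N <= k)%N -> (N <= l)%N -> `|x k - x l| <= e) ->
  exists l, forall e, 0 < e -> exists N, forall k, (N <= k)%N -> `|x k - l| <= e.
Proof.
move=> xc; have /cauchy_cvgP : cauchy (x @ \oo).
  apply/cauchyP => e e0; have [|N xN] := xc (e / 2); first by rewrite divr_gt0.
  exists (x N); exists N => // k /= Nk; rewrite /ball /=.
  apply: le_lt_trans (xN _ _ (leqnn N) Nk) _.
  by rewrite ltr_pdivrMr// ltr_pMr// ltr1n.
move=> /cvg_ex[l /cvgrPdist_le xl]; exists l => e /xl[N _ h].
by exists N => k /h; rewrite distrC.
Qed.

(** * Weak convergence from finite approximations *)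

Section linf_lipschitz.
Context (I : Type) (R : realType).
Local Notation V := (linf I R).
Implicit Types (f : I -> R) (y z : V).

(* Junk value 0 if f is unbounded. *)
Definition to_linf f : V :=
  if pselect (exists M, forall i, `|f i| <= M) is left h
  then Linf (proj2 (bounded_predE f) h) else 0.

Lemma to_linfE f : (exists M, forall i, `|f i| <= M) -> to_linf f = f :> (I -> R).
Proof. by rewrite /to_linf; case: pselect. Qed.

Lemma linf_dist_le y z c : 0 <= c -> (forall i, `|y i - z i| <= c) -> `|y - z| <= c.
Proof. by move=> c0 h; apply: (@linf_norm_le _ _ (y - z)). Qed.

Lemma le_linf_dist y z i : `|y i - z i| <= `|y - z|.
Proof. exact: (linf_norm_ub (y - z)). Qed.

Lemma to_linf_dist_le f g c : 0 <= c ->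
  (exists M, forall i, `|f i| <= M) -> (exists M, forall i, `|g i| <= M) ->
  (forall i, `|f i - g i| <= c) -> `|to_linf f - to_linf g| <= c.
Proof.
by move=> c0 fb gb fg; apply: linf_dist_le => // i; rewrite !to_linfE.
Qed.

Lemma linf_nbhsP z (A : set V) :
  nbhs z A <-> exists2 e, 0 < e & forall y, `|z - y| < e -> A y.
Proof.
split; first by move=> /nbhs_ballP[e /= e0 eA]; exists e => // y yz; apply: eA; rewrite -ball_normE.
by move=> [e e0 eA]; apply/nbhs_ballP; exists e => //= y; rewrite -ball_normE; exact: eA.
Qed.

Definition lipschitz_by (L : R) (h : V -> R) := forall y z, `|h y - h z| <= L * `|y - z|.

Lemma lipschitz_by_continuous L h : 0 <= L -> lipschitz_by L h -> continuous h.
Proof.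
move=> L0 hL z; apply/(@cvgrPdist_le _ _ _ _ (nbhs_filter z)) => e e0.
apply/linf_nbhsP; exists (e / (L + 1)); first by rewrite divr_gt0// ltr_wpDl.
move=> y zy; apply: (le_trans (hL _ _)).
apply: (@le_trans _ _ ((L + 1) * (e / (L + 1)))).
  by rewrite ler_pM// ?lerDl// ltW.
by rewrite mulrC divfK// gt_eqF// ltr_wpDl.
Qed.

Lemma row_continuous K (Phi : 'rV[R]_K -> R) (C : R) : 0 <= C ->
  (forall (x y : 'rV[R]_K) e, 0 <= e -> (forall k, `|x 0 k - y 0 k| <= e) ->
    `|Phi x - Phi y| <= C * e) ->
  continuous Phi.
Proof.
move=> C0 PhiC x; apply/(@cvgrPdist_le _ _ _ _ (nbhs_filter x)) => e e0.
have ce : 0 < e / (C + 1) by rewrite divr_gt0// ltr_wpDl.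
apply/nbhs_ballP; exists (e / (C + 1)) => //= y [_ xy].
apply: (le_trans (PhiC x y (e / (C + 1)) (ltW ce) _)).
  by move=> k; exact: ltW (xy 0 k).
rewrite mulrA ler_pdivrMr ?ltr_wpDl// mulrC ler_wpM2l ?(ltW e0)//.
by rewrite lerDl.
Qed.

(** For bounded [H] this is the Pasch-Hausdorff envelope, the largest [m]-Lipschitz minorant. *)
Definition inf_convolution (H : V -> R) (m : nat) z : R :=
  inf (range (fun y => H y + m%:R * `|z - y|)).

Section inf_convolution.
Variables (H : V -> R) (M : R).
Hypothesis HM : forall z, `|H z| <= M.

Let Hge z : - M <= H z. Proof. by have := HM z; rewrite ler_norml => /andP[]. Qed.
Let Hle z : H z <= M. Proof. by have := HM z; rewrite ler_norml => /andP[]. Qed.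

Lemma inf_convolution_le m z y : inf_convolution H m z <= H y + m%:R * `|z - y|.
Proof.
apply: ge_inf; last by exists y.
exists (- M) => _ [x _ <-]; apply: (le_trans (Hge x)).
by rewrite lerDl mulr_ge0.
Qed.

Lemma le_inf_convolution m z c : (forall y, c <= H y + m%:R * `|z - y|) ->
  c <= inf_convolution H m z.
Proof.
move=> h; apply: lb_le_inf => [|_ [y _ <-]//].
by exists (H z + m%:R * `|z - z|), z.
Qed.

Lemma inf_convolution_ge m z : - M <= inf_convolution H m z.
Proof.
apply: le_inf_convolution => y; apply: (le_trans (Hge y)).
by rewrite lerDl mulr_ge0.
Qed.

Lemma inf_convolution_le_fun m z : inf_convolution H m z <= H z.
Proof.
by apply: (le_trans (inf_convolution_le m z z)); rewrite subrr normr0 mulr0 addr0.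
Qed.

Lemma inf_convolution_norm_le m z : `|inf_convolution H m z| <= M.
Proof.
rewrite ler_norml inf_convolution_ge/=.
exact: le_trans (inf_convolution_le_fun m z) (Hle z).
Qed.

Lemma lipschitz_inf_convolution m : lipschitz_by m%:R (inf_convolution H m).
Proof.
have h y z : inf_convolution H m y <= inf_convolution H m z + m%:R * `|y - z|.
  rewrite -lerBlDr; apply: le_inf_convolution => x.
  rewrite lerBlDr; apply: (le_trans (inf_convolution_le m y x)).
  rewrite -addrA lerD2l -mulrDr ler_wpM2l// [leRHS]addrC.
  by rewrite -[y - x](subrKA z); exact: ler_normD.
move=> y z; rewrite ler_norml; apply/andP; split.
  by rewrite lerNl opprB lerBlDl distrC; exact: h.
by rewrite lerBlDl; exact: h.
Qed.

(** Far from [z] the penalty [m%:R * dl] exceeds the oscillation 2 M of [H]; near [z] continuity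
    applies. *)
Lemma inf_convolution_cvg z : continuous H ->
  inf_convolution H m z @[m --> \oo] --> H z.
Proof.
move=> cH; apply/cvgrPdist_le => e e0.
have /(@cvgrPdist_le _ _ _ _ (nbhs_filter z))/(_ e e0)/linf_nbhsP[dl d0 Hd] := cH z.
exists (Num.truncn (2 * M / dl)).+1 => // m /= mM.
have M0 : 0 <= M by exact: le_trans (HM 0).
have M2 : 0 <= 2 * M / dl by rewrite divr_ge0 ?mulr_ge0// ltW.
have md : 2 * M <= m%:R * dl.
  rewrite -ler_pdivrMr//; have /andP[_ /ltW h] := truncn_itv M2.
  by apply: (le_trans h); rewrite ler_nat.
have le := inf_convolution_le_fun m z.
rewrite ger0_norm ?subr_ge0// lerBlDr -lerBlDl.
apply: le_inf_convolution => y; have [zy|zy] := ltP `|z - y| dl.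
  have := Hd y zy; rewrite ler_norml => /andP[_ h].
  have : 0 <= m%:R * `|z - y| by rewrite mulr_ge0.
  by lra.
have : m%:R * dl <= m%:R * `|z - y| by rewrite ler_wpM2l.
by have := Hge y; have := Hle z; lra.
Qed.

End inf_convolution.

Section borel.
Context d (Omega : measurableType d).

Lemma borel_measurable_comp (Z : Omega -> V) (h : V -> R) :
  borel_measurable Z -> continuous h -> measurable_fun setT (h \o Z).
Proof.
move=> mZ /continuousP ch; apply: measurable_fun_open => U oU.
by rewrite comp_preimage; apply: mZ; exact: ch.
Qed.

(** Z lies in U exactly when, for some m, the Z_k eventually lie in the set [W m] of points having a
    ball of radius greater than 1 / (m + 1) inside U. The strict inequality makes [W m] open, and
    only countable operations occur, so separability is not an issue. *)
Lemma borel_measurable_limit (Z_ : nat -> Omega -> V) (Z : Omega -> V) :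
  (forall k, borel_measurable (Z_ k)) ->
  (forall w e, 0 < e -> exists N, forall k, (N <= k)%N -> `|Z_ k w - Z w| <= e) ->
  borel_measurable Z.
Proof.
move=> mZ_ ZZ U oU.
pose W m : set V := [set z | exists2 e, m.+1%:R^-1 < e & forall y, `|z - y| < e -> U y].
have oW m : open (W m).
  rewrite openE => z [e me eU]; apply/linf_nbhsP.
  exists ((e - m.+1%:R^-1) / 2); first by rewrite divr_gt0 ?subr_gt0.
  move=> y zy; exists ((e + m.+1%:R^-1) / 2).
    by move: (m.+1%:R^-1) me => u; lra.
  move=> x yx; apply: eU; rewrite -[z - x](subrKA y).
  apply: le_lt_trans (ler_normD _ _) _.
  by move: (m.+1%:R^-1) me zy yx => u; lra.
have -> : Z @^-1` U = \bigcup_m \bigcup_N \bigcap_(k in [set k | (N <= k)%N]) (Z_ k @^-1` W m).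
  apply/seteqP; split => w /=.
    move=> Uz; have : nbhs (Z w) U by apply: open_nbhs_nbhs.
    move=> /linf_nbhsP[e e0 eU].
    have e20 : 0 < e / 2 by rewrite divr_gt0.
    have [m me] := exists_inv_nat e20.
    have [N hN] := ZZ w _ e20; have e40 : 0 < e / 4 by rewrite divr_gt0.
    have [N' hN'] := ZZ w _ e40.
    exists m => //; exists N' => // k /= Nk; exists (e / 2) => // y ky; apply: eU.
    rewrite -[_ - y](subrKA (Z_ k w)); apply: le_lt_trans (ler_normD _ _) _.
    by have := hN' _ Nk; rewrite distrC; lra.
  move=> [m _ [N _ h]]; have m0 : 0 < m.+1%:R^-1 :> R by rewrite invr_gt0.
  have [N' hN'] := ZZ w _ m0.
  have [] := h (maxn N N') _; first by rewrite /= leq_maxl.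
  by move=> e me; apply; apply: le_lt_trans me; apply: hN'; rewrite leq_maxr.
apply: bigcupT_measurable => m; apply: bigcupT_measurable => N.
apply: bigcap_measurable => [|k _]; first by exists N => /=.
exact: mZ_.
Qed.

End borel.
End linf_lipschitz.

Lemma bounded_funE (T : Type) (R : realType) (f : T -> R) :
  bounded_fun f <-> exists M, forall t, `|f t| <= M.
Proof.
rewrite -bounded_predE unfold_in /bounded_pred; split => [/asboolP//|/asboolP].
exact.
Qed.

Lemma min1_dist (R : realType) (a b : R) : `|Num.min 1 a - Num.min 1 b| <= `|a - b|.
Proof.
by rewrite /Num.min; case: ltP => ha; case: ltP => hb; rewrite ?subrr ?normr0 ?normr_ge0//;
  rewrite !ler_norml; apply/andP; split; have := ler_norm (a - b); have := lerNnormlW (lexx `|a - b|); lra.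
Qed.

Lemma subr_subrACA (V : zmodType) (a b c e : V) :
  a - b - (c - e) = (a - c) - (b - e).
Proof. by rewrite !opprB [e - c]addrC addrACA [e - b]addrC. Qed.

Lemma sum_half (R : realType) J : \sum_(0 <= k < J) 2 * (2^-1 : R) ^+ k <= 4.
Proof.
suff -> : \sum_(0 <= k < J) 2 * (2^-1 : R) ^+ k = 4 - 4 * (2^-1) ^+ J.
  by rewrite gerBl mulr_ge0// exprn_ge0// invr_ge0.
elim: J => [|J IH]; first by rewrite big_nil expr0 mulr1 subrr.
by rewrite big_nat_recr//= IH exprS; field.
Qed.

(** Once the tail of the truncated series is at most 1/2, every later term is below 1 and the
    truncation is inactive. *)
Lemma summable_tail (R : realType) (D : nat -> R) (M : R) : (forall k, 0 <= D k) ->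
  (forall J, \sum_(0 <= k < J) Num.min 1 (D k) <= M) ->
  forall e, 0 < e -> exists N, forall k l, (N <= k)%N -> (k <= l)%N ->
    \sum_(k <= j < l) D j <= e.
Proof.
move=> D0 DM e e0; pose e' := Num.min e (2^-1).
have e'0 : 0 < e' by rewrite lt_min e0 invr_gt0/=.
have m0 k : 0 <= Num.min 1 (D k) by rewrite le_min ler01 D0.
have [N hN] := small_tail m0 DM e'0.
have key k l : (N <= k)%N -> (k <= l)%N -> \sum_(k <= j < l) Num.min 1 (D j) <= e'.
  move=> Nk kl; have := hN (l - N)%N; rewrite subnKC ?(leq_trans Nk)//.
  rewrite (@big_cat_nat _ _ _ k)//=; apply: le_trans.
  by rewrite lerDr sumr_ge0.
exists N => k l Nk kl; apply: (@le_trans _ _ (\sum_(k <= j < l) Num.min 1 (D j))).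
  apply: ler_sum_nat => j /andP[kj jl].
  have := key j j.+1 (leq_trans Nk kj) (leqnSn j); rewrite big_nat1.
  rewrite le_min ge_min => /andP[_].
  rewrite ge_min; have -> : (1 <= 2^-1 :> R) = false by apply/negbTE; rewrite -ltNge; lra.
  rewrite /= le_min lexx andbT => h; rewrite (le_trans h)//; lra.
by apply: (le_trans (key _ _ Nk kl)); rewrite ge_min lexx.
Qed.

Lemma telescope_dist (R : realType) (x D : nat -> R) :
  (forall k, `|x k - x k.+1| <= D k) -> forall k l, (k <= l)%N ->
  `|x k - x l| <= \sum_(k <= j < l) D j.
Proof.
move=> xD k l kl; rewrite -(subnKC kl); elim: (l - k)%N => [|m IH].
  by rewrite addn0 subrr normr0 big_geq.
rewrite addnS big_nat_recr ?leq_addr//= -[_ - _](subrKA (x (k + m)%N)).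
by apply: le_trans (ler_normD _ _) _; exact: lerD.
Qed.

(** * Construction of the limit and convergence to it *)

Section weak_convergence.
Context d (Omega : measurableType d) (R : realType) (P : probability Omega R).
Context dG (OmegaG : measurableType dG) (PG : probability OmegaG R).
Variables (I : Type) (G_ : nat -> I -> Omega -> R) (G : I -> OmegaG -> R).

Local Notation L1 f := (P.-integrable setT (EFin \o f)).
Local Notation E f := (Rintegral P setT f).
Local Notation EG f := (Rintegral PG setT f).

Hypothesis mG_ : forall n i, (0 < n)%N -> measurable_fun setT (G_ n i).
Hypothesis mG : forall i, measurable_fun setT (G i).
Hypothesis bG_ : forall n w, (0 < n)%N -> exists M, forall i, `|G_ n i w| <= M.
Hypothesis fidi : forall K (u : 'I_K -> I), cvg_in_distribution P PG
  (fun n w => \row_k G_ n (u k) w) (fun w => \row_k G (u k) w).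
Lemma finite_range_bounded (J : Type) K (x : 'I_K -> R) (kap : J -> 'I_K) :
  exists M, forall i, `|x (kap i)| <= M.
Proof.
exists (\sum_k `|x k|) => i; rewrite (bigD1 (kap i))//= lerDl.
by apply: sumr_ge0.
Qed.

Lemma measurable_continuous_row d' (Om : measurableType d') K (f : 'I_K -> Om -> R)
    (Phi : 'rV[R]_K -> R) :
  (forall k, measurable_fun setT (f k)) -> continuous Phi ->
  measurable_fun setT (fun w => Phi (\row_k f k w)).
Proof.
move=> mf /continuousP cPhi; apply: measurable_fun_open => U oU.
exact: (measurable_row_open mf (cPhi _ oU)).
Qed.

Lemma fidi_E K (u : 'I_K -> I) (Phi : 'rV[R]_K -> R) M :
  continuous Phi -> (forall x, `|Phi x| <= M) ->
  E (fun w => Phi (\row_k G_ n (u k) w)) @[n --> \oo] -->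
  EG (fun w => Phi (\row_k G (u k) w)).
Proof.
move=> cPhi PhiM; have bPhi : bounded_fun Phi by apply/bounded_funE; exists M.
have PG1 : PG.-integrable setT (EFin \o (fun w => Phi (\row_k G (u k) w))).
  apply: (@L1_bounded _ _ _ PG _ M); first exact: measurable_continuous_row.
  by move=> w; exact: PhiM.
have := @fidi K u Phi cPhi bPhi; rewrite unlock.
have -> : (\int[PG]_w ((Phi \o (fun w => \row_k G (u k) w)) w)%:E)%E =
  (EG (fun w => Phi (\row_k G (u k) w)))%:E by rewrite EFin_E.
by move=> /fine_cvgP[_].
Qed.

(* J is I when two discretizations of the process are compared, and unit when a
   single coordinate is. *)
Lemma fidi_sup_dist (J : Type) K L (u : 'I_K -> I) (v : 'I_L -> I)
    (kap : J -> 'I_K) (xi : J -> 'I_L) c n0 :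
  let D w := `|to_linf (fun j => G (u (kap j)) w) - to_linf (fun j => G (v (xi j)) w)| in
  (forall n, (n0 <= n)%N -> exists U, [/\ L1 U, forall w, 0 <= U w, E U <= c &
    forall j w, `|G_ n (u (kap j)) w - G_ n (v (xi j)) w| <= U w]) ->
  measurable_fun setT D /\ EG (fun w => Num.min 1 (D w)) <= c.
Proof.
move=> D HU.
(* Both families are joined into one, so that a single finite-dimensional law governs the
   distance. *)
pose uv (p : 'I_(K + L)) := match fintype.split p with inl a => u a | inr b => v b end.
pose psi (x : 'rV[R]_(K + L)) := `|to_linf (fun j => x 0 (lshift L (kap j))) -
   to_linf (fun j => x 0 (rshift K (xi j)))|.
have psi_lip (x y : 'rV[R]_(K + L)) e : 0 <= e -> (forall k, `|x 0 k - y 0 k| <= e) ->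
    `|psi x - psi y| <= 2 * e.
  move=> e0 xy; apply: (le_trans (ler_dist_dist _ _)).
  rewrite subr_subrACA.
  apply: le_trans (ler_normB _ _) _; rewrite mulr2n mulrDl mul1r lerD//.
    apply: to_linf_dist_le => //.
    - exact: (finite_range_bounded (fun k => x 0 (lshift L k))).
    - exact: (finite_range_bounded (fun k => y 0 (lshift L k))).
  apply: to_linf_dist_le => //.
  - exact: (finite_range_bounded (fun k => x 0 (rshift K k))).
  - exact: (finite_range_bounded (fun k => y 0 (rshift K k))).
have psiE Om (g : I -> Om -> R) w : psi (\row_p g (uv p) w) =
    `|to_linf (fun j => g (u (kap j)) w) - to_linf (fun j => g (v (xi j)) w)|.
  rewrite /psi; congr (`|to_linf _ - to_linf _|); apply/funext => j; rewrite mxE /uv.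
    by rewrite (unsplitK (inl (kap j))).
  by rewrite (unsplitK (inr (xi j))).
have cpsi : continuous psi by exact: (row_continuous (ler0n _ 2) psi_lip).
have mD : measurable_fun setT D.
  rewrite (_ : D = fun w => psi (\row_p G (uv p) w)); first exact: measurable_continuous_row.
  by apply/funext => w; rewrite psiE.
split=> //.
(* Convergence in law gives nothing for unbounded functionals; the cut-off at 1 makes this one
   admissible. *)
have cmin : continuous (fun x => Num.min 1 (psi x)).
  apply: (row_continuous (ler0n _ 2)) => x y e e0 xy.
  exact: le_trans (min1_dist _ _) (psi_lip x y e e0 xy).
have minM x : `|Num.min 1 (psi x)| <= 1.
  by rewrite ger0_norm ?ge_min ?lexx// le_min ler01 normr_ge0.
have := @fidi_E _ uv _ _ cmin minM.
under [X in _ --> Rintegral _ _ X]eq_fun do rewrite psiE.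
move=> /cvgr_to_le; apply; exists (maxn n0 1) => // n /=; rewrite geq_max => /andP[n0n n_gt0].
have [U [U1 U0 UE Ub]] := HU n n0n.
apply: le_trans UE; apply: ler_E => //.
  apply: (@L1_bounded _ _ _ P _ 1) => [|w]; last exact: minM.
  apply: measurable_fun_open => V oV; move/continuousP : cmin => /(_ _ oV) h.
  by apply: (measurable_row_open _ h) => k; exact: mG_.
move=> w; rewrite psiE ge_min; apply/orP; right.
apply: to_linf_dist_le => //.
- exact: (finite_range_bounded (fun k => G_ n (u k) w)).
- exact: (finite_range_bounded (fun k => G_ n (v k) w)).
Qed.

Variables (K : nat -> nat) (u : forall k, 'I_(K k) -> I) (kap : forall k, I -> 'I_(K k)).
Variable n0 : nat -> nat.
Hypothesis levels : forall k n, (n0 k <= n)%N -> exists U, [/\ L1 U, forall w, 0 <= U w,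
  E U <= (2^-1) ^+ k & forall i w, `|G_ n i w - G_ n (u (kap k i)) w| <= U w].

Let pi k i := u (kap k i).
Let Zk k w := to_linf (fun i => G (pi k i) w).

Lemma bounded_level k w : exists M, forall i, `|G (pi k i) w| <= M.
Proof. exact: (finite_range_bounded (fun j => G (u j) w)). Qed.

(** Truncated distances of consecutive levels have means at most 2^-k + 2^-(k+1), which are
    summable. Since the distance is the sup norm, one null set serves all indices. *)
Lemma ae_levels_cauchy : exists W, [/\ measurable W, PG (~` W) = 0%E &
  forall w, W w -> forall e, 0 < e -> exists N, forall i k l, (N <= k)%N -> (N <= l)%N ->
    `|G (pi k i) w - G (pi l i) w| <= e].
Proof.
pose D k w := `|Zk k w - Zk k.+1 w|.
have D_ k : measurable_fun setT (D k) /\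
    EG (fun w => Num.min 1 (D k w)) <= 2 * (2^-1) ^+ k.
  apply: (@fidi_sup_dist I _ _ (@u k) (@u k.+1) (kap k) (kap k.+1) _ (maxn (n0 k) (n0 k.+1))).
  move=> n; rewrite geq_max => /andP[/levels[U [U1 U0 UE Ub]] /levels[V [V1 V0 VE Vb]]].
  exists (fun w => U w + V w); split.
  - exact: L1D.
  - by move=> w; rewrite addr_ge0.
  - rewrite ED// mulr2n mulrDl mul1r lerD//; apply: (le_trans VE).
    by rewrite exprS ler_piMl ?exprn_ge0 ?invr_ge0//; lra.
  move=> i w; have := Ub i w; have := Vb i w.
  move=> h1 h2; rewrite -[_ - _](subrKA (G_ n i w)).
  by apply: le_trans (ler_normD _ _) _; apply: lerD; rewrite // distrC.
have m1 k : measurable_fun setT (fun w => Num.min 1 (D k w)).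
  by apply: measurable_minr; [exact: measurable_cst|exact: (D_ k).1].
have p1 k w : 0 <= Num.min 1 (D k w) by rewrite le_min ler01 normr_ge0.
have l1 k : PG.-integrable setT (EFin \o (fun w => Num.min 1 (D k w))).
  by apply: (@L1_bounded _ _ _ PG _ 1) => // w; rewrite ger0_norm// ge_min lexx.
have [W [mW W0 hW]] := ae_summable m1 p1 l1 (fun k => (D_ k).2) (@sum_half R).
exists W; split=> // w /hW[M hM] e e0.
have D0 k : 0 <= D k w by exact: normr_ge0.
have [N hN] := summable_tail D0 hM e0.
have xD i k : `|G (pi k i) w - G (pi k.+1 i) w| <= D k w.
  have := le_linf_dist (Zk k w) (Zk k.+1 w) i; rewrite /Zk !to_linfE//; exact: bounded_level.
exists N => i k l Nk Nl; wlog kl : k l Nk Nl / (k <= l)%N.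
  by move=> h; case: (leqP k l) => [|/ltnW] kl; [|rewrite distrC]; exact: h.
by apply: le_trans (hN _ _ Nk kl); exact: (telescope_dist (xD i)).
Qed.

(** Here the null set depends on [i]. That is enough to compare finitely many coordinates of the
    version with G. *)
Lemma ae_level_cvg i : exists W, [/\ measurable W, PG (~` W) = 0%E &
  forall w, W w -> forall e, 0 < e -> exists N, forall k, (N <= k)%N ->
    `|G (pi k i) w - G i w| <= e].
Proof.
pose Di k w := `|to_linf (fun _ : unit => G (u (kap k i)) w) - to_linf (fun _ : unit => G i w)|.
have D_ k : measurable_fun setT (Di k) /\
    EG (fun w => Num.min 1 (Di k w)) <= 2 * (2^-1) ^+ k.
  apply: (@fidi_sup_dist unit _ 1 (@u k) (fun=> i) (fun=> kap k i) (fun=> ord0) _ (n0 k)).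
  move=> n /levels[U [U1 U0 UE Ub]]; exists U; split => //.
  - by apply: (le_trans UE); rewrite ler_peMl ?exprn_ge0 ?invr_ge0//; lra.
  - by move=> _ w; rewrite distrC; exact: Ub.
have m1 k : measurable_fun setT (fun w => Num.min 1 (Di k w)).
  by apply: measurable_minr; [exact: measurable_cst|exact: (D_ k).1].
have p1 k w : 0 <= Num.min 1 (Di k w) by rewrite le_min ler01 normr_ge0.
have l1 k : PG.-integrable setT (EFin \o (fun w => Num.min 1 (Di k w))).
  by apply: (@L1_bounded _ _ _ PG _ 1) => // w; rewrite ger0_norm// ge_min lexx.
have [W [mW W0 hW]] := ae_summable m1 p1 l1 (fun k => (D_ k).2) (@sum_half R).
exists W; split=> // w /hW[M hM] e e0.
have D0 k : 0 <= Di k w by exact: normr_ge0.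
have [N hN] := summable_tail D0 hM e0.
exists N => k Nk; have := hN k k.+1 Nk (leqnSn k); rewrite big_nat1; apply: le_trans.
have := le_linf_dist (to_linf (fun _ : unit => G (u (kap k i)) w)) (to_linf (fun _ : unit => G i w)) tt.
rewrite !to_linfE//; first by exists `|G i w|.
by exists `|G (u (kap k i)) w|.
Qed.

(** A discretization factors through a continuous map from a finite-dimensional space, which is why
    it is Borel although l^oo may be nonseparable. *)
Lemma open_level k (U : set (linf I R)) : open U ->
  open [set x : 'rV[R]_(K k) | U (to_linf (fun i => x 0 (kap k i)))].
Proof.
move=> oU; rewrite openE => x Ux.
have : nbhs (to_linf (fun i => x 0 (kap k i))) U by apply: open_nbhs_nbhs.
move=> /linf_nbhsP[e e0 eU]; apply/nbhs_ballP.
have e20 : 0 < e / 2 by rewrite divr_gt0.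
exists (e / 2) => //= y [_ xy]; apply: eU.
apply: (@le_lt_trans _ _ (e / 2)); last by lra.
apply: to_linf_dist_le; rewrite ?(ltW e20)//.
- exact: (finite_range_bounded (fun j => x 0 j)).
- exact: (finite_range_bounded (fun j => y 0 j)).
- by move=> i; exact: ltW (xy 0 (kap k i)).
Qed.

Lemma borel_level k : borel_measurable (Zk k).
Proof.
move=> U oU; have := measurable_row_open (fun j => mG (u j)) (@open_level k U oU).
congr measurable; apply/seteqP; split => w /=.
  by congr U; congr to_linf; apply/funext => i; rewrite mxE.
by congr U; congr to_linf; apply/funext => i; rewrite mxE.
Qed.

Lemma limit_version : exists (Z : OmegaG -> linf I R) (W : set OmegaG),
  [/\ borel_measurable Z, measurable W, PG (~` W) = 0%E &
   forall w, W w -> forall e, 0 < e -> exists N, forall k, (N <= k)%N ->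
    `|Zk k w - Z w| <= e].
Proof.
have [W [mW W0 hW]] := ae_levels_cauchy.
have /choice[Z hZ] : forall w, exists z : linf I R, (W w -> forall e, 0 < e ->
    exists N, forall k, (N <= k)%N -> `|Zk k w - z| <= e) /\ (~ W w -> z = 0).
  move=> w; have [Ww|nW] := pselect (W w); last by exists 0.
  have /choice[f hf] : forall i, exists l, forall e, 0 < e -> exists N, forall k,
      (N <= k)%N -> `|G (pi k i) w - l| <= e.
    move=> i; apply: real_cauchy_limit => e /(hW w Ww)[N hN].
    by exists N => k l; exact: hN.
  have unif e : 0 < e -> exists N, forall k, (N <= k)%N -> forall i, `|G (pi k i) w - f i| <= e.
    move=> e0; have e20 : 0 < e / 2 by rewrite divr_gt0.
    have [N hN] := hW w Ww _ e20; exists N => k Nk i.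
    have [N' hN'] := hf i _ e20.
    have h1 := hN i k (maxn N N') Nk (leq_maxl _ _).
    have h2 := hN' (maxn N N') (leq_maxr _ _).
    rewrite -[_ - _](subrKA (G (pi (maxn N N') i) w)).
    by apply: le_trans (ler_normD _ _) _; lra.
  have fb : exists M, forall i, `|f i| <= M.
    have [N hN] := unif 1 ltr01; have [M hM] := bounded_level N w.
    exists (M + 1) => i; have h1 := hN N (leqnn N) i; have h2 := hM i.
    rewrite -[f i](subrK (G (pi N i) w)) addrC; apply: le_trans (ler_normD _ _) _.
    by rewrite lerD// distrC.
  exists (to_linf f); split => // _ e e0; have [N hN] := unif e e0.
  exists N => k Nk; apply: to_linf_dist_le => //; [exact: ltW|exact: bounded_level|exact: hN].
exists Z, W; split => //; last by move=> w Ww; exact: (hZ w).1.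
(* Off [W] both the levels and the limit are set to 0, so that convergence holds at every point and
   the limit is Borel. *)
pose Zk' k w := if `[< W w >] then Zk k w else 0.
apply: (@borel_measurable_limit I R _ _ Zk') => [k U oU|w e e0].
  have -> : Zk' k @^-1` U = (W `&` Zk k @^-1` U) `|` (~` W `&` [set w | U 0]).
    apply/seteqP; split => w /=; rewrite /Zk'.
      by case: asboolP => Ww h; [left|right].
    by case: asboolP => Ww [[? ?]|[? ?]].
  apply: measurableU; first by apply: measurableI => //; exact: borel_level.
  apply: measurableI; first exact: measurableC.
  have [U0|U0] := pselect (U 0).
    by rewrite (_ : [set w | U 0] = setT)//; apply/seteqP; split.
  by rewrite (_ : [set w | U 0] = set0)//; apply/seteqP; split.
rewrite /Zk'; case: asboolP => Ww; first exact: (hZ w).1.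
by exists 0%N => k _; rewrite (hZ w).2// subrr normr0 ltW.
Qed.

Lemma version_same_fidi (Z : OmegaG -> linf I R) (W : set OmegaG) :
  borel_measurable Z -> measurable W -> PG (~` W) = 0%E ->
  (forall w, W w -> forall e, 0 < e -> exists N, forall k, (N <= k)%N ->
    `|Zk k w - Z w| <= e) ->
  same_fidi PG PG G (fun i w => Z w i).
Proof.
move=> bZ mW W0 hW K' v A sA.
have /choice[Wv hWv] := fun k => ae_level_cvg (v k).
pose C := W `&` \bigcap_k Wv k.
have mC : measurable C.
  apply: measurableI => //; apply: fin_bigcap_measurable => // k _.
  by case: (hWv k).
have mZ i : measurable_fun setT (fun w => Z w i).
  apply: (@borel_measurable_comp _ _ _ _ Z (fun z : linf I R => z i) bZ).
  apply: (lipschitz_by_continuous ler01) => y z.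
  by rewrite mul1r; exact: le_linf_dist.
apply: (@eq_prob_null _ _ _ PG _ _ C) => //.
- by apply: measurable_row => // k; exact: mG.
- by apply: measurable_row => // k; exact: mZ.
- apply/negligibleP; first exact: measurableC.
  (* The finitely many exceptional sets are indexed by [nat], empty from [K'] on, for countable
     subadditivity. *)
  pose F n := [set w | exists k : 'I_K', val k = n /\ ~ Wv k w].
  apply: (@negligibleS _ _ _ _ (~` W `|` \bigcup_n F n)).
    move=> w /= nC; have [Ww|nW] := pselect (W w); last by left.
    right; apply: contrapT => nF; apply: nC; split => // k _.
    by apply: contrapT => nk; apply: nF; exists (val k) => //; exists k.
  apply: negligibleU; first by apply/negligibleP => //; exact: measurableC.
  apply: negligible_bigcup => n; have [nK|Kn] := ltnP n K'.
    have [mk k0 _] := hWv (Ordinal nK).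
    apply: (@negligibleS _ _ _ _ (~` Wv (Ordinal nK))).
      move=> w [k [kn nk]]; rewrite (_ : Ordinal nK = k)//; exact: val_inj.
    by apply/negligibleP => //; exact: measurableC.
  apply: (@negligibleS _ _ _ _ set0); last exact: negligible_set0.
  by move=> w [k [kn _]]; move: (ltn_ord k); rewrite ltnNge kn Kn.
have GZ k w : C w -> G (v k) w = Z w (v k).
  move=> [Ww Wvw]; have [_ _ hk] := hWv k.
  apply/eqP; rewrite -subr_eq0 -normr_le0; apply/ler_addgt0Pr => e e0; rewrite add0r.
  have e20 : 0 < e / 2 by rewrite divr_gt0.
  have [N hN] := hk w (Wvw k Logic.I) _ e20; have [N' hN'] := hW w Ww _ e20.
  have h1 := hN _ (leq_maxl N N'); have h2 := hN' _ (leq_maxr N N').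
  have h3 := le_linf_dist (Zk (maxn N N') w) (Z w) (v k).
  rewrite /Zk to_linfE in h3; last exact: bounded_level.
  rewrite -[_ - _](subrKA (G (pi (maxn N N') (v k)) w)).
  by apply: le_trans (ler_normD _ _) _; rewrite distrC; rewrite /Zk in h2; lra.
apply/seteqP; split => w /= [Aw Cw]; split => //; move: Aw; congr A.
  by apply/rowP => k; rewrite !mxE GZ.
by apply/rowP => k; rewrite !mxE GZ.
Qed.

Let Zn n w := to_linf (fun i => G_ n i w).

(** Three comparisons at a fixed level [k0]: the process with its discretization by [U], the
    discretizations by convergence in law, and the discretized G with Z by bounded convergence. The
    function [g] is a measurable substitute for [h \o Zn n]. *)
Lemma lipschitz_approx (Z : OmegaG -> linf I R) (W : set OmegaG) (h : linf I R -> R) L M :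
  borel_measurable Z -> measurable W -> PG (~` W) = 0%E ->
  (forall w, W w -> forall e, 0 < e -> exists N, forall k, (N <= k)%N ->
    `|Zk k w - Z w| <= e) ->
  0 <= L -> lipschitz_by L h -> (forall z, `|h z| <= M) ->
  forall e, 0 < e -> exists N, forall n, (N <= n)%N -> exists g U,
    [/\ L1 g, L1 U, forall w, `|h (Zn n w) - g w| <= U w, E U <= e &
        `|E g - EG (h \o Z)| <= e].
Proof.
move=> bZ mW W0 hW L0 hL hM e e0.
have ch := lipschitz_by_continuous L0 hL.
have e20 : 0 < e / 2 by rewrite divr_gt0.
have mZ := borel_measurable_comp bZ ch.
have mZk k := borel_measurable_comp (@borel_level k) ch.
have [k0 [k0L k0c]] : exists k, L * (2^-1) ^+ k <= e /\ `|EG (h \o Zk k) - EG (h \o Z)| <= e / 2.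
  have LE0 : 0 < e / (L + 1) by rewrite divr_gt0// ltr_wpDl.
  have [l hl] := exists_half_power LE0.
  pose f k w := if `[< W w >] then h (Zk k w) else h (Z w).
  have mf k : measurable_fun setT (f k).
    apply: measurable_fun_ifT => //; [|exact: mZk].
    apply: (measurable_fun_bool true); rewrite setTI.
    by rewrite (_ : _ @^-1` _ = W)//; apply/seteqP; split => w /= /asboolP.
  have : EG (f k) @[k --> \oo] --> EG (h \o Z).
    apply: (@E_bounded_cvg _ _ _ PG _ _ M) => //.
    - by move=> k w; rewrite /f; case: ifP.
    move=> w; rewrite /f; case: asboolP => Ww; last exact: cvg_cst.
    apply/cvgrPdist_le => e' e'0; have e'L : 0 < e' / (L + 1) by rewrite divr_gt0// ltr_wpDl.
    have [N hN] := hW w Ww _ e'L; exists N => // k /= Nk.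
    rewrite distrC; apply: (le_trans (hL _ _)).
    apply: (le_trans (ler_wpM2l L0 (hN k Nk))).
    by rewrite mulrA ler_pdivrMr ?ltr_wpDl// mulrC ler_wpM2l ?(ltW e'0)// lerDl.
  move=> /cvgrPdist_le/(_ _ e20)[N _ hN]; exists (maxn l N); split.
    apply: (@le_trans _ _ (L * (e / (L + 1)))).
      rewrite ler_wpM2l//; apply: le_trans hl; apply: ler_wiXn2l; [lra|lra|exact: leq_maxl].
    by rewrite mulrA ler_pdivrMr ?ltr_wpDl// mulrC ler_wpM2l ?(ltW e0)// lerDl.
  have := hN (maxn l N) (leq_maxr _ _); rewrite distrC.
  rewrite (_ : EG (f _) = EG (h \o Zk (maxn l N)))//.
  by apply: (E_ae_eq (mf _) (mZk _) mW W0) => w Ww; rewrite /f asboolT.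
pose Phi (x : 'rV[R]_(K k0)) := h (to_linf (fun i => x 0 (kap k0 i))).
have cPhi : continuous Phi.
  apply: (row_continuous L0) => x y c c0 xy; apply: (le_trans (hL _ _)).
  rewrite ler_wpM2l//; apply: to_linf_dist_le => //.
  - exact: (finite_range_bounded (fun j => x 0 j)).
  - exact: (finite_range_bounded (fun j => y 0 j)).
have PhiE Om (g : I -> Om -> R) w :
    Phi (\row_j g (u j) w) = h (to_linf (fun i => g (pi k0 i) w)).
  by rewrite /Phi; congr (h (to_linf _)); apply/funext => i; rewrite mxE.
have PhiM x : `|Phi x| <= M by exact: hM.
have := @fidi_E _ (@u k0) _ _ cPhi PhiM.
under [X in _ --> Rintegral _ _ X]eq_fun do rewrite PhiE.
move=> /cvgrPdist_le/(_ _ e20)[N _ hN].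
exists (maxn 1 (maxn N (n0 k0))) => n; rewrite !geq_max => /and3P[n_gt0 Nn n0n].
have [U [U1 U0 UE Ub]] := levels n0n.
exists (fun w => Phi (\row_j G_ n (u j) w)), (fun w => L * U w); split.
- apply: (@L1_bounded _ _ _ P _ M) => [|w]; last exact: PhiM.
  apply: measurable_fun_open => V oV; move/continuousP : cPhi => /(_ _ oV) h'.
  by apply: (measurable_row_open _ h') => k; exact: mG_.
- exact: L1Z.
- move=> w; rewrite PhiE; apply: (le_trans (hL _ _)); rewrite ler_wpM2l//.
  apply: to_linf_dist_le => //; first exact: bG_.
  exact: (finite_range_bounded (fun j => G_ n (u j) w)).
- by rewrite EZ//; apply: le_trans k0L; rewrite ler_wpM2l.
- have := hN n Nn; rewrite distrC => h1.
  rewrite -[_ - _](subrKA (EG (h \o Zk k0))); apply: le_trans (ler_normD _ _) _.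
  by apply: le_trans (lerD h1 k0c) _; lra.
Qed.

(* H lies between Lipschitz functionals whose integrals along Z are close. *)
Lemma weak_cvg_limit (Z : OmegaG -> linf I R) (W : set OmegaG) :
  borel_measurable Z -> measurable W -> PG (~` W) = 0%E ->
  (forall w, W w -> forall e, 0 < e -> exists N, forall k, (N <= k)%N ->
    `|Zk k w - Z w| <= e) ->
  weak_cvg P PG Zn Z.
Proof.
move=> bZ mW W0 hW H cH /bounded_funE[M hM].
have mHZ := borel_measurable_comp bZ cH.
have L1_bd (f : OmegaG -> R) : measurable_fun setT f -> (forall w, `|f w| <= M) ->
    PG.-integrable setT (EFin \o f) by move=> mf fM; exact: L1_bounded fM.
have HZ1 : PG.-integrable setT (EFin \o (H \o Z)) by apply: L1_bd => // w; exact: hM.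
(* Only a lower bound is needed: applied to [- H] it yields the upper one. *)
have half (H' : linf I R -> R) : continuous H' -> (forall z, `|H' z| <= M) ->
    forall e, 0 < e -> exists N, forall n, (N <= n)%N -> exists g U,
    [/\ L1 g, L1 U, forall w, g w - U w <= H' (Zn n w) &
      EG (H' \o Z) - e <= E g - E U].
  move=> cH' hM' e e0; have e30 : 0 < e / 3 by rewrite divr_gt0.
  have lipm m := lipschitz_inf_convolution hM' m.
  have : EG (fun w => inf_convolution H' m (Z w)) @[m --> \oo] --> EG (H' \o Z).
    apply: (@E_bounded_cvg _ _ _ PG _ _ M).
    - move=> m; apply: (borel_measurable_comp bZ).
      exact: (lipschitz_by_continuous _ (lipm m)).
    - exact: borel_measurable_comp.
    - by move=> m w; exact: inf_convolution_norm_le.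
    - by move=> w; exact: inf_convolution_cvg.
  move=> /cvgrPdist_le/(_ _ e30)[m _ /(_ m (leqnn m)) hm].
  have [N hN] := lipschitz_approx bZ mW W0 hW (ler0n _ m) (lipm m)
    (inf_convolution_norm_le hM' m) e30.
  exists N => n /hN[g [U [g1 U1 gU UE gE]]]; exists g, U; split => //.
    move=> w; apply: le_trans (inf_convolution_le_fun hM' m _).
    by have := gU w; rewrite ler_norml => /andP[]; lra.
  move: hm gE; rewrite /= !ler_norml => /andP[_ h1] /andP[h2 _].
  by move: h1 h2; rewrite /comp; lra.
have -> : ('E_PG[H \o Z])%E = (EG (H \o Z))%:E by rewrite EFin_E// unlock.
have bnd e : 0 < e -> exists N, forall n, (N <= n)%N ->
    ((EG (H \o Z) - e)%:E <= outer_expectation P (H \o Zn n) <= (EG (H \o Z) + e)%:E)%E.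
  move=> e0; have [N hN] := half H cH hM e e0.
  have [||N' hN'] := half (fun z => - H z) _ _ e e0.
  - by move=> z; exact: (@cvgN _ _ _ _ (nbhs_filter z) _ _ (cH z)).
  - by move=> z; rewrite normrN.
  exists (maxn N N') => n; rewrite geq_max => /andP[/hN[g [U [g1 U1 gU gE]]]].
  move=> /hN'[g' [U' [g'1 U'1 gU' gE']]]; apply/andP; split.
    apply: (@le_trans _ _ (E (fun w => g w - U w))%:E); first by rewrite lee_fin EB.
    by apply: outer_expectation_ge => //; exact: L1B.
  apply: (@le_trans _ _ (E (fun w => - 1 * (g' w - U' w)))%:E).
    apply: outer_expectation_le; first by apply: L1Z; exact: L1B.
    by move=> w; have := gU' w; rewrite /=; lra.
  rewrite lee_fin EZ; last exact: L1B.
  rewrite EB//; have : EG ((fun z => - H z) \o Z) = - 1 * EG (H \o Z).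
    by rewrite -EZ//; congr Rintegral; apply/funext => w /=; rewrite mulN1r.
  by move: gE' => /[swap] ->; lra.
apply/fine_cvgP; split.
  have [N hN] := bnd 1 ltr01; exists N => // n /hN /andP[h1 h2].
  by rewrite fin_numE; apply/andP; split; apply/eqP => h; rewrite h in h1 h2.
apply/cvgrPdist_le => e e0; have [N hN] := bnd e e0; exists N => // n /= /hN.
case: (outer_expectation _ _) => [x| |] /andP[] //=; rewrite !lee_fin => h1 h2.
by rewrite ler_norml; apply/andP; split; lra.
Qed.

End weak_convergence.

(** The approximation [u], [kap] is chosen before [n]; only then can it be carried over to G. Taking
    dlt = 2^-k makes the errors summable. *)
Theorem weak_cvg_of_finite_approximation d (Omega : measurableType d) (R : realType)
    (P : probability Omega R) dG (OmegaG : measurableType dG) (PG : probability OmegaG R)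
    (I : Type) (G_ : nat -> I -> Omega -> R) (G : I -> OmegaG -> R) :
  (forall n i, (0 < n)%N -> measurable_fun setT (G_ n i)) ->
  (forall i, measurable_fun setT (G i)) ->
  (forall n w, (0 < n)%N -> exists M, forall i, `|G_ n i w| <= M) ->
  (forall K (u : 'I_K -> I), cvg_in_distribution P PG
    (fun n w => \row_k G_ n (u k) w) (fun w => \row_k G (u k) w)) ->
  (forall dlt : R, 0 < dlt ->
    exists K (u : 'I_K -> I) (kap : I -> 'I_K) n0, forall n, (n0 <= n)%N ->
    exists U, [/\ P.-integrable setT (EFin \o U), forall w, 0 <= U w,
      Rintegral P setT U <= dlt & forall i w, `|G_ n i w - G_ n (u (kap i)) w| <= U w]) ->
  weak_cvg_to_version P PG G_ G.
Proof.
move=> mG_ mG bG_ fidi approx.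
have /choice[T hT] : forall k, exists T : {K : nat & ('I_K -> I) * (I -> 'I_K) * nat}%type,
    forall n, ((projT2 T).2 <= n)%N ->
    exists U, [/\ P.-integrable setT (EFin \o U), forall w, 0 <= U w,
      Rintegral P setT U <= (2^-1) ^+ k &
      forall i w, `|G_ n i w - G_ n ((projT2 T).1.1 ((projT2 T).1.2 i)) w| <= U w].
  move=> k; have [|K [u [kap [n0 h]]]] := approx ((2^-1) ^+ k); first by rewrite exprn_gt0.
  by exists (existT _ K (u, kap, n0)).
pose K k := projT1 (T k); pose u k : 'I_(K k) -> I := (projT2 (T k)).1.1.
pose kap k : I -> 'I_(K k) := (projT2 (T k)).1.2; pose n0 k := (projT2 (T k)).2.
have [Z [W [bZ mW W0 hW]]] := @limit_version _ _ _ P _ _ PG I G_ G mG_ mG fidi K u kap n0 hT.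
exists (fun n w => to_linf (fun i => G_ n i w)).
  by move=> n w i n_gt0; rewrite to_linfE//; exact: bG_.
exists dG, OmegaG, PG, Z; split => //.
  exact: (@version_same_fidi _ _ _ P _ _ PG I G_ G mG_ mG fidi K u kap n0 hT Z W).
exact: (@weak_cvg_limit _ _ _ P _ _ PG I G_ G mG_ mG bG_ fidi K u kap n0 hT Z W).
Qed.

(** * Bracketing entropy *)

Section bracketing_facts.
Context d (X : measurableType d) (R : realType).
Implicit Types (F A B : set (X -> R)) (rho : (X -> R) -> \bar R).

Lemma card_I_enum (U : pointedType) (A : set U) N : (A #= `I_N)%card ->
  exists g : 'I_N -> U, (forall i, A (g i)) /\ forall x, A x -> exists i, x = g i.
Proof.
rewrite card_eq_sym => /card_set_bijP[f [fA _ fs]].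
exists (fun i => f (val i)); split => [i|x /fs[k /= kN <-]].
  by apply: fA => /=.
by exists (Ordinal kN).
Qed.

Lemma bracketing_enum F rho eps N A B : bracketing F rho eps N A B ->
  exists (a : 'I_N -> F) (b : 'I_N -> X -> R) (pa pb : F -> 'I_N),
    (forall i, B (b i)) /\
    forall phi x, `|val phi x - val (a (pa phi)) x| <= b (pb phi) x.
Proof.
move=> [AF /card_I_enum[a [aA As]] /card_I_enum[b [bB Bs]] _ br].
pose a' i : F := SigSub (mem_set (AF _ (aA i))).
have /choice[p hp] : forall phi : F, exists p : 'I_N * 'I_N,
    forall x, `|val phi x - val (a' p.1) x| <= b p.2 x.
  move=> phi; have [a0 [b0 [/As[i ->] /Bs[k ->] h]]] := br (val phi) (set_mem (valP phi)).
  by exists (i, k).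
by exists a', b, (fun phi => (p phi).1), (fun phi => (p phi).2).
Qed.

Lemma bracketing_number_anti F rho x y : x <= y ->
  (bracketing_number F rho y <= bracketing_number F rho x)%E.
Proof.
move=> xy; apply: le_ereal_inf => _ [N [A [B [h1 h2 h3 h4 h5]]] <-].
exists N => //; exists A, B; split => // b /h4[mb rb]; split => //.
by apply: (lt_le_trans rb); rewrite lee_fin.
Qed.

Lemma bracketing_number_ge0 F rho x : (0 <= bracketing_number F rho x)%E.
Proof. by apply: le_ereal_inf_tmp => _ [N _ <-]; rewrite lee_fin. Qed.

Lemma measurable_anti (h : R -> \bar R) : (forall x y, x <= y -> (h y <= h x)%E) ->
  measurable_fun setT h.
Proof.
move=> hm; apply: (measurability _ (ErealGenOInfty.measurableE R)).
move=> /= _ [_ [a ->]] <-; rewrite setTI preimage_itvoy.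
apply: is_interval_measurable => x y /= hx hy z /andP[xz zy].
exact: lt_le_trans hy (hm _ _ zy).
Qed.

(** Both factors of the integrand are nonincreasing, so on ]eps_(j+1), eps_j] it is at least its
    value at eps_j. The interval has length eps_j / 2, whence the factor 2 in the bound. *)
Lemma entropy_sum F rho (th q : R) (N : nat -> nat) : 0 <= th -> 0 <= q ->
  (forall j, (N j)%:R%:E = bracketing_number F rho ((2^-1) ^+ j)) ->
  (\int[lebesgue_measure]_(x in `]0%R, 1%R])
      ((x `^ (- th))%R%:E * (bracketing_number F rho x) `^ q) < +oo)%E ->
  exists M, forall J, \sum_(0 <= j < J) (N j)%:R `^ q * ((2^-1) ^+ j) `^ (1 - th) <= M.
Proof.
move=> th0 q0 NE; set mu := lebesgue_measure; pose eps j : R := (2^-1) ^+ j.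
have eps0 j : 0 < eps j by rewrite exprn_gt0.
pose f x : \bar R := ((x `^ (- th))%R%:E * (bracketing_number F rho x) `^ q)%E.
move=> foo; have f0 x : (0 <= f x)%E by rewrite mule_ge0 ?poweR_ge0// lee_fin powR_ge0.
have mf : measurable_fun setT f.
  apply: emeasurable_funM; first by apply/measurable_EFinP; exact: measurable_powR.
  apply: measurable_anti => x y xy; apply: gt0_ler_poweR => //.
  - by rewrite in_itv /= bracketing_number_ge0 leey.
  - by rewrite in_itv /= bracketing_number_ge0 leey.
  - exact: bracketing_number_anti.
pose c j := (N j)%:R `^ q * (eps j) `^ (- th).
have c0 j : 0 <= c j by rewrite mulr_ge0// powR_ge0.
have eS j : eps j = 2 * eps j.+1 by rewrite /eps exprS mulrA mulfV ?mul1r.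
have fc j x : eps j.+1 < x -> x <= eps j -> ((c j)%:E <= f x)%E.
  move=> x1 x2; have x0 : 0 < x by exact: lt_trans x1.
  rewrite /c mulrC EFinM /f -(poweR_EFin (N j)%:R) NE; apply: lee_pmul.
  - by rewrite lee_fin powR_ge0.
  - exact: poweR_ge0.
  - rewrite lee_fin !powRN lef_pV2 ?posrE ?powR_gt0//.
    by apply: ge0_ler_powR; rewrite ?nnegrE ?(ltW x0) ?(ltW (eps0 j)).
  apply: gt0_ler_poweR => //.
  - by rewrite in_itv /= bracketing_number_ge0 leey.
  - by rewrite in_itv /= bracketing_number_ge0 leey.
  - exact: bracketing_number_anti.
(* The integral over the remaining interval at 0 is carried along, so that the induction peels off
   one dyadic piece at a time. *)
have key J : ((\sum_(0 <= j < J) c j * eps j.+1)%:E +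
    \int[mu]_(x in `]0%R, eps J]) f x <= \int[mu]_(x in `]0%R, 1%R]) f x)%E.
  elim: J => [|J IH]; first by rewrite big_nil add0e /eps expr0.
  apply: le_trans IH; rewrite big_nat_recr//= EFinD -addeA leeD2l//.
  have -> : `]0, eps J]%classic = `]0, eps J.+1]%classic `|` `]eps J.+1, eps J]%classic.
    apply/seteqP; split => x /=; rewrite !in_itv /=.
      by case: (leP x (eps J.+1)) => h /andP[h1 h2]; [left|right]; rewrite ?h1 ?h2.
    have e1 : eps J.+1 <= eps J by rewrite [leRHS]eS ler_peMl ?(ltW (eps0 _))// ler1n.
    move=> [/andP[-> h]|/andP[h1 ->]]; first by rewrite (le_trans h).
    by rewrite (lt_trans _ h1)// eps0.
  rewrite ge0_integral_setU//=; last 2 first.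
  - by apply: measurable_funS mf.
  - apply/disj_setPS => x /= []; rewrite !in_itv /= => /andP[_ h1] /andP[h2 _].
    by move: h2; rewrite ltNge h1.
  rewrite addeC leeD2l//; apply: (@le_trans _ _ (\int[mu]_(x in `]eps J.+1, eps J]) (c J)%:E)%E).
    rewrite integral_cst//= lebesgue_measure_itv /= lte_fin.
    rewrite [X in if X then _ else _](_ : _ = true); last first.
      by rewrite [X in _ < X]eS ltr_pMl ?eps0// ltr1n.
    by rewrite -EFinB -EFinM lee_fin ler_wpM2l// [X in _ <= X - _]eS; lra.
  apply: ge0_le_integral => //.
  - by move=> x _; rewrite lee_fin.
  - exact: measurable_funS mf.
  - by move=> x /=; rewrite in_itv /= => /andP[? ?]; exact: fc.
have I0 : (0 <= \int[mu]_(x in `]0%R, 1%R]) f x)%E by exact: integral_ge0.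
have Ifin : (\int[mu]_(x in `]0%R, 1%R]) f x)%E \is a fin_num by rewrite ge0_fin_numE.
exists (2 * fine (\int[mu]_(x in `]0%R, 1%R]) f x)%E) => J.
rewrite -ler_pdivrMl// -lee_fin fineK//; apply: le_trans (key J).
rewrite -[leLHS]adde0; apply: leeD; last exact: integral_ge0.
rewrite lee_fin mulr_sumr; apply: ler_sum => j _.
rewrite /c -/(eps j) powRD; last by apply/implyP => _; rewrite gt_eqF.
rewrite powRr1 ?(ltW (eps0 j))// {1}[eps j]eS.
by rewrite le_eqVlt; apply/orP; left; apply/eqP; field.
Qed.

End bracketing_facts.

(** * The hypotheses in the form used above *)

Section array_moments.
Context d (Omega : measurableType d) (R : realType) (P : probability Omega R).
Context d' (X : measurableType d') (Y : nat -> nat -> Omega -> X).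
Hypothesis mY : forall n t, (1 <= t <= n)%N -> measurable_fun setT (Y n t).

Local Notation L1 f := (P.-integrable setT (EFin \o f)).
Local Notation E f := (Rintegral P setT f).

(** A gap [t] admits [t.+1] positions, and gap 0 occurs, so the weights are shifted: the term at 0
    is at most 1, and t + 1 <= 2 t costs [2 ^+ m]. *)
Lemma alpha_weighted_sum (m : nat) (th : R) : 0 <= th ->
  (\sum_(1 <= t <oo) ((t%:R ^+ m)%R%:E * alpha P Y t `^ th) < +oo)%E ->
  exists sa, forall n, \sum_(0 <= t < n) t.+1%:R ^+ m * alphar P Y t `^ th <= sa.
Proof.
move=> th0; set s := (X in (X < _)%E) => soo.
have term t : ((t%:R ^+ m)%R%:E * alpha P Y t `^ th)%E =
    (t%:R ^+ m * alphar P Y t `^ th)%:E.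
  by rewrite alpharE// poweR_EFin -EFinM.
have s0 t : (0 <= (t%:R ^+ m)%R%:E * alpha P Y t `^ th)%E.
  by rewrite term lee_fin mulr_ge0 ?exprn_ge0// powR_ge0.
have sfin : s \is a fin_num by rewrite ge0_fin_numE// nneseries_ge0.
exists (1 + 2 ^+ m * fine s) => n.
have part : \sum_(1 <= t < n.+1) t%:R ^+ m * alphar P Y t `^ th <= fine s.
  rewrite -lee_fin fineK// -sumEFin; under eq_bigr do rewrite -term.
  exact: nneseries_lim_ge.
apply: (@le_trans _ _ (\sum_(0 <= t < n.+1) t.+1%:R ^+ m * alphar P Y t `^ th)).
  by rewrite [leRHS]big_nat_recr//= lerDl mulr_ge0 ?exprn_ge0// powR_ge0.
rewrite big_ltn//; apply: lerD.
  rewrite expr1n mul1r; have /andP[a0 a1] := alphar_bounds P mY 0.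
  have p1 : 1 `^ th = 1 :> R by rewrite powR1.
  by rewrite -[leRHS]p1; apply: ge0_ler_powR; rewrite ?nnegrE.
apply: le_trans (ler_wpM2l (exprn_ge0 _ (ler0n _ 2)) part).
rewrite mulr_sumr; apply: ler_sum_nat => t /andP[t1 _].
rewrite mulrA -exprMn ler_wpM2r ?powR_ge0// lerXn2r ?nnegrE//.
by rewrite -natrM ler_nat; lia.
Qed.

Lemma sup_array_root_le (f : nat -> nat -> \bar R) (eps : R) : 0 <= eps ->
  (forall n t, (0 <= f n t)%E) ->
  (sup_array (fun n t => f n t `^ (2^-1)%R) <= eps%:E)%E ->
  forall n t, (1 <= t <= n)%N -> (f n t <= (eps ^+ 2)%:E)%E.
Proof.
move=> eps0 f0 fe n t tn.
have h : (f n t `^ 2^-1 <= eps%:E)%E.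
  by apply: le_trans fe; apply: ereal_sup_ubound; exists n, t.
rewrite -[f n t]poweRe1// (_ : 1 = 2^-1 * 2%:R); last by rewrite mulVf.
rewrite poweRrM -powR_mulrn// -poweR_EFin; apply: gt0_ler_poweR => //.
- by rewrite in_itv /= poweR_ge0 leey.
- by rewrite in_itv /= lee_fin eps0 leey.
Qed.

Lemma envelope_mean (b : X -> R) eps : 0 < eps -> measurable_fun setT b ->
  (rho P Y b <= eps%:E)%E -> forall n t, (1 <= t <= n)%N ->
  L1 (b \o Y n t) /\ E (b \o Y n t) <= eps.
Proof.
move=> eps0 mb rb n t tn; have mbY := measurable_comp_Y mY tn mb.
have /(_ n t tn) : forall n t, (1 <= t <= n)%N ->
    ('E_P[fun w => (`|b (Y n t w)| ^+ 2)%R] <= (eps ^+ 2)%:E)%E.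
  apply: sup_array_root_le rb; first exact: ltW.
  by move=> n' t'; apply: expectation_ge0 => w; exact: exprn_ge0.
rewrite unlock => h.
have m2 : measurable_fun setT (fun w => `|b (Y n t w)| ^+ 2).
  by apply: measurable_funX; exact: measurableT_comp.
have [b1 bE] := L1_ge0_le m2 (fun w => exprn_ge0 2 (normr_ge0 _)) h.
(* AM-GM: [|b| <= (b^2 / eps + eps) / 2] *)
have amgm w : `|(b \o Y n t) w| <= (2 * eps)^-1 * `|b (Y n t w)| ^+ 2 + eps / 2.
  rewrite /= -subr_ge0; set z := `|_|.
  have -> : (2 * eps)^-1 * z ^+ 2 + eps / 2 - z = (2 * eps)^-1 * (z - eps) ^+ 2.
    by field; rewrite gt_eqF.
  by rewrite mulr_ge0 ?sqr_ge0// invr_ge0 mulr_ge0// ltW.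
have g1 : L1 (fun w => (2 * eps)^-1 * `|b (Y n t w)| ^+ 2 + eps / 2).
  by apply: L1D; [exact: L1Z|exact: L1_cst].
have bY1 : L1 (b \o Y n t) by exact: L1_le g1 amgm.
split=> //; apply: le_trans (ler_norm _) _; apply: le_trans (ler_norm_E bY1 g1 amgm) _.
rewrite ED; [|exact: L1Z|exact: L1_cst].
rewrite EZ// E_cst.
have : (2 * eps)^-1 * E (fun w => `|b (Y n t w)| ^+ 2) <= eps / 2.
  rewrite ler_pdivrMl ?mulr_gt0//; apply: (le_trans bE).
  by rewrite expr2; lra.
by lra.
Qed.

Lemma envelope_moments (b : X -> R) (r eps : R) Q n : 0 < eps ->
  measurable_fun setT b ->
  (forall i, (2 <= i <= Q)%N -> (sup_array (fun n t =>
     'E_P[fun w => (`|b (Y n t w)| `^ (i%:R * r))%R] `^ (2^-1)%R) <= eps%:E)%E) ->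
  moments_le P Y r Q n b (eps ^+ 2).
Proof.
move=> eps0 mb mom t q tn qQ; have mbY := measurable_comp_Y mY tn mb.
have /(_ n t tn) : forall n t, (1 <= t <= n)%N ->
    ('E_P[fun w => (`|b (Y n t w)| `^ (q%:R * r))%R] <= (eps ^+ 2)%:E)%E.
  apply: sup_array_root_le (mom q qQ); first exact: ltW.
  by move=> n' t'; apply: expectation_ge0 => w; exact: powR_ge0.
rewrite unlock => h; apply: L1_ge0_le h => [|w]; last exact: powR_ge0.
apply: (measurableT_comp (measurable_powR _)).
exact: (measurableT_comp (@normr_measurable R setT) mbY).
Qed.

End array_moments.

Local Open Scope ereal_scope.

Theorem corollary2p6 (R : realType)
  (d : measure_display) (Omega : measurableType d) (P : probability Omega R)
  (dX : measure_display) (X : measurableType dX)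
  (Y : nat -> nat -> Omega -> X)
  (mY : forall n t, (1 <= t <= n)%N -> measurable_fun setT (Y n t))
  (F : set (X -> R))
  (mF : forall phi, F phi -> measurable_fun setT phi)
  (intF : forall phi n t, F phi -> (1 <= t <= n)%N ->
    'E_P[fun w => `|phi (Y n t w)|%R] < +oo)
  (gamma : R) (gamma_gt0 : (0 < gamma)%R)
  (Q : nat) (Q_even : ~~ odd Q) (Q_ge2 : (2 <= Q)%N)
  (mixing : strongly_mixing P Y)
  (alpha_summable :
    \sum_(1 <= t <oo)
      ((t%:R ^+ (Q - 2))%R%:E * (alpha P Y t) `^ (gamma / (2 + gamma))%R) < +oo)
  (entropy :
    \int[lebesgue_measure]_(x in `]0%R, 1%R])
      ((x `^ (- (gamma / (2 + gamma))))%R%:E *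
       (bracketing_number F (rho P Y) x) `^ (Q%:R^-1)%R) < +oo)
  (bounding_moments : forall eps : R, (0 < eps)%R ->
    exists (N : nat) (A B : set (X -> R)),
      [/\ (N%:R)%:E = bracketing_number F (rho P Y) eps,
          bracketing F (rho P Y) eps N A B
        & forall i : nat, (2 <= i <= Q)%N -> forall b, B b ->
            sup_array (fun n t =>
              'E_P[fun w => (`|b (Y n t w)| `^ (i%:R * ((2 + gamma) / 2)))%R]
                `^ (2^-1)%R) <= eps%:E])
  (dG : measure_display) (OmegaG : measurableType dG)
  (PG : probability OmegaG R) (G : F -> {RV PG >-> R})
  (gaussG : centered_gaussian_process G)
  (fidi_cvg : forall (K : nat) (phi : 'I_K -> F),
    cvg_in_distribution P PG
      (fun n w => \row_k empirical_process P Y n 1%R (val (phi k)) w)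
      (fun w => \row_k G (phi k) w)) :
  weak_cvg_to_version P PG
    (fun n (phi : F) w => empirical_process P Y n 1%R (val phi) w)
    (fun phi => G phi).
Proof.
have Q0 : (0 < Q%:R :> R)%R by rewrite ltr0n (leq_trans _ Q_ge2).
have g2 : (0 < 2 + gamma)%R by rewrite addr_gt0.
pose r : R := ((2 + gamma) / 2)%R; pose th : R := (gamma / (2 + gamma))%R.
have r1 : (1 < r)%R by rewrite /r ltr_pdivlMr//; lra.
have thE : (1 - r^-1 = th)%R by rewrite /r /th; field; rewrite gt_eqF.
have thE' : (1 - th = r^-1)%R by rewrite -thE; ring.
have th0 : (0 <= th)%R by rewrite divr_ge0 ?ltW.
have [sa hS] := alpha_weighted_sum mY th0 alpha_summable.
rewrite -thE in hS.
have [C C0 HC] := maximal_family mY r1 Q_ge2 Q_even hS.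
pose eps j : R := ((2^-1) ^+ j)%R.
have eps0 j : (0 < eps j)%R by rewrite exprn_gt0.
have /choice[NAB hNAB] : forall j, exists NAB : nat * set (X -> R) * set (X -> R),
    [/\ (NAB.1.1%:R)%:E = bracketing_number F (rho P Y) (eps j),
      bracketing F (rho P Y) (eps j) NAB.1.1 NAB.1.2 NAB.2
      & forall i : nat, (2 <= i <= Q)%N -> forall b, NAB.2 b ->
            sup_array (fun n t =>
              'E_P[fun w => (`|b (Y n t w)| `^ (i%:R * r))%R]
                `^ (2^-1)%R) <= (eps j)%:E].
  by move=> j; have [N [A [B h]]] := bounding_moments (eps j) (eps0 j); exists (N, A, B).
pose N j := (NAB j).1.1.
have br j : exists x : ('I_(N j) -> F) * ('I_(N j) -> X -> R) * (F -> 'I_(N j)) * (F -> 'I_(N j)),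
    (forall i, (NAB j).2 (x.1.1.2 i)) /\
    forall phi z, (`|val phi z - val (x.1.1.1 (x.1.2 phi)) z| <= x.1.1.2 (x.2 phi) z)%R.
  have [_ hb _] := hNAB j; have [a [b [pa [pb h]]]] := bracketing_enum hb.
  by exists (a, b, pa, pb).
pose X_ j := projT1 (cid (br j)).
pose a j := (X_ j).1.1.1; pose b j := (X_ j).1.1.2.
pose pa j := (X_ j).1.2; pose pb j := (X_ j).2.
have bB j i : (NAB j).2 (b j i) by exact: (projT2 (cid (br j))).1.
have bracket j (phi : F) z : (`|val phi z - val (a j (pa j phi)) z| <= b j (pb j phi) z)%R.
  exact: (projT2 (cid (br j))).2.
have mev (phi : F) : measurable_fun setT (val phi) by apply: mF; exact: set_mem (valP phi).
have mb j i : measurable_fun setT (b j i).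
  by have [_ [_ _ _ h _] _] := hNAB j; have [] := h _ (bB j i).
have Mb j i n : moments_le P Y r Q n (b j i) (eps j ^+ 2)%R.
  apply: (envelope_moments mY (eps0 j) (mb j i)) => k kQ.
  by have [_ _ h] := hNAB j; exact: h (bB j i).
have Eb j i n t : (1 <= t <= n)%N -> P.-integrable setT (EFin \o (b j i \o Y n t)) /\
    (Rintegral P setT (b j i \o Y n t) <= eps j)%R.
  apply: (envelope_mean mY (eps0 j) (mb j i)).
  by have [_ [_ _ _ h _] _] := hNAB j; have [_ /ltW] := h _ (bB j i).
have iev (phi : F) n t : (1 <= t <= n)%N -> P.-integrable setT (EFin \o (val phi \o Y n t)).
  move=> tn; have mp := measurable_comp_Y mY tn (mev phi).
  have := intF _ n t (set_mem (valP phi)) tn; rewrite unlock => h.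
  have m1 : measurable_fun setT (fun w => `|val phi (Y n t w)|%R) by exact: measurableT_comp.
  have i1 := L1_ge0_lty m1 (fun w => normr_ge0 _) h.
  by apply: (L1_le mp i1) => w.
have [M hM] : exists M : R, forall J,
    (\sum_(0 <= j < J) (N j)%:R `^ (Q%:R^-1) * eps j `^ r^-1 <= M)%R.
  have q0 : (0 <= Q%:R^-1 :> R)%R by rewrite invr_ge0 ltW.
  (* The dyadic sum carries the exponent [1 - th], which is the [r^-1] of the maximal inequality. *)
  have [|M hM] := @entropy_sum _ X R F (rho P Y) th Q%:R^-1 N th0 q0 _ entropy.
    by move=> j; have [] := hNAB j.
  by exists M => J; rewrite -thE'.
apply: weak_cvg_of_finite_approximation.
- by move=> n phi _; exact: (@measurable_empirical _ _ _ P _ _ _ mY n (val phi) (mev phi)).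
- by move=> phi; exact: measurable_funPT.
(* Sample paths are bounded: at level 0 the condition on [n] is [1 <= n%:R], and [last_link] leaves
   finitely many coordinates. Only the finiteness of [U w] matters here. *)
- move=> n w n0; have n1 : (1 <= n%:R * (eps 0%N `^ r^-1) ^+ 2)%R.
    by rewrite /eps expr0 powR1 expr1n mulr1 ler1n.
  have [U [_ _ _ hU]] := last_link iev mb Mb Eb bracket HC n0 n1.
  have [M0 hM0] := finite_range_bounded
    (fun i => empirical_process P Y n 1%R (val (a 0%N i)) w) (pa 0%N).
  exists (U w + M0)%R => phi.
  rewrite -[X in (`|X| <= _)%R](subrK
    (empirical_process P Y n 1%R (val (a 0%N (pa 0%N phi))) w)).
  by apply: le_trans (ler_normD _ _) _; apply: lerD; [exact: hU|exact: hM0].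
- exact: fidi_cvg.
move=> dlt dlt0.
have [l [n0 h]] := asymptotic_equicontinuity mY r1 mev iev mb Mb Eb bracket C0 HC hM dlt0.
by exists (N l), (a l), (pa l), n0.
Qed.
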